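(* Let $f,g:\mathbb{R}^n\to\mathbb{R}^n$ be $C^\infty$ vector fields with $f(0)=0$, and consider the single-input control-affine system $$\dot x=f(x)+u\,g(x),\qquad (x,u)\in\mathbb{R}^n\times\mathbb{R}. \qquad (\ast)$$ Assume that there exists a smooth, positive definite and proper function $V:\mathbb{R}^n\to\mathbb{R}^+$ such that the following two conditions hold. (1) There exist continuous nonnegative functions $\theta:\mathbb{R}^n\to\mathbb{R}^+$ and $\xi:\mathbb{R}^+\to\mathbb{R}^+$ such that $$|(fV)(\omega)+\theta(\omega)|\le\xi(|\omega|)\,|(gV)(\omega)|,\qquad\forall\omega\in\mathbb{R}^n.$$ (2) For every $x\neq 0$, either $(gV)(x)\neq 0$, or $(gV)(x)=0$ and at least one of the following (A), (B) holds. (A) $(fV)(x)<0$. (B) There exists an integer $N=N(x)\ge 1$ such that $$(\Delta_1\Delta_2\cdots\Delta_kV)(x)=0\quad\text{for all }k=1,2,\dots\text{ and all }\Delta_1,\dots,\Delta_k\in L\{f,g\}\text{ with }\sum_{p=1}^k\mathrm{order}\,\Delta_p\le N,$$ and one of the following two properties P1, P2 is fulfilled: - P1: $(f^{N+1}V)(x)<0$. - P2: $(f^{N+1}V)(x)\le 0$ and, further, one of the following holds: - P2(i): $N$ is a positive integer and there exists an odd integer $j=j(N)\in\{1,\dots,N\}$ such that $(\lambda_{N+1,j}V)(x)\neq 0$; moreover, if $j>2$, then for every even positive integer $q<j$, $$(\Delta_1\cdots\Delta_kV)(x)=0\quad\text{for all }k=1,2,\dots\text{ and all }\Delta_1,\dots,\Delta_k\in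 L\{f,g\}\text{ with }\sum_{p=1}^k\mathrm{order}\,\Delta_p=N+1,\ \sum_{p=1}^k\mathrm{order}_{\{g\}}\Delta_p=q.$$ - P2(ii) (strengthened): $N>2$ is an odd integer, $(\lambda_{N+1,N}V)(x)\neq 0$, and $$(\Delta_1\cdots\Delta_kV)(x)=0\quad\text{for all }k=1,2,\dots\text{ and all }\Delta_1,\dots,\Delta_k\in L\{f,g\}\text{ with }\sum_{p=1}^k\mathrm{order}\,\Delta_p=N+1,\ \sum_{p=1}^k\mathrm{order}_{\{g\}}\Delta_p\le N-1. \qquad (\ast\ast)$$ - P2(iii) (strengthened): $N$ is even, $(\lambda_{N+1,N}V)(x)<0$, and $(\ast\ast)$ holds. Then system $(\ast)$ is BSDF-SGAS.
   Context: Notation. $|x|$ is the Euclidean norm, $\mathbb{R}^+=[0,\infty)$, $\mathbb{N}_0=\{0,1,2,\dots\}$. For $C^1$ maps $X:\mathbb{R}^n\to\mathbb{R}^k$, $Y:\mathbb{R}^k\to\mathbb{R}^l$ write $XY:=(DY)X$, where $DY$ is the derivative of $Y$; in particular, for a vector field $X$ and a scalar function $V$ on $\mathbb{R}^n$, $(XV)(x)=DV(x)X(x)$, and $\Delta_1\Delta_2\cdots\Delta_kV$ means $\Delta_1(\Delta_2(\cdots(\Delta_kV)))$. For vector fields, $[X,Y]:=XY-YX=(DY)X-(DX)Y$. Also $f^1V:=fV$ and $f^iV:=f(f^{i-1}V)$ for $i\geq 2$. $\mathrm{Lie}\{f,g\}$ is the Lie algebra generated by $\{f,g\}$. Order. Let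 $L_1:=\mathrm{span}\{f,g\}$ and $L_{i+1}:=\mathrm{span}\{[X,Y]: X\in L_i,\ Y\in L_1\}$, $i=1,2,\dots$. For nonzero $\Delta\in\mathrm{Lie}\{f,g\}$: $\mathrm{order}\,\Delta:=1$ if $\Delta\in L_1\setminus\{0\}$, and $\mathrm{order}\,\Delta:=k>1$ if $\Delta=\Delta_1+\Delta_2$ with $\Delta_1\in L_k\setminus\{0\}$ and $\Delta_2\in\mathrm{span}\bigcup_{i=1}^{k-1}L_i$. Write $\mathrm{order}_{\{g\}}\Delta=l$, $l\in\mathbb{N}_0$, when $\Delta\in\mathrm{Lie}\{f,g\}$ is contained in the linear span of all Lie monomials of $f$ and $g$ involving $g$ exactly $l$ times. The vector fields $\lambda_{\kappa,j}$ and $L\{f,g\}$. Put $\lambda_{1,0}:=f$, and for $\kappa=2,3,\dots$ and $j=1,\dots,\kappa-1$ let $$\lambda_{\kappa,j}:=\sum_{\substack{r_1,\dots,r_j\in\mathbb{N}_0\\ r_1+\cdots+r_j=\kappa-j-1}} B_{r_1,\dots,r_j},$$ where $B_{r_1,\dots,r_j}$ is the left-nested iterated bracket obtained by starting from $f$ and successively bracketing on the right (i.e. replacing the current $Z$ by $[Z,\cdot]$) with the letters, in this order: $g$, then $f$ ($r_j$ times), then $g$, then $f$ ($r_{j-1}$ times), then $g$, ..., then $f$ ($r_2$ times), then $g$, then $f$ ($r_1$ times) (so $g$ occurs exactly $j$ times). For example $\lambda_{2,1}=[f,g]$, $\lambda_{3,1}=[[f,g],f]$, $\lambda_{3,2}=[[f,g],g]$,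 $\lambda_{4,2}=[[[f,g],f],g]+[[[f,g],g],f]$. Define $$L\{f,g\}:=\mathrm{span}\{\lambda_{\kappa,j}:\ \lambda_{1,0},\ \text{and }\kappa=2,3,\dots,\ j=1,\dots,\kappa-1\}.$$ One has $\mathrm{order}\,\lambda_{\kappa,j}=\kappa$ and $\mathrm{order}_{\{g\}}\lambda_{\kappa,j}=j$. SDF-SGAS. A system $\dot x=F(x,u)$, $(x,u)\in\mathbb{R}^n\times\mathbb{R}^m$, $F(0,0)=0$ (here $F(x,u)=f(x)+ug(x)$, $m=1$) is Semi-Globally Asymptotically Stabilizable by Sampled-Data Feedback (SDF-SGAS) if for every $R>0$ and every partition of times $T_1:=0<T_2<T_3<\cdots<T_\nu<\cdots$ with $T_\nu\to\infty$ and $T_{\nu+1}-T_\nu$, $\nu=1,2,\dots$, bounded, there exist a neighborhood $\Omega$ of $0$ with $\{x\in\mathbb{R}^n:|x|\le R\}\subset\Omega$ and a map $k:\mathbb{R}^+\times\Omega\to\mathbb{R}^m$ such that for each $x\in\Omega$ the map $k(\cdot,x)$ is measurable and essentially bounded, and the trajectories $\pi(\cdot)$ of the sampled-data closed-loop system $\dot\pi=F(\pi,k(t,\pi(T_i)))$, $t\in[T_i,T_{i+1})$, $i=1,2,\dots$, with $\pi(0)\in\Omega$ satisfy: (Stability) for every $\varepsilon>0$ there is $\delta=\delta(\varepsilon)>0$ such that $|\pi(0)|\le\delta\Rightarrow|\pi(t)|\le\varepsilon$ for all $t\ge0$ and any $\pi(0)\in\Omega$; (Attractivity) $\lim_{t\to+\infty}\pi(t)=0$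 for every $\pi(0)\in\Omega$. BSDF-SGAS. The system is bounded SDF-SGAS (BSDF-SGAS) if it is SDF-SGAS and in addition there exists a constant $C=C_\Omega>0$ such that the corresponding map $k:\mathbb{R}^+\times\Omega\to\mathbb{R}^m$ satisfies $|k(t,x)|\le C$ for all $x\in\Omega$ and $t\ge0$ near zero. *)

(* Defs.v *)
From HB Require Import structures.
From mathcomp Require Import all_boot all_order all_algebra.
From mathcomp Require Import all_classical all_reals all_analysis.

Set Implicit Arguments.
Unset Strict Implicit.
Unset Printing Implicit Defensive.

Import Order.TTheory GRing.Theory Num.Theory.
Import numFieldNormedType.Exports.

Local Open Scope classical_set_scope.
Local Open Scope ring_scope.

(* The library norm on ['rV[R]_n] is the sup norm (it induces the usual
   topology), hence a separate Euclidean norm. *)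
Definition enorm (R : realType) (n : nat) (x : 'rV[R]_n) : R :=
  Num.sqrt (\sum_(i < n) x 0 i ^+ 2).

Fixpoint Ck (R : realType) (n : nat) (W : normedModType R) (k : nat)
    (f : 'rV[R]_n -> W) : Prop :=
  if k is k'.+1 then
    (forall x, differentiable f x) /\
    (forall v : 'rV[R]_n, Ck k' (fun x => 'D_v f x))
  else continuous f.

Definition smooth (R : realType) (n : nat) (W : normedModType R)
    (f : 'rV[R]_n -> W) : Prop := forall k, Ck k f.

Definition posdef (R : realType) (n : nat) (V : 'rV[R]_n -> R) : Prop :=
  V 0 = 0 /\ forall x, x != 0 -> 0 < V x.

Definition proper_fun (R : realType) (n : nat) (V : 'rV[R]_n -> R) : Prop :=
  forall K : set R, compact K -> compact (V @^-1` K).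

Section LieCalculus.
Context {R : realType} {n : nat}.
Local Notation vfield := ('rV[R]_n -> 'rV[R]_n).

(* X Y := (DY) X, for [Y] a scalar function or a vector field. *)
Definition lieD {W : normedModType R} (X : vfield) (Y : 'rV[R]_n -> W) :
  'rV[R]_n -> W := fun x => 'd Y x (X x).

Definition bracket (X Y : vfield) : vfield :=
  fun x => lieD X Y x - lieD Y X x.

(* Delta_0 (Delta_1 ( ... (Delta_(k-1) V))) *)
Definition lieDs (k : nat) (Delta : 'I_k -> vfield) (V : 'rV[R]_n -> R) :
  'rV[R]_n -> R := foldr lieD V [seq Delta p | p <- enum 'I_k].

Definition lspan (A : set vfield) : set vfield :=
  [set X | exists (m : nat) (c : 'I_m -> R) (Y : 'I_m -> vfield),
     (forall i, A (Y i)) /\ X = (fun x => \sum_(i < m) c i *: Y i x)].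

Variables f g : vfield.

(* L_i for [i >= 1]; the value at [i = 0] is never used. *)
Fixpoint lie_layer (i : nat) : set vfield :=
  match i with
  | 0 => [set (fun=> 0)]
  | 1 => lspan [set f; g]
  | i'.+1 => lspan [set Z | exists X Y, [/\ lie_layer i' X,
                                           lspan [set f; g] Y
                                         & Z = bracket X Y]]
  end.

(* A relation rather than a function: the same nonzero field may admit several
   decompositions when [f] and [g] satisfy bracket relations. *)
Definition has_order (Delta : vfield) (k : nat) : Prop :=
  Delta <> (fun=> 0) /\
  (k = 1%N /\ lie_layer 1 Delta \/
   (1 < k)%N /\
   exists D1 D2 : vfield,
     [/\ lie_layer k D1, D1 <> (fun=> 0),
         lspan (\bigcup_(i in [set i | (0 < i < k)%N]) lie_layer i) D2
       & Delta = (fun x => D1 x + D2 x)]).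

(* [lie_monomial l X]: [X] is a Lie monomial in [f] and [g], with arbitrary
   bracketing, in which [g] is written exactly [l] times. *)
Inductive lie_monomial : nat -> vfield -> Prop :=
| lie_monomial_f : lie_monomial 0 f
| lie_monomial_g : lie_monomial 1 g
| lie_monomial_bracket l1 l2 X Y :
    lie_monomial l1 X -> lie_monomial l2 Y ->
    lie_monomial (l1 + l2) (bracket X Y).

Definition has_order_g (Delta : vfield) (l : nat) : Prop :=
  lspan [set X | lie_monomial l X] Delta.

(* B_(r_1,...,r_j): the exponents are consumed in the order r_j, ..., r_1, each
   one contributing a letter [g] and then [r_i] letters [f]. *)
Definition nested_bracket (r : seq nat) : vfield :=
  foldl (fun Z m => iter m (fun Z' => bracket Z' f) (bracket Z g)) f (rev r).

(* The exponents are bounded by [kappa] only to make the index type finite: the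
   constraint on their sum already forces it. For [kappa = 1], [j = 0] this is
   the one-term sum [f]. *)
Definition lambda (kappa j : nat) : vfield := fun x =>
  \sum_(r : {ffun 'I_j -> 'I_kappa} |
        (\sum_(i < j) r i == kappa - j - 1)%N)
    nested_bracket [seq nat_of_ord (r i) | i <- enum 'I_j] x.

Definition Lfg : set vfield :=
  lspan [set X | X = lambda 1 0 \/
                 exists kappa j : nat, (1 <= j < kappa)%N /\ X = lambda kappa j].

(* (Delta_1 ... Delta_k V)(x) = 0 for all k >= 1 and Delta_p in L{f,g} with
   [C] (sum of the orders). *)
Definition vanish_order (V : 'rV[R]_n -> R) (x : 'rV[R]_n) (C : nat -> Prop) :
    Prop :=
  forall (k : nat) (Delta : 'I_k -> vfield) (o : 'I_k -> nat),
    (0 < k)%N ->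
    (forall p, Lfg (Delta p)) ->
    (forall p, has_order (Delta p) (o p)) ->
    C (\sum_(p < k) o p)%N ->
    lieDs Delta V x = 0.

(* The same with [C] (sum of the orders) (sum of the g-orders). *)
Definition vanish_orders (V : 'rV[R]_n -> R) (x : 'rV[R]_n)
    (C : nat -> nat -> Prop) : Prop :=
  forall (k : nat) (Delta : 'I_k -> vfield) (o l : 'I_k -> nat),
    (0 < k)%N ->
    (forall p, Lfg (Delta p)) ->
    (forall p, has_order (Delta p) (o p)) ->
    (forall p, has_order_g (Delta p) (l p)) ->
    C (\sum_(p < k) o p)%N (\sum_(p < k) l p)%N ->
    lieDs Delta V x = 0.

Definition P2i (V : 'rV[R]_n -> R) (x : 'rV[R]_n) (N : nat) : Prop :=
  (0 < N)%N /\
  exists j : nat,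
    [/\ odd j, (1 <= j <= N)%N, lieD (lambda N.+1 j) V x != 0
      & (2 < j)%N -> forall q : nat, (0 < q < j)%N -> ~~ odd q ->
          vanish_orders V x (fun o l => o = N.+1 /\ l = q)].

Definition P2star (V : 'rV[R]_n -> R) (x : 'rV[R]_n) (N : nat) : Prop :=
  vanish_orders V x (fun o l => o = N.+1 /\ (l <= N - 1)%N).

Definition P2ii (V : 'rV[R]_n -> R) (x : 'rV[R]_n) (N : nat) : Prop :=
  [/\ (2 < N)%N, odd N, lieD (lambda N.+1 N) V x != 0 & P2star V x N].

Definition P2iii (V : 'rV[R]_n -> R) (x : 'rV[R]_n) (N : nat) : Prop :=
  [/\ ~~ odd N, lieD (lambda N.+1 N) V x < 0 & P2star V x N].

Definition condB (V : 'rV[R]_n -> R) (x : 'rV[R]_n) : Prop :=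
  exists N : nat,
    [/\ (1 <= N)%N,
        vanish_order V x (fun o => (o <= N)%N)
      & iter N.+1 (lieD f) V x < 0 \/
        (iter N.+1 (lieD f) V x <= 0 /\
         [\/ P2i V x N, P2ii V x N | P2iii V x N])].

End LieCalculus.

Section SampledData.
Context {R : realType} {n m : nat}.
Local Notation state := 'rV[R]_n.
Local Notation input := 'rV[R]_m.
Local Notation mu := (@lebesgue_measure R).

(* [T i] is the sampling time usually numbered T_(i+1). *)
Definition time_partition (T : nat -> R) : Prop :=
  [/\ T 0%N = 0,
      (forall i, T i < T i.+1),
      T i @[i --> \oo] --> +oo
    & exists M : R, forall i, T i.+1 - T i <= M].

(* Caratheodory solution on [0, +oo) of the sampled-data closed loop: on each
   sampling interval, componentwise,
     pi t = pi (T i) + \int_(T i)^t F (pi s) (k s (pi (T i))) ds.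
   Membership of the sampled states in [Omega] is part of the definition, since
   the feedback is only meaningful there; only the values of [pi] and [k] at
   times [t >= 0] are used. *)
Definition trajectory (F : state -> input -> state) (T : nat -> R)
    (Omega : set state) (k : R -> state -> input) (pi : R -> state) : Prop :=
  forall i : nat,
    Omega (pi (T i)) /\
    forall t : R, T i <= t <= T i.+1 -> forall j : 'I_n,
      let h := fun s => F (pi s) (k s (pi (T i))) 0 j in
      mu.-integrable `[T i, t] (EFin \o h) /\
      pi t 0 j = pi (T i) 0 j + (\int[mu]_(s in `[T i, t]) h s)%R.

(* Global existence is required explicitly, so that "every trajectory" is not
   vacuous. When [F] is locally Lipschitz in the state and continuous,
   trajectories are unique, so this excludes finite escape time and exit of a
   sampled state from [Omega]. *)
Definition stabilizing_feedback (F : state -> input -> state) (T : nat -> R)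
    (Omega : set state) (k : R -> state -> input) : Prop :=
  [/\ (forall x, Omega x ->
         (forall j, measurable_fun (`[0, +oo[ : set R) (fun t : R => k t x 0 j : R)) /\
         exists M : R, {ae mu, forall t, 0 <= t -> enorm (k t x) <= M}),
      (forall x, Omega x ->
         exists pi, trajectory F T Omega k pi /\ pi 0 = x),
      (forall eps : R, 0 < eps -> exists2 delta : R, 0 < delta &
         forall pi, trajectory F T Omega k pi -> enorm (pi 0) <= delta ->
           forall t, 0 <= t -> enorm (pi t) <= eps)
    & (forall pi, trajectory F T Omega k pi -> pi t @[t --> +oo] --> (0 : state))].

Definition SDF_SGAS (F : state -> input -> state) : Prop :=
  forall (r : R) (T : nat -> R), 0 < r -> time_partition T ->
    exists (Omega : set state) (k : R -> state -> input),
      [/\ nbhs (0 : state) Omega, [set x | enorm x <= r] `<=` Omega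
        & stabilizing_feedback F T Omega k].

(* [SDF_SGAS] with a feedback that is moreover bounded on
   [0, tau] x Omega for some tau > 0. *)
Definition BSDF_SGAS (F : state -> input -> state) : Prop :=
  forall (r : R) (T : nat -> R), 0 < r -> time_partition T ->
    exists (Omega : set state) (k : R -> state -> input),
      [/\ nbhs (0 : state) Omega, [set x | enorm x <= r] `<=` Omega,
          stabilizing_feedback F T Omega k
        & exists C : R, 0 < C /\ exists2 tau : R, 0 < tau &
            forall t x, 0 <= t <= tau -> Omega x -> enorm (k t x) <= C].

End SampledData.

(* Main.v *)
(** At a point [x <> 0] where (B) holds, run [Z = f + u g] for a time [e] and then
    [f + v g] for a time [t e], where [v = - u / t]. The second stage is the flow of
    [Y = t (f + v g)] for the time [e], and [Z + Y = s f] with [s = 1 + t], so the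
    coefficients of [V] in powers of [e] satisfy a recursion which expresses them
    through iterated derivatives along the fields [lambda_(k, j)] only: this is
    where [L{f,g}] comes from. The coefficients up to order [N] vanish by (B), and
    the one of order [N + 1] is a polynomial in [u] and [s] that P1 or P2 makes
    negative somewhere. Taylor's formula turns this into a decrease of [V] along
    genuine trajectories, locally uniformly in the starting point; by compactness
    of the sublevel sets of [V], there are open-loop controls with a common bound
    that decrease [V] at a uniform rate above each level.

    The feedback only sees the states at the sampling times, while these controls
    last longer than a sampling interval. Sampling intervals are therefore grouped
    into windows of increasing length, and at each sampling time one replans until
    the end of the current window, choosing a plan whose score (the index of the
    sublevel set that the plan reaches) is maximal. The tail of a plan is again a
    plan of the same score, so the score never decreases along a trajectory, and
    long windows force it to increase without bound. *)
Require Import Defs.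
From mathcomp Require Import all_boot all_order all_algebra.
From mathcomp Require Import all_classical all_reals all_analysis.
From mathcomp Require Import measurable_function measurable_realfun.
From mathcomp Require Import ring lra zify.
Import Order.TTheory GRing.Theory Num.Theory.
Import numFieldNormedType.Exports.
Set Implicit Arguments.
Unset Strict Implicit.
Unset Printing Implicit Defensive.
Local Open Scope classical_set_scope.
Local Open Scope ring_scope.

(** * Calculus of smooth functions and vector fields *)

Section SmoothFunctions.
Context {R : realType} {n : nat}.
Local Notation state := 'rV[R]_n.
Local Notation vfield := (state -> state).
Implicit Types (h : state -> R) (X Y Z : vfield).

(** Two parameters are needed because they count different things: in the coefficient of order
    [N.+1] the power of [u] records how often [g] occurs, the power of [s] how many fields are
    composed. The part linear in [s] isolates the single fields [lambda N.+1 j], so the compositions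
    of shorter fields with an odd number of [g], which P2(i) leaves free, cannot cancel it for every
    [s]. A feedback sees only the time and the last sample, so it cannot remember which plan it was
    following. An integer score makes the greedy choice consistent: a bounded set of integers has a
    maximum, whereas the infimum of a real cost need not be attained. Along a plan [V] may rise
    before it falls, so a plan of score [m] is allowed to climb to level [m - 1]. This loss does not
    accumulate, because the plan must come back to level [m] at the end of its window. The levels
    are indexed by [int] and accumulate at 0 and at [c]: every point of the open sublevel set then
    has a level, and there is always a next level above it to absorb the overshoot. *)

Lemma CkW (W : normedModType R) k (h : state -> W) : Ck k.+1 h -> Ck k h.
Proof.
elim: k h => [|k IH] h /= [dh Dh].
  by move=> x; exact: differentiable_continuous.
by split => // v; exact: IH.
Qed.

Lemma CkD k h1 h2 : Ck k h1 -> Ck k h2 -> Ck k (h1 + h2).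
Proof.
elim: k h1 h2 => [|k IH] h1 h2 /=.
  by move=> c1 c2 x; apply: continuousD; [exact: c1|exact: c2].
move=> [d1 D1] [d2 D2]; split=> [x|v]; first exact: differentiableD.
rewrite (_ : (fun _ => _) = (fun x => 'D_v h1 x) + (fun x => 'D_v h2 x)).
  exact: IH.
by apply/funext => x; rewrite deriveD//; exact: diff_derivable.
Qed.

Lemma CkM k h1 h2 : Ck k h1 -> Ck k h2 -> Ck k (h1 * h2).
Proof.
elim: k h1 h2 => [|k IH] h1 h2.
  by move=> c1 c2 x; apply: continuousM; [exact: c1|exact: c2].
move=> C1 C2; have [d1 D1] := C1; have [d2 D2] := C2.
split=> [x|v]; first exact: differentiableM.
rewrite (_ : (fun _ => _) =
    h1 * (fun x => 'D_v h2 x) + h2 * (fun x => 'D_v h1 x)).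
  by apply: CkD; apply: IH; [exact: CkW C1|exact: D2|exact: CkW C2|exact: D1].
by apply/funext => x; rewrite deriveM; [|exact: diff_derivable..].
Qed.

Lemma Ck_cst k (c : R) : Ck k (cst c : state -> R).
Proof.
elim: k c => [|k IH] c /=; first exact: cst_continuous.
split=> [x|v]; first exact: differentiable_cst.
rewrite (_ : (fun _ => _) = cst 0); first exact: IH.
by apply/funext => x; rewrite derive_cst.
Qed.

Lemma smoothD h1 h2 : smooth h1 -> smooth h2 -> smooth (h1 + h2).
Proof. by move=> s1 s2 k; exact: CkD. Qed.

Lemma smoothM h1 h2 : smooth h1 -> smooth h2 -> smooth (h1 * h2).
Proof. by move=> s1 s2 k; exact: CkM. Qed.

Lemma smooth_cst (c : R) : smooth (cst c : state -> R).
Proof. by move=> k; exact: Ck_cst. Qed.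

Lemma smoothZ (c : R) h : smooth h -> smooth (c *: h).
Proof. by move=> sh; exact: (smoothM (smooth_cst c) sh). Qed.

Lemma smoothB h1 h2 : smooth h1 -> smooth h2 -> smooth (h1 - h2).
Proof.
by move=> s1 s2; rewrite -scaleN1r; apply: smoothD => //; exact: smoothZ.
Qed.

Lemma smooth_sum (I : Type) (r : seq I) (P : pred I) (F : I -> state -> R) :
  (forall i, P i -> smooth (F i)) -> smooth (\sum_(i <- r | P i) F i).
Proof.
move=> sF; apply: (big_ind (@smooth R n R)) => //; first exact: smooth_cst.
exact: smoothD.
Qed.

Lemma smooth_differentiable (W : normedModType R) (h : state -> W) x :
  smooth h -> differentiable h x.
Proof. by move=> /(_ 1%N) []. Qed.

Lemma smooth_continuous (W : normedModType R) (h : state -> W) :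
  smooth h -> continuous h.
Proof. exact: (fun sh => sh 0%N). Qed.

Lemma smooth_derive (W : normedModType R) (h : state -> W) v :
  smooth h -> smooth (fun x => 'D_v h x).
Proof. by move=> sh k; have [_ /(_ v)] := sh k.+1. Qed.

Definition coord_fun X (j : 'I_n) : state -> R := fun x => X x 0 j.

(** Smoothness is taken componentwise because the identities below are proved for scalar functions;
    brackets then remain smooth through [bracket_coord]. *)
Definition smooth_field X := forall j, smooth (coord_fun X j).

Lemma diff_coord_fun X j x v :
  differentiable X x -> 'd (coord_fun X j) x v = 'd X x v 0 j.
Proof.
move=> dX.
have dXj : differentiable (coord_fun X j) x.
  exact: (differentiable_comp dX (differentiable_coord _ _ _)).
rewrite -!deriveE// derive_mx ?mxE//; exact: diff_derivable.
Qed.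

Lemma CkS_coord X k j : Ck k X -> Ck k (coord_fun X j).
Proof.
elim: k X => [|k IH] X /=.
  move=> cX x; apply: (@continuous_comp _ _ _ X (fun y : state => y 0 j)).
    exact: cX.
  exact: coord_continuous.
move=> [dX DX]; split=> [x|v].
  exact: (differentiable_comp (dX x) (differentiable_coord _ _ _)).
rewrite (_ : (fun _ => _) = coord_fun (fun x => 'D_v X x) j); first exact: IH.
apply/funext => x; rewrite deriveE ?diff_coord_fun//.
  by rewrite /coord_fun deriveE.
exact: (differentiable_comp (dX x) (differentiable_coord _ _ _)).
Qed.

Lemma smooth_smooth_field X : smooth X -> smooth_field X.
Proof. by move=> sX j k; exact: CkS_coord. Qed.

Lemma smooth_field_differentiable X x : smooth_field X -> differentiable X x.
Proof.
move=> sX; rewrite (_ : X = \sum_(j < n) (fun x => coord_fun X j x *: delta_mx 0 j)).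
  apply: differentiable_sum => j; apply: differentiableZl.
  exact: smooth_differentiable.
by apply/funext => y; rewrite fct_sumE [LHS]row_sum_delta.
Qed.

Lemma lieD_coord X h : smooth h ->
  lieD X h = \sum_(i < n) coord_fun X i * (fun x => 'D_(delta_mx 0 i) h x).
Proof.
move=> sh; apply/funext => x; rewrite fct_sumE /lieD.
rewrite [X in 'd h x X]row_sum_delta linear_sum /=; apply: eq_bigr => i _.
rewrite linearZ/= [RHS]/(_ * _) deriveE //; exact: smooth_differentiable.
Qed.

Lemma smooth_lieD X h : smooth_field X -> smooth h -> smooth (lieD X h).
Proof.
move=> sX sh; rewrite lieD_coord//; apply: smooth_sum => i _.
by apply: smoothM => //; exact: smooth_derive.
Qed.

Lemma lieDDr_at (W : normedModType R) X (h1 h2 : state -> W) x :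
  differentiable h1 x -> differentiable h2 x ->
  lieD X (h1 + h2) x = lieD X h1 x + lieD X h2 x.
Proof. by move=> d1 d2; exact: (congr1 (@^~ (X x)) (diffD d1 d2)). Qed.

Lemma lieDZr_at (W : normedModType R) X (c : R) (h : state -> W) x :
  differentiable h x -> lieD X (c *: h) x = c *: lieD X h x.
Proof. by move=> d1; exact: (congr1 (@^~ (X x)) (diffZ c d1)). Qed.

Lemma lieDDl_at (W : normedModType R) X Y (h : state -> W) x :
  lieD (X + Y) h x = lieD X h x + lieD Y h x.
Proof. exact: (linearD ('d h x)). Qed.

Lemma lieDZl_at (W : normedModType R) (c : R) X (h : state -> W) x :
  lieD (c *: X) h x = c *: lieD X h x.
Proof. by rewrite /lieD [LHS]linearZ. Qed.

Lemma lieDDr X h1 h2 : smooth h1 -> smooth h2 ->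
  lieD X (h1 + h2) = lieD X h1 + lieD X h2.
Proof.
move=> s1 s2; apply/funext => x; rewrite lieDDr_at//; exact: smooth_differentiable.
Qed.

Lemma lieDZr X (c : R) h : smooth h -> lieD X (c *: h) = c *: lieD X h.
Proof.
by move=> s1; apply/funext => x; rewrite lieDZr_at//; exact: smooth_differentiable.
Qed.

Lemma lieD_cst X (c : R) : lieD X (cst c) = 0.
Proof. by apply/funext => x; rewrite /lieD diff_cst. Qed.

Lemma lieDr0 X : lieD X (0 : state -> R) = 0.
Proof. exact: lieD_cst. Qed.

Lemma lieD_sumr (I : Type) (r : seq I) (P : pred I) (F : I -> state -> R) X :
  (forall i, P i -> smooth (F i)) ->
  lieD X (\sum_(i <- r | P i) F i) = \sum_(i <- r | P i) lieD X (F i).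
Proof.
move=> sF; suff [] : lieD X (\sum_(i <- r | P i) F i) =
    \sum_(i <- r | P i) lieD X (F i) /\ smooth (\sum_(i <- r | P i) F i) by [].
apply: (big_ind2 (fun u v => lieD X u = v /\ smooth u)).
- by split; [exact: lieDr0|exact: smooth_cst].
- move=> u1 v1 u2 v2 [<- su1] [<- su2].
  by split; [exact: lieDDr|exact: smoothD].
- by move=> i Pi; split => //; exact: sF.
Qed.

Lemma lieDDl X Y h : lieD (X + Y) h = lieD X h + lieD Y h.
Proof. by apply/funext => x; rewrite /lieD [LHS]linearD. Qed.

Lemma lieDZl (c : R) X h : lieD (c *: X) h = c *: lieD X h.
Proof. by apply/funext => x; rewrite /lieD [LHS]linearZ. Qed.

Lemma lieD0l h : lieD (0 : vfield) h = 0.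
Proof. by apply/funext => x; rewrite /lieD [LHS]linear0. Qed.

Lemma lieD_suml (I : Type) (r : seq I) (P : pred I) (F : I -> vfield) h :
  lieD (\sum_(i <- r | P i) F i) h = \sum_(i <- r | P i) lieD (F i) h.
Proof.
apply: (big_ind2 (fun u v => lieD u h = v)) => //; first exact: lieD0l.
by move=> u1 v1 u2 v2 <- <-; exact: lieDDl.
Qed.

Lemma smooth_fieldD X Y : smooth_field X -> smooth_field Y -> smooth_field (X + Y).
Proof.
move=> sX sY j; rewrite (_ : coord_fun _ _ = coord_fun X j + coord_fun Y j).
  exact: smoothD.
by apply/funext => x; rewrite /coord_fun mxE.
Qed.

Lemma smooth_fieldZ (c : R) X : smooth_field X -> smooth_field (c *: X).
Proof.
move=> sX j; rewrite (_ : coord_fun _ _ = c *: coord_fun X j).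
  exact: smoothZ.
by apply/funext => x; rewrite /coord_fun mxE.
Qed.

Lemma smooth_field0 : smooth_field 0.
Proof.
move=> j; rewrite (_ : coord_fun _ _ = cst 0); first exact: smooth_cst.
by apply/funext => x; rewrite /coord_fun mxE.
Qed.

Lemma bracket_coord X Y j : smooth_field X -> smooth_field Y ->
  coord_fun (bracket X Y) j = lieD X (coord_fun Y j) - lieD Y (coord_fun X j).
Proof.
move=> sX sY; apply/funext => x; rewrite /coord_fun /bracket !mxE.
rewrite [RHS]/(_ - _) /lieD !diff_coord_fun//.
all: exact: smooth_field_differentiable.
Qed.

Lemma smooth_bracket X Y :
  smooth_field X -> smooth_field Y -> smooth_field (bracket X Y).
Proof.
by move=> sX sY j; rewrite bracket_coord//; apply: smoothB; exact: smooth_lieD.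
Qed.

Lemma bracketDl X Y Z : smooth_field X -> smooth_field Y ->
  bracket (X + Y) Z = bracket X Z + bracket Y Z.
Proof.
move=> sX sY; apply/funext => x.
have := @lieDDr_at _ Z _ _ x (smooth_field_differentiable x sX)
  (smooth_field_differentiable x sY).
by rewrite [RHS]/(_ + _) /bracket lieDDl_at => ->; rewrite opprD addrACA.
Qed.

Lemma bracketZl (c : R) X Y : smooth_field X ->
  bracket (c *: X) Y = c *: bracket X Y.
Proof.
move=> sX; apply/funext => x.
have := @lieDZr_at _ Y c _ x (smooth_field_differentiable x sX).
by rewrite [RHS]/(_ *: _) /bracket lieDZl_at => ->; rewrite scalerBr.
Qed.

Lemma bracketC X Y : bracket X Y = - bracket Y X.
Proof. by apply/funext => x; exact: (esym (opprB (lieD Y X x) (lieD X Y x))). Qed.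

Lemma bracketDr X Y Z : smooth_field Y -> smooth_field Z ->
  bracket X (Y + Z) = bracket X Y + bracket X Z.
Proof. by move=> sY sZ; rewrite !(bracketC X) bracketDl// opprD. Qed.

Lemma bracketZr (c : R) X Y : smooth_field Y ->
  bracket X (c *: Y) = c *: bracket X Y.
Proof. by move=> sY; rewrite !(bracketC X) bracketZl// scalerN. Qed.

Lemma bracketXX X : bracket X X = 0.
Proof. by apply/funext => x; rewrite /bracket subrr. Qed.

Lemma bracket0l X : bracket 0 X = 0.
Proof. by rewrite -[0 in LHS](scale0r 0) bracketZl ?scale0r//; exact: smooth_field0. Qed.

End SmoothFunctions.

(** * Symmetry of second derivatives; the bracket as a commutator *)

Section Commutator.
Context {R : realType} {n : nat}.
Local Notation state := 'rV[R]_n.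
Local Notation vfield := (state -> state).
Implicit Types (h : state -> R) (X Y Z : vfield).

Lemma is_derive_line (W : normedModType R) (h : state -> W) (y v : state) (t : R) :
  differentiable h (y + t *: v) ->
  is_derive t 1 (fun r : R => h (y + r *: v)) ('D_v h (y + t *: v)).
Proof.
move=> dh; have Dh := diff_derivable (v := v) dh.
suff E : (fun r : R => r^-1 *: (((fun r : R => h (y + r *: v)) \o shift t) (r *: 1)
    - h (y + t *: v))) = (fun r : R => r^-1 *: ((h \o shift (y + t *: v)) (r *: v)
    - h (y + t *: v))).
  by split; rewrite /derivable /derive E.
apply/funext => r /=; rewrite /shift/=; congr (_ *: (h _ - _)).
by rewrite scalerDl [r *: 1]mulr1 addrCA.
Qed.

Lemma directional_MVT h (y v : state) (s : R) : 0 <= s -> smooth h ->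
  exists2 t : R, t \in `[0, s]%R & h (y + s *: v) - h y = 'D_v h (y + t *: v) * s.
Proof.
move=> s0 sh.
have dl (t : R) : is_derive t 1 (fun r : R => h (y + r *: v)) ('D_v h (y + t *: v)).
  by apply: is_derive_line; exact: smooth_differentiable.
have [] := @MVT_segment R (fun r => h (y + r *: v))
  (fun t => 'D_v h (y + t *: v)) 0 s s0.
  apply: derivable_within_continuous => t _.
  exact: (@ex_derive _ _ _ _ _ _ _ (dl t)).
by move=> t ts; rewrite scale0r addr0 subr0 => E; exists t.
Qed.

Lemma derive_translate (W : normedModType R) (h : state -> W) (a w y : state) :
  'D_w (fun z => h (z + a)) y = 'D_w h (y + a).
Proof.
suff E : (fun r : R => r^-1 *: (((fun z => h (z + a)) \o shift y) (r *: w) - h (y + a))) =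
    (fun r : R => r^-1 *: ((h \o shift (y + a)) (r *: w) - h (y + a))).
  by rewrite /derive E.
by apply/funext => r /=; rewrite /shift/= addrA.
Qed.

(** Two mean value theorems: along [v] for the increment of [h] under the shift [s *: u], then along
    [u] for the derivative of [h] in the direction [v]. The second difference is symmetric in [u]
    and [v], which [derive_comm] exploits. *)
Lemma second_difference h (x u v : state) (s : R) : 0 <= s -> smooth h ->
  exists a b : R, [/\ a \in `[0, s]%R, b \in `[0, s]%R &
    h (x + s *: u + s *: v) - h (x + s *: u) - h (x + s *: v) + h x =
    'D_u (fun y => 'D_v h y) (x + a *: u + b *: v) * s * s].
Proof.
move=> s0 sh.
pose h' : state -> R := (fun y => h (y + s *: u)) - h.
have sh' : smooth h'.
  apply: smoothB => // k; move: (sh k) => {h' sh}.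
  elim: k h => [|k IH] h /=.
    move=> ch y; apply: (@continuous_comp _ _ _ (fun z : state => z + s *: u) h).
      by apply: (@continuousD _ _ _ id (cst _)); [exact: cvg_id|exact: cst_continuous].
    exact: ch.
  move=> [dh Dh].
  have ds y : differentiable (fun z : state => z + s *: u) y.
    by apply: differentiableD => //; exact: differentiable_cst.
  split=> [y|w].
    exact: (differentiable_comp (ds y) (dh (y + s *: u))).
  rewrite (_ : (fun _ => _) = fun y => 'D_w h (y + s *: u)).
    exact: (IH (fun y => 'D_w h y)).
  by apply: funext => y; exact: derive_translate.
have [b bs E] := directional_MVT x v s0 sh'.
have [a as_ E2] := directional_MVT (x + b *: v) u s0 (smooth_derive v sh).
exists a, b; split => //.
have -> : h (x + s *: u + s *: v) - h (x + s *: u) - h (x + s *: v) + h x =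
    h' (x + s *: v) - h' x.
  rewrite /h' /= -![(_ - _ : _ -> _) _]/(_ - _) (addrAC x (s *: v)); ring.
rewrite E; congr (_ * _).
rewrite (addrAC x (a *: u)) -E2.
rewrite /h' deriveB; first last.
- by apply: diff_derivable; exact: smooth_differentiable.
- apply: diff_derivable; apply: (differentiable_comp (f := fun z : state => z + s *: u)).
    by apply: differentiableD => //; exact: differentiable_cst.
  exact: smooth_differentiable.
by rewrite derive_translate.
Qed.

(** Schwarz's theorem: the same second difference, divided by [s * s], is a value of either mixed
    derivative at a point close to [x], and both derivatives are continuous. *)
Lemma derive_comm h (u v x : state) : smooth h ->
  'D_u (fun y => 'D_v h y) x = 'D_v (fun y => 'D_u h y) x.
Proof.
move=> sh.
pose A : state -> R := fun y => 'D_u (fun y => 'D_v h y) y.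
pose B : state -> R := fun y => 'D_v (fun y => 'D_u h y) y.
change (A x = B x).
have sA : smooth A by do 2! apply: smooth_derive.
have sB : smooth B by do 2! apply: smooth_derive.
pose S (s : R) := h (x + s *: u + s *: v) - h (x + s *: u) - h (x + s *: v) + h x.
have SA (s : R) : 0 <= s -> exists a b : R, [/\ a \in `[0, s]%R, b \in `[0, s]%R &
    S s = A (x + a *: u + b *: v) * s * s].
  by move=> s0; exact: second_difference.
have SB (s : R) : 0 <= s -> exists a b : R, [/\ a \in `[0, s]%R, b \in `[0, s]%R &
    S s = B (x + a *: v + b *: u) * s * s].
  move=> s0; rewrite /S (addrAC x (s *: u)) (addrAC (h _)).
  exact: second_difference.
clearbody A B S.
suff : `|A x - B x| <= 0 by rewrite normr_le0 subr_eq0 => /eqP.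
apply/ler_addgt0Pl => e e0; rewrite addr0.
have e2 : 0 < e / 2 by rewrite divr_gt0.
have := smooth_continuous sA; move=> /(_ x) /cvgrPdist_le /(_ _ e2) /nbhs_ballP[d1 /= d10 Hd1].
have := smooth_continuous sB; move=> /(_ x) /cvgrPdist_le /(_ _ e2) /nbhs_ballP[d2 /= d20 Hd2].
pose d : R := Num.min d1 d2.
have d0 : 0 < d by rewrite lt_min d10.
pose c : R := `|u| + `|v| + 1.
have c0 : 0 < c by rewrite ltr_wpDl// addr_ge0.
(* With this choice the intermediate points are within [s * c], that is [d / 2], of [x]. *)
pose s : R := d / (2 * c).
have s0 : 0 < s by rewrite divr_gt0// mulr_gt0.
have near_x (a b : R) : a \in `[0, s]%R -> b \in `[0, s]%R -> `|a *: u + b *: v| < d.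
  rewrite !in_itv/= => /andP[a0 as_] /andP[b0 bs].
  apply: (@le_lt_trans _ _ (s * c)).
    apply: (le_trans (ler_normD _ _)); rewrite !normrZ !ger0_norm//.
    rewrite /c !mulrDr ler_wpDr ?mulr1 ?(ltW s0)//.
    by apply: lerD; exact: ler_wpM2r.
  rewrite /s invfM mulrA -mulrA mulVf ?gt_eqF// mulr1.
  by rewrite ltr_pdivrMr// ltr_pMr// ltr1n.
have [a [b [as_ bs E1]]] := SA s (ltW s0).
have [b' [a' [bs' as' E2]]] := SB s (ltW s0).
have : A (x + a *: u + b *: v) = B (x + b' *: v + a' *: u).
  apply: (@mulIf _ (s * s)); first by rewrite mulf_neq0 ?gt_eqF.
  by clearbody s; rewrite !mulrA -E1 E2.
move=> EAB.
have HA : `|A x - A (x + a *: u + b *: v)| <= e / 2.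
  apply: Hd1; rewrite -ball_normE/= -addrA opprD addNKr normrN.
  by rewrite (lt_le_trans (near_x _ _ as_ bs))// ge_min lexx.
have HB : `|B x - B (x + b' *: v + a' *: u)| <= e / 2.
  apply: Hd2; rewrite -ball_normE/= -addrA opprD addNKr normrN addrC.
  by rewrite (lt_le_trans (near_x _ _ as' bs'))// ge_min lexx orbT.
rewrite (splitr e).
have -> : A x - B x = (A x - A (x + a *: u + b *: v)) - (B x - B (x + b' *: v + a' *: u)).
  rewrite EAB; ring.
by rewrite (le_trans (ler_normB _ _))// lerD.
Qed.

Lemma lieDM X h1 h2 : smooth h1 -> smooth h2 ->
  lieD X (h1 * h2) = h1 * lieD X h2 + h2 * lieD X h1.
Proof.
move=> s1 s2; apply/funext => x.
exact: (congr1 (@^~ (X x)) (diffM (smooth_differentiable x s1)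
  (smooth_differentiable x s2))).
Qed.

(** In coordinates the second-order terms of both compositions involve the symmetric matrix [H i j]
    and cancel. The first-order terms remain, and their coefficients are the coordinates of the
    bracket. *)
Lemma lieD_bracket X Y h : smooth_field X -> smooth_field Y -> smooth h ->
  lieD X (lieD Y h) - lieD Y (lieD X h) = lieD (bracket X Y) h.
Proof.
move=> sX sY sh.
pose d i : state -> R := fun x => 'D_(delta_mx 0 i) h x.
have sd i : smooth (d i) by exact: smooth_derive.
pose H i j : state -> R := fun x => 'D_(delta_mx 0 j) (d i) x.
have expand Z1 Z2 : smooth_field Z1 -> smooth_field Z2 ->
    lieD Z1 (lieD Z2 h) = \sum_(i < n) d i * lieD Z1 (coord_fun Z2 i) +
    \sum_(i < n) \sum_(j < n) coord_fun Z2 i * (coord_fun Z1 j * H i j).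
  move=> sZ1 sZ2; rewrite (lieD_coord _ sh) lieD_sumr => [|i _]; last first.
    by apply: smoothM => //; exact: sd.
  rewrite -big_split/=; apply: eq_bigr => i _.
  rewrite lieDM//; last exact: sd.
  by rewrite (lieD_coord _ (sd i)) mulr_sumr addrC.
rewrite !expand//.
have -> : \sum_(i < n) \sum_(j < n) coord_fun X i * (coord_fun Y j * H i j) =
   \sum_(i < n) \sum_(j < n) coord_fun Y i * (coord_fun X j * H i j).
  rewrite exchange_big/=; apply: eq_bigr => i _; apply: eq_bigr => j _.
  rewrite mulrCA; suff -> : H i j = H j i by [].
  by apply/funext => x; exact: derive_comm.
have cancel_r (a b c : state -> R) : (a + b) - (c + b) = a - c.
  by rewrite opprD addrACA subrr addr0.
rewrite cancel_r (lieD_coord _ sh) -sumrB; apply: eq_bigr => i _.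
by rewrite bracket_coord// -mulrBr mulrC.
Qed.

End Commutator.

(** * The fields lambda: recursion on the last letter, orders, words *)

Section LambdaFields.
Context {R : realType} {n : nat}.
Local Notation state := 'rV[R]_n.
Local Notation vfield := (state -> state).
Variables f g : vfield.
Hypotheses (sf : smooth_field f) (sg : smooth_field g).
Implicit Types (X Y Z : vfield) (A B : set vfield).

Lemma bracket_suml (I : Type) (r : seq I) (P : pred I) (F : I -> vfield) X :
  (forall i, P i -> smooth_field (F i)) ->
  bracket (\sum_(i <- r | P i) F i) X = \sum_(i <- r | P i) bracket (F i) X.
Proof.
move=> sF; suff [] : bracket (\sum_(i <- r | P i) F i) X =
    \sum_(i <- r | P i) bracket (F i) X /\
    smooth_field (\sum_(i <- r | P i) F i) by [].
apply: (big_ind2 (fun u v => bracket u X = v /\ smooth_field u)).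
- by split; [exact: bracket0l|exact: smooth_field0].
- move=> u1 v1 u2 v2 [<- su1] [<- su2].
  by split; [exact: bracketDl|exact: smooth_fieldD].
- by move=> i Pi; split => //; exact: sF.
Qed.

(* [lam k j] is the field written [lambda_(k+1, j)] in the paper. *)
Fixpoint lam (k j : nat) : vfield :=
  match k, j with
  | 0, 0 => f
  | 0, _ => 0
  | k'.+1, 0 => bracket (lam k' 0) f
  | k'.+1, j'.+1 => bracket (lam k' j'.+1) f + bracket (lam k' j') g
  end.

Lemma smooth_lam k j : smooth_field (lam k j).
Proof.
elim: k j => [|k IH] [|j] /=; [exact: sf|exact: smooth_field0| |].
  exact: smooth_bracket.
by apply: smooth_fieldD; apply: smooth_bracket.
Qed.

Lemma lamS0 k : lam k.+1 0 = 0.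
Proof.
by elim: k => [|k IH]; [exact: bracketXX|rewrite /= in IH *; rewrite IH bracket0l].
Qed.

Lemma lam_gt k j : (k < j)%N -> lam k j = 0.
Proof.
elim: k j => [|k IH] [|j]//= kj; rewrite !IH ?bracket0l ?addr0//.
exact: ltn_trans kj.
Qed.

Let adf (m : nat) X := iter m (fun Z => bracket Z f) X.

Let smooth_adf m X : smooth_field X -> smooth_field (adf m X).
Proof. by move=> sX; elim: m => //= m IH; exact: smooth_bracket. Qed.

Let adf_sum m (I : Type) (r : seq I) (P : pred I) (F : I -> vfield) :
  (forall i, P i -> smooth_field (F i)) ->
  adf m (\sum_(i <- r | P i) F i) = \sum_(i <- r | P i) adf m (F i).
Proof.
move=> sF; elim: m => //= m ->; rewrite bracket_suml// => i Pi.
by apply: smooth_adf; exact: sF.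
Qed.

Let lamSS k j : lam k.+1 j.+1 = bracket (lam k j.+1) f + bracket (lam k j) g.
Proof. by []. Qed.

(** The recursion of [lam] is unfolded along the trailing letters [f] down to the last [g]; [i] is
    the exponent $r_1$ of the letters [f] after this [g]. *)
Lemma lam_expand j m : lam (j.+1 + m) j.+1 =
  \sum_(i < m.+1) iter i (fun Z => bracket Z f) (bracket (lam (j + (m - i)) j) g).
Proof.
elim: m => [|m IH].
  by rewrite addn0 big_ord1 /= addn0 lam_gt// bracket0l add0r.
rewrite addnS lamSS IH bracket_suml => [|i _]; last first.
  by apply: smooth_adf; apply: smooth_bracket => //; exact: smooth_lam.
by rewrite [RHS]big_ord_recl subn0 addrC /= addnS.
Qed.

Lemma nested_bracket_cons r rs : nested_bracket f g (r :: rs) =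
  iter r (fun Z => bracket Z f) (bracket (nested_bracket f g rs) g).
Proof. by rewrite /nested_bracket rev_cons -cats1 foldl_cat. Qed.

Lemma smooth_nested_bracket rs : smooth_field (nested_bracket f g rs).
Proof.
elim: rs => [|r rs IH]; first exact: sf.
by rewrite nested_bracket_cons; apply: smooth_adf; exact: smooth_bracket.
Qed.

Let nbf K j (r : {ffun 'I_j -> 'I_K}) :=
  nested_bracket f g [seq nat_of_ord (r i) | i <- enum 'I_j].

Let ffun_cons K j (p : 'I_K * {ffun 'I_j -> 'I_K}) : {ffun 'I_j.+1 -> 'I_K} :=
  [ffun i => if unlift ord0 i is Some i' then p.2 i' else p.1].

Let ffun_cons_bij K j : bijective (@ffun_cons K j).
Proof.
exists (fun r : {ffun 'I_j.+1 -> 'I_K} => (r ord0, [ffun i => r (lift ord0 i)])).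
  move=> [a r]; rewrite /ffun_cons /= ffunE unlift_none/=; congr pair.
  by apply/ffunP => i; rewrite !ffunE liftK.
move=> r; apply/ffunP => i; rewrite /ffun_cons ffunE /=.
by case: unliftP => [i' ->|->//]; rewrite ffunE.
Qed.

(** The head of the list is $r_1$, the exponent of the outermost letters, so splitting it off
    matches [lam_expand] and the induction runs on [j]. The bound [K] is separate from [m] because
    the induction hypothesis is used for smaller sums over the same index type. *)
Lemma sum_nested_bracket K j m : (m < K)%N ->
  \sum_(r : {ffun 'I_j -> 'I_K} | (\sum_(i < j) r i == m)%N) nbf r = lam (j + m) j.
Proof.
elim: j m => [|j IH] m mK.
  rewrite (eq_bigl (fun r => m == 0%N)) => [|r]; last by rewrite big_ord0 eq_sym.
  rewrite (eq_bigr (fun=> f)) => [|r _]; last first.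
    by rewrite /nbf (size0nil (s := enum 'I_0)) ?size_enum_ord.
  have c1 : #|{: {ffun 'I_0 -> 'I_K}}| = 1%N by rewrite card_ffun !card_ord expn0.
  case: m mK => [|m] _; last by rewrite big_pred0 // add0n lamS0.
  by rewrite sumr_const /= c1.
rewrite lam_expand (reindex _ (onW_bij _ (@ffun_cons_bij K j))).
have E a r : (\sum_(i < j.+1) ffun_cons (a, r) i = a + \sum_(i < j) r i)%N.
  rewrite big_ord_recl /ffun_cons ffunE unlift_none /=; congr addn.
  by apply: eq_bigr => i _; rewrite ffunE liftK.
have E2 a r : nbf (ffun_cons (a, r)) =
    iter a (fun Z => bracket Z f) (bracket (nbf r) g).
  rewrite -nested_bracket_cons /nbf; congr (nested_bracket f g _).
  rewrite enum_ordSl /= -map_comp ffunE unlift_none; congr cons.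
  by apply: eq_map => i /=; rewrite ffunE liftK.
rewrite (eq_bigl (fun p : 'I_K * {ffun 'I_j -> 'I_K} => xpredT p.1 && ((p.1 + \sum_(i < j) p.2 i)%N == m))); last first.
  by move=> [a r] /=; rewrite E.
rewrite (eq_bigr (fun p : 'I_K * {ffun 'I_j -> 'I_K} => iter p.1 (fun Z => bracket Z f) (bracket (nbf p.2) g))); last first.
  by move=> [a r] _; exact: E2.
rewrite -(pair_big_dep xpredT (fun (a : 'I_K) (r : {ffun 'I_j -> 'I_K}) =>
   (a + \sum_(i < j) r i)%N == m) (fun (a : 'I_K) r => iter a (fun Z => bracket Z f) (bracket (nbf r) g))).
rewrite (big_ord_widen K (fun i => iter i (fun Z => bracket Z f) (bracket (lam (j + (m - i)) j) g)))//.
rewrite [RHS]big_mkcond; apply: eq_bigr => a _; rewrite ltnS.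
case: leqP => am; last first.
  rewrite big_pred0// => r; apply/negbTE; rewrite neq_ltn; apply/orP; right.
  by rewrite (leq_trans am)// leq_addr.
rewrite -IH; last by rewrite (leq_ltn_trans (leq_subr _ _)).
rewrite bracket_suml => [|r _]; last exact: smooth_nested_bracket.
rewrite -/(adf _ _) adf_sum => [|r _]; last first.
  by apply: smooth_bracket => //; exact: smooth_nested_bracket.
apply: eq_bigl => r; rewrite -(eqn_add2l a (\sum_(i < j) r i)%N) subnKC//.
Qed.

Lemma lambdaE k j : (j <= k)%N -> lambda f g k.+1 j = lam k j.
Proof.
move=> jk; rewrite -[in RHS](subnKC jk) -(@sum_nested_bracket k.+1) ?ltnS ?leq_subr//.
apply/funext => x; rewrite fct_sumE /lambda; apply: eq_bigl => r.
by rewrite subSn// subn1.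
Qed.

Lemma lspan_mem A X : A X -> lspan A X.
Proof.
move=> AX; exists 1%N, (fun=> 1), (fun=> X); split => //.
by apply/funext => x; rewrite big_ord1 scale1r.
Qed.

Lemma lspan0 A : lspan A 0.
Proof.
exists 0%N, (fun=> 0), (fun=> 0); split; first by case.
by apply/funext => x; rewrite big_ord0.
Qed.

Lemma lspanD A X Y : lspan A X -> lspan A Y -> lspan A (X + Y).
Proof.
move=> [m1 [c1 [Y1 [A1 ->]]]] [m2 [c2 [Y2 [A2 ->]]]].
exists (m1 + m2)%N, (fun i => match fintype.split i with inl a => c1 a | inr b => c2 b end),
  (fun i => match fintype.split i with inl a => Y1 a | inr b => Y2 b end); split.
  by move=> i; case: fintype.split.
apply/funext => x; rewrite big_split_ord /=; congr (_ + _).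
  by apply: eq_bigr => i _; rewrite (unsplitK (inl _ i)).
by apply: eq_bigr => i _; rewrite (unsplitK (inr _ i)).
Qed.

Lemma lspan_bracket A B X Y : (forall Z, A Z -> smooth_field Z /\ B (bracket Z Y)) ->
  lspan A X -> lspan B (bracket X Y).
Proof.
move=> AB [m [c [F [AF ->]]]].
exists m, c, (fun i => bracket (F i) Y); split; first by move=> i; have [] := AB _ (AF i).
have -> : (fun x => \sum_(i < m) c i *: F i x) = \sum_(i < m) c i *: F i.
  by apply/funext => x; rewrite fct_sumE.
rewrite bracket_suml => [|i _]; last first.
  by apply: smooth_fieldZ; have [] := AB _ (AF i).
apply/funext => x; rewrite fct_sumE; apply: eq_bigr => i _.
by rewrite bracketZl//; have [] := AB _ (AF i).
Qed.

Lemma lie_layer_lam k j : lie_layer f g k.+1 (lam k j).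
Proof.
have Lf : lspan [set f; g] f by apply: lspan_mem; left.
have Lg : lspan [set f; g] g by apply: lspan_mem; right.
elim: k j => [|k IH] j.
  by case: j => [|j]; [exact: Lf|exact: lspan0].
rewrite [lie_layer _ _ _]/=.
case: j => [|j]; [|apply: lspanD]; apply: lspan_mem;
  [exists (lam k 0), f|exists (lam k j.+1), f|exists (lam k j), g].
all: by split => //; exact: IH.
Qed.

Lemma smooth_lie_monomial l X : lie_monomial f g l X -> smooth_field X.
Proof. by elim=> // *; exact: smooth_bracket. Qed.

Lemma has_order_g_lam k j : has_order_g f g (lam k j) j.
Proof.
have stepf l X : has_order_g f g X l -> has_order_g f g (bracket X f) l.
  apply: lspan_bracket => Z mZ; split; first exact: smooth_lie_monomial mZ.
  by have := lie_monomial_bracket mZ (lie_monomial_f f g); rewrite addn0.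
have stepg l X : has_order_g f g X l -> has_order_g f g (bracket X g) l.+1.
  apply: lspan_bracket => Z mZ; split; first exact: smooth_lie_monomial mZ.
  by have := lie_monomial_bracket mZ (lie_monomial_g f g); rewrite addn1.
elim: k j => [|k IH] [|j] /=.
- by apply: lspan_mem; exact: lie_monomial_f.
- exact: lspan0.
- exact: stepf.
- by apply: lspanD; [exact: stepf|exact: stepg].
Qed.

Lemma has_order_lam k j : lam k j <> 0 -> has_order f g (lam k j) k.+1.
Proof.
move=> l0; split => //; case: k l0 => [|k] l0.
  by left; split => //; exact: lie_layer_lam.
right; split => //; exists (lam k.+1 j), 0; split => //.
- exact: lie_layer_lam.
- exact: lspan0.
- by apply/funext => x; rewrite addr0.
Qed.

Lemma Lfg_lam k j : lam k j <> 0 -> Lfg f g (lam k j).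
Proof.
move=> l0; apply: lspan_mem.
case: (leqP j k) => jk; last by case: l0; exact: lam_gt.
case: j k jk l0 => [|j] [|k] jk l0.
- by left; rewrite lambdaE.
- by case: l0; exact: lamS0.
- by [].
- by right; exists k.+2, j.+1; rewrite lambdaE.
Qed.

Definition lie_word (w : seq (nat * nat)) (V : state -> R) : state -> R :=
  foldr (fun p h => lieD (lam p.1 p.2) h) V w.

Lemma smooth_lie_word w V : smooth V -> smooth (lie_word w V).
Proof.
move=> sV; elim: w => //= p w IH; apply: smooth_lieD => //; exact: smooth_lam.
Qed.

(** The hypothesis speaks only of nonzero fields, since only these have an order. A word that
    contains a zero field annihilates [V] by linearity, whence the case distinction. *)
Lemma vanish_lie_word (V : state -> R) x (C : nat -> nat -> Prop) w :
  vanish_orders f g V x C -> w != [::] ->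
  C (\sum_(p <- w) p.1.+1)%N (\sum_(p <- w) p.2)%N -> lie_word w V x = 0.
Proof.
move=> vC w0 Cw.
have [/existsP[i /asboolP Hi]|] :=
    boolP [exists i : 'I_(size w), `[< lam (nth (0%N, 0%N) w i).1 (nth (0%N, 0%N) w i).2 = 0 >]].
  suff -> : lie_word w V = 0 by [].
  have := mem_nth (0%N, 0%N) (ltn_ord i).
  move: (nth _ _ _) Hi => p Hp; elim: w {w0 Cw i} => //= q w IH.
  rewrite inE => /predU1P[<-|/IH ->]; first by rewrite Hp lieD0l.
  by rewrite lieDr0.
rewrite negb_exists => /forallP /= nz.
have nz' (i : 'I_(size w)) :
    lam (nth (0%N, 0%N) w i).1 (nth (0%N, 0%N) w i).2 <> 0.
  by have := nz i; move=> /asboolP.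
have := vC (size w) (fun i => lam (nth (0%N, 0%N) w i).1 (nth (0%N, 0%N) w i).2)
  (fun i => (nth (0, 0) w i).1.+1)%N (fun i => (nth (0, 0) w i).2)%N.
rewrite lt0n size_eq0 => /(_ w0 (fun i => Lfg_lam (nz' i))
  (fun i => has_order_lam (nz' i)) (fun i => has_order_g_lam _ _)).
rewrite (big_nth (0%N, 0%N)) big_mkord (big_nth (0%N, 0%N)) big_mkord in Cw.
move=> /(_ Cw) <-; rewrite /lieDs.
congr (_ x); rewrite /lie_word -{1}(mkseq_nth (0%N, 0%N) w) /mkseq.
by rewrite -val_enum_ord -map_comp !foldr_map.
Qed.

End LambdaFields.

(** * Formal expansion along two successive flows *)

Section CompositionOfFlows.
Context {R : realType} {n : nat}.
Local Notation state := 'rV[R]_n.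
Local Notation vfield := (state -> state).
Implicit Types (X Y Z : vfield) (h V : state -> R).

(** The Taylor coefficient of order [i] of [h] along the flow of [Z]. *)
Definition lie_exp Z i h : state -> R := i`!%:R^-1 *: iter i (lieD Z) h.

(* The coefficient of [e^k] in the formal expansion of [V] along the flow of
   [Z] for time [e] followed by the flow of [Y] for time [e]. *)
Definition flow_coef Z Y V k : state -> R :=
  \sum_(i < k.+1) lie_exp Z i (lie_exp Y (k - i) V).

Lemma smooth_iter_lieD Z i h :
  smooth_field Z -> smooth h -> smooth (iter i (lieD Z) h).
Proof. by move=> sZ sh; elim: i => //= i; exact: smooth_lieD. Qed.

Lemma smooth_lie_exp Z i h : smooth_field Z -> smooth h -> smooth (lie_exp Z i h).
Proof. by move=> sZ sh; apply: smoothZ; exact: smooth_iter_lieD. Qed.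

Lemma lie_expZ Z i (c : R) h : smooth_field Z -> smooth h ->
  lie_exp Z i (c *: h) = c *: lie_exp Z i h.
Proof.
move=> sZ sh; rewrite /lie_exp scalerA mulrC -scalerA; congr (_ *: _).
by elim: i => //= i ->; rewrite lieDZr//; exact: smooth_iter_lieD.
Qed.

Lemma lie_expD Z i h1 h2 : smooth_field Z -> smooth h1 -> smooth h2 ->
  lie_exp Z i (h1 + h2) = lie_exp Z i h1 + lie_exp Z i h2.
Proof.
move=> sZ s1 s2; rewrite /lie_exp -scalerDr; congr (_ *: _).
by elim: i => //= i ->; rewrite lieDDr//; exact: smooth_iter_lieD.
Qed.

Lemma lie_exp0 Z h : lie_exp Z 0 h = h.
Proof. by rewrite /lie_exp fact0 invr1 scale1r. Qed.

Lemma lie_expSr Z i h : i.+1%:R *: lie_exp Z i.+1 h = lie_exp Z i (lieD Z h).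
Proof.
rewrite /lie_exp scalerA factS natrM invfM mulrA divff ?pnatr_eq0// mul1r.
by rewrite iterSr.
Qed.

Lemma lie_expS Z i h : smooth_field Z -> smooth h ->
  i.+1%:R *: lie_exp Z i.+1 h = lieD Z (lie_exp Z i h).
Proof.
move=> sZ sh; rewrite /lie_exp scalerA factS natrM invfM mulrA divff ?pnatr_eq0//.
by rewrite mul1r lieDZr//; exact: smooth_iter_lieD.
Qed.

(** Coefficients of exp(-t). The sign arises because the brackets below have [Z] on the right, and
    $[X,Z]=-\mathrm{ad}_Z X$. *)
Let cf (l : nat) : R := (-1) ^+ l / l`!%:R.

Let cfS l : cf l.+1 * l.+1%:R = - cf l.
Proof.
rewrite /cf exprS factS natrM; field.
by rewrite nat1r !pnatr_eq0 -lt0n fact_gt0.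
Qed.

(** Coefficientwise form of $e^{tZ}X=(e^{t\,\mathrm{ad}_Z}X)\,e^{tZ}$. The induction step moves one
    more [Z] past [r l], at the cost of the bracket [r l.+1]. *)
Lemma lie_exp_comm Z X i h : smooth_field Z -> smooth_field X -> smooth h ->
  lie_exp Z i (lieD X h) = \sum_(l < i.+1)
    cf l *: lieD (iter l (fun X' => bracket X' Z) X) (lie_exp Z (i - l) h).
Proof.
move=> sZ sX sh; pose r l := iter l (fun X' => bracket X' Z) X.
have sr l : smooth_field (r l) by elim: l => //= l IHl; exact: smooth_bracket.
elim: i => [|i IH].
  by rewrite big_ord1 subn0 !lie_exp0 /cf expr0 fact0 divr1 scale1r.
have i0 : (i.+1%:R : R) != 0 by rewrite pnatr_eq0.
apply: (scalerI i0); rewrite lie_expS//; last exact: smooth_lieD.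
rewrite IH lieD_sumr => [|l _]; last first.
  by apply: smoothZ; apply: smooth_lieD; [exact: sr|exact: smooth_lie_exp].
have swap l : lieD Z (lieD (r l) (lie_exp Z (i - l) h)) =
    (i - l).+1%:R *: lieD (r l) (lie_exp Z (i - l).+1 h) - lieD (r l.+1) (lie_exp Z (i - l) h).
  have sl : smooth (lie_exp Z (i - l) h) by exact: smooth_lie_exp.
  rewrite -[lieD (r l.+1) _](lieD_bracket (sr l) sZ sl) -lie_expS//.
  have -> : lieD (r l) ((i - l).+1%:R *: lie_exp Z (i - l).+1 h) =
      (i - l).+1%:R *: lieD (r l) (lie_exp Z (i - l).+1 h).
    by apply: lieDZr; exact: smooth_lie_exp.
  by rewrite opprB addrC subrK.
under eq_bigr => l _.
  rewrite lieDZr; last by apply: smooth_lieD; [exact: sr|exact: smooth_lie_exp].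
  rewrite swap scalerBr scalerA.
  over.
rewrite sumrB scaler_sumr.
(* The weight [i.+1] is split as [(i.+1 - l) + l]: the first part collects the terms in which [Z]
   has passed through, the second the new brackets, shifted by one index. *)
pose a l := lieD (r l) (lie_exp Z (i.+1 - l) h).
rewrite [RHS](eq_bigr (fun l : 'I_i.+2 => (cf l * (i.+1 - l)%:R) *: a l + (cf l * l%:R) *: a l)); last first.
  move=> l _; rewrite -scalerDl -mulrDr scalerA -natrD subnK 1?mulrC//.
  by rewrite -ltnS.
rewrite big_split /=; congr (_ + _).
  rewrite [RHS]big_ord_recr /= subnn mulr0 scale0r addr0; apply: eq_bigr => l _.
  by rewrite /a subSn// -ltnS.
rewrite [RHS]big_ord_recl mulr0 scale0r add0r -sumrN; apply: eq_bigr => l _.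
by rewrite /= cfS /a /bump add1n subSS scaleNr.
Qed.

Lemma sum_triangle (T : nmodType) (F : nat -> nat -> T) k :
  \sum_(i < k.+1) \sum_(l < i.+1) F i l =
  \sum_(l < k.+1) \sum_(i < (k - l).+1) F (l + i)%N l.
Proof.
elim: k => [|k IH]; first by rewrite !big_ord1.
rewrite big_ord_recr /= IH [RHS]big_ord_recr /= subnn big_ord1 addn0.
rewrite [X in _ + X = _]big_ord_recr /= addrA -big_split /=; congr (_ + _).
apply: eq_bigr => l _; have lk : (l <= k)%N by rewrite -ltnS.
by rewrite subSn// [RHS]big_ord_recr /= addnS subnKC.
Qed.

(* [d/de (e^(eZ) e^(eY)) = s e^(eZ) f e^(eY)] and [e^(eZ) f e^(-eZ) =
   exp (e ad Z) f], read off coefficientwise. *)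
Lemma flow_coef_rec Z Y X (s : R) V k :
  smooth_field Z -> smooth_field Y -> smooth_field X -> smooth V ->
  Y = s *: X - Z ->
  k.+1%:R *: flow_coef Z Y V k.+1 = s *: \sum_(l < k.+1)
    cf l *: lieD (iter l (fun X' => bracket X' Z) X) (flow_coef Z Y V (k - l)).
Proof.
move=> sZ sY sX sV YE.
have step : k.+1%:R *: flow_coef Z Y V k.+1 =
    s *: \sum_(i < k.+1) lie_exp Z i (lieD X (lie_exp Y (k - i) V)).
  rewrite /flow_coef scaler_sumr.
  (* The weight [k.+1] is split as [i + (k.+1 - i)], from differentiating the first and the second
     exponential. Both derivatives land between the two exponentials, where they add up to [Z + Y],
     that is [s *: X]. *)
  pose b i := lie_exp Z i (lie_exp Y (k.+1 - i) V).
  rewrite (eq_bigr (fun i : 'I_k.+2 => i%:R *: b i + (k.+1 - i)%:R *: b i)); last first.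
    by move=> i _; rewrite -scalerDl -natrD subnKC// -ltnS.
  rewrite big_split /= big_ord_recl scale0r add0r.
  rewrite [X in _ + X]big_ord_recr /= subnn scale0r addr0 -big_split scaler_sumr.
  apply: eq_bigr => i _; rewrite /= /b /bump add1n subSS lie_expSr.
  have ik : (i <= k)%N by rewrite -ltnS.
  rewrite subSn// -(lie_expZ _ (k - i).+1%:R sZ); last exact: smooth_lie_exp.
  rewrite lie_expS// -lie_expD//; last 2 first.
    by apply: smooth_lieD => //; exact: smooth_lie_exp.
    by apply: smooth_lieD => //; exact: smooth_lie_exp.
  rewrite -lieDDl -lie_expZ//; last by apply: smooth_lieD => //; exact: smooth_lie_exp.
  by rewrite -lieDZl YE addrC subrK.
rewrite step; congr (_ *: _).
under eq_bigr => i _ do rewrite (lie_exp_comm _ sZ sX (smooth_lie_exp _ sY sV)).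
rewrite (sum_triangle (fun i l => cf l *: lieD (iter l (fun X' => bracket X' Z) X)
   (lie_exp Z (i - l) (lie_exp Y (k - i) V)))).
apply: eq_bigr => l _; rewrite lieD_sumr => [|i _]; last first.
  by apply: smooth_lie_exp => //; exact: smooth_lie_exp.
rewrite scaler_sumr; apply: eq_bigr => i _.
by rewrite addKn subnDA.
Qed.

Lemma flow_coef0 Z Y V : flow_coef Z Y V 0 = V.
Proof. by rewrite /flow_coef big_ord1 !lie_exp0. Qed.

End CompositionOfFlows.

(** * Expansion into words in the fields lambda *)

Section WordExpansion.
Context {R : realType} {n : nat}.
Local Notation state := 'rV[R]_n.
Local Notation vfield := (state -> state).
Variables f g : vfield.
Hypotheses (sf : smooth_field f) (sg : smooth_field g).
Variable V : state -> R.
Hypothesis sV : smooth V.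

(** Each bracket with [f + u *: g] appends a letter [f], or a letter [g] with a factor [u]; sorted
    by powers of [u], this is the recursion of [lam]. *)
Lemma iter_bracket_lam (u : R) l :
  iter l (fun X => bracket X (f + u *: g)) f = \sum_(j < l.+1) u ^+ j *: lam f g l j.
Proof.
have sl k j : smooth_field (lam f g k j) by exact: smooth_lam.
elim: l => [|l IH]; first by rewrite big_ord1 /= expr0 scale1r.
rewrite iterS IH bracket_suml => [|j _]; last exact: smooth_fieldZ.
rewrite (eq_bigr (fun j : 'I_l.+1 => u ^+ j *: bracket (lam f g l j) f +
   u ^+ j.+1 *: bracket (lam f g l j) g)); last first.
  move=> j _; rewrite bracketZl// bracketDr//; last exact: smooth_fieldZ.
  by rewrite bracketZr// scalerDr scalerA -exprSr.
rewrite big_split /= [RHS]big_ord_recl.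
rewrite [X in _ = _ + X](eq_bigr (fun j : 'I_l.+1 => u ^+ j.+1 *: bracket (lam f g l j.+1) f +
   u ^+ j.+1 *: bracket (lam f g l j) g)); last first.
  by move=> j _; rewrite -scalerDr.
rewrite big_split /= addrA; congr (_ + _).
(* The two sums differ by a top term, which vanishes because [lam l l.+1] would have more letters
   [g] than brackets. *)
have shift_sum (a : nat -> vfield) : a l.+1 = 0 ->
    \sum_(i < l.+1) a i = a 0%N + \sum_(i < l.+1) a i.+1.
  move=> a0; transitivity (\sum_(i < l.+2) a i); last by rewrite big_ord_recl.
  by rewrite [RHS]big_ord_recr /= a0 addr0.
apply: (shift_sum (fun i => u ^+ i *: bracket (lam f g l i) f)).
by rewrite lam_gt// bracket0l scaler0.
Qed.

(* Weighted words [(c, w)] of total order [k]; [N >= k] is fuel. *)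
Fixpoint words (N k : nat) : seq (R * seq (nat * nat)) :=
  match k, N with
  | 0, _ => [:: (1, [::])]
  | _.+1, 0 => [::]
  | k'.+1, N'.+1 =>
      flatten [seq flatten [seq
        [seq ((-1) ^+ l / l`!%:R / k'.+1%:R * p.1, (l, j) :: p.2) | p <- words N' (k' - l)]
        | j <- iota 0 l.+1] | l <- iota 0 k'.+1]
  end.

Let coef k l : R := (-1) ^+ l / l`!%:R / k.+1%:R.

Let wordsE N k : words N.+1 k.+1 = flatten [seq flatten [seq
   [seq (coef k l * p.1, (l, j) :: p.2) | p <- words N (k - l)]
        | j <- index_iota 0 l.+1] | l <- index_iota 0 k.+1].
Proof. by []. Qed.

Lemma big_words (T : nmodType) N k (F : R * seq (nat * nat) -> T) :
  \sum_(p <- words N.+1 k.+1) F p = \sum_(l < k.+1) \sum_(j < l.+1)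
    \sum_(p <- words N (k - l)) F (coef k l * p.1, (nat_of_ord l, nat_of_ord j) :: p.2).
Proof.
rewrite wordsE big_flatten big_map big_mkord; apply: eq_bigr => l _.
rewrite big_flatten big_map big_mkord; apply: eq_bigr => j _.
by rewrite big_map.
Qed.

Lemma mem_words N k l j q : (l <= k)%N -> (j <= l)%N -> q \in words N (k - l) ->
  (coef k l * q.1, (l, j) :: q.2) \in words N.+1 k.+1.
Proof.
move=> lk jl qw; pose F l j := [seq (coef k l * p.1, (l, j) :: p.2) | p <- words N (k - l)].
pose G l := flatten [seq F l j | j <- index_iota 0 l.+1].
rewrite wordsE; apply/flattenP; exists (G l).
  by apply: (map_f G); rewrite mem_index_iota.
apply/flattenP; exists (F l j); first by apply: (map_f (F l)); rewrite mem_index_iota.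
by apply/mapP; exists q.
Qed.

Lemma wordsP N k p : p \in words N.+1 k.+1 -> exists l j q,
  [/\ (l <= k)%N, (j <= l)%N, q \in words N (k - l) &
      p = (coef k l * q.1, (l, j) :: q.2)].
Proof.
rewrite wordsE.
move=> /flattenP[s1 /mapP[l + ->] /flattenP[s2 /mapP[j + ->] /mapP[q qw ->]]].
rewrite !mem_index_iota !ltnS => /andP[_ lk] /andP[_ jl].
by exists l, j, q.
Qed.

Definition gord (w : seq (nat * nat)) : nat := \sum_(p <- w) p.2.
Definition ford (w : seq (nat * nat)) : nat := \sum_(p <- w) p.1.+1.

(** Each use of [flow_coef_rec] peels off one letter [(l, j)] of order [l.+1], with a factor
    [u ^+ j] and one factor [s]. Hence the exponent of [u] is the number of [g], that of [s] the
    length of the word. *)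
Lemma flow_coef_words (u s : R) N k : (k <= N)%N ->
  flow_coef (f + u *: g) (s *: f - (f + u *: g)) V k =
  \sum_(p <- words N k) (p.1 * u ^+ gord p.2 * s ^+ size p.2) *: lie_word f g p.2 V.
Proof.
set Z := f + u *: g; set Y := s *: f - Z.
have sZ : smooth_field Z by apply: smooth_fieldD => //; exact: smooth_fieldZ.
have sY : smooth_field Y.
  rewrite /Y -scaleN1r; apply: smooth_fieldD; exact: smooth_fieldZ.
elim: N k => [|N IH] [|k] // kN.
- by rewrite flow_coef0 /= big_seq1 /gord big_nil !expr0 !mulr1 scale1r.
- by rewrite flow_coef0 /= big_seq1 /gord big_nil !expr0 !mulr1 scale1r.
have k0 : (k.+1%:R : R) != 0 by rewrite pnatr_eq0.
apply: (scalerI k0); rewrite (flow_coef_rec _ sZ sY sf sV (erefl _)).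
rewrite big_words !scaler_sumr; apply: eq_bigr => l _.
have lk : (l <= k)%N by rewrite -ltnS.
rewrite IH; last by rewrite (leq_trans (leq_subr _ _)).
rewrite iter_bracket_lam lieD_suml !scaler_sumr; apply: eq_bigr => j _.
rewrite lieD_sumr => [|p _]; last by apply: smoothZ; exact: smooth_lie_word.
rewrite !scaler_sumr; apply: eq_bigr => p _ /=.
rewrite lieDZl lieDZr; last exact: smooth_lie_word.
rewrite !scalerA; congr (_ *: _).
rewrite /gord big_cons exprD exprS /= -!/(gord _).
rewrite /coef; set F := (_ / l`!%:R); field.
by rewrite nat1r k0.
Qed.

Lemma words_ford N k p : p \in words N k -> ford p.2 = k.
Proof.
elim: N k p => [|N IH] [|k] p.
- by rewrite inE => /eqP -> /=; rewrite /ford big_nil.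
- by rewrite in_nil.
- by rewrite inE => /eqP -> /=; rewrite /ford big_nil.
move=> /wordsP[l [j [q [lk _ /IH qk ->]]]].
by rewrite /= /ford big_cons /= -/(ford _) qk addSn subnKC.
Qed.

(** A letter [(l, j)] has order [l.+1] and [j <= l], so every letter spends at least one unit of
    order on something other than a counted [g]. In total order [N.+1], a word with [N] occurrences
    of [g] has therefore a single letter; P2(iii) rests on this. *)
Lemma words_gord N k p : p \in words N k -> (gord p.2 + size p.2 <= k)%N.
Proof.
elim: N k p => [|N IH] [|k] p.
- by rewrite inE => /eqP -> /=; rewrite /gord big_nil.
- by rewrite in_nil.
- by rewrite inE => /eqP -> /=; rewrite /gord big_nil.
move=> /wordsP[l [j [q [lk jl /IH qk ->]]]].
have -> : gord ((l, j) :: q.2) = (j + gord q.2)%N by rewrite /gord big_cons.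
by rewrite /= addnS ltnS -addnA (leq_trans (leq_add jl qk))// subnKC.
Qed.

Lemma words_size1 N k p : p \in words N k.+1 -> size p.2 = 1%N ->
  p.1 = coef k k /\ p.2 = [:: (k, gord p.2)].
Proof.
case: N => [|N]; first by rewrite in_nil.
move=> /wordsP[l [j [q [lk jl qw ->]]]] /= [] /size0nil q0; move: qw.
case: (leqP k l) => kl; last first.
  move=> /words_ford; rewrite q0 /ford big_nil => /esym/eqP.
  by rewrite subn_eq0 leqNgt kl.
have -> : l = k by apply/eqP; rewrite eqn_leq lk.
rewrite subnn; case: N => [|N]; rewrite inE => /eqP -> /=;
by rewrite mulr1 /gord big_seq1.
Qed.

Lemma mem_words1 N k j : (k < N)%N -> (j <= k)%N ->
  (coef k k, [:: (k, j)]) \in words N k.+1.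
Proof.
case: N => // N _ jk; rewrite -[coef k k]mulr1.
apply: (@mem_words N k k j (1, [::])) => //.
by rewrite subnn; case: N => [|N]; rewrite inE.
Qed.

End WordExpansion.

(** * From conditions P1 and P2 to a negative leading coefficient *)

Section DescentDirection.
Context {R : realType} {n : nat}.
Local Notation state := 'rV[R]_n.
Local Notation vfield := (state -> state).

(** For a small [u] of sign opposite to [p q0], the odd power [q0] is negative and dominates all
    higher ones; the constant term can only help. *)
Lemma exists_neg_sum_powers (M : nat) (p : nat -> R) (q0 : nat) :
  p 0%N <= 0 -> (0 < q0 <= M)%N -> odd q0 -> p q0 != 0 ->
  (forall q, (0 < q < q0)%N -> p q = 0) ->
  exists2 u : R, `|u| <= 1 & \sum_(q < M.+1) u ^+ q * p q < 0.
Proof.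
move=> p0 /andP[q00 q0M] odd_q0 pq0 pz.
pose B := \sum_(q < M.+1) `|p q|.
have B0 : 0 <= B by exact: sumr_ge0.
(* The size of [u]: the remaining powers contribute at most [e ^+ q0.+1 * B], and the [+ 1] makes
   this strictly less than the gain at [q0]. *)
pose e := Num.min 1 (`|p q0| / (B + 1)).
have e0 : 0 < e by rewrite lt_min ltr01 divr_gt0 ?normr_gt0// ltr_wpDl.
have e1 : e <= 1 by rewrite ge_min lexx.
have eB : e * B < `|p q0|.
  apply: (@le_lt_trans _ _ (`|p q0| / (B + 1) * B)).
    by rewrite ler_wpM2r// ge_min lexx orbT.
  rewrite -mulrA gtr_pMr ?normr_gt0// mulrC ltr_pdivrMr ?ltr_wpDl// mul1r.
  by rewrite ltrDl.
pose u := - Num.sg (p q0) * e.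
have nu : `|u| = e by rewrite normrM normrN normr_sg pq0 mul1r gtr0_norm.
exists u; first by rewrite nu.
have i0 : (q0 < M.+1)%N by [].
apply: (@le_lt_trans _ _ (- e ^+ q0 * `|p q0| + e ^+ q0.+1 * B)); last first.
  rewrite exprSr -mulrA mulNr addrC subr_lt0 ltr_pM2l ?exprn_gt0//.
rewrite /B mulr_sumr (bigD1 (Ordinal i0)) //=.
have -> : u ^+ q0 * p q0 = - e ^+ q0 * `|p q0|.
  rewrite exprMn exprNn -signr_odd odd_q0 expr1 normrEsg mulN1r !mulNr; congr (- _).
  rewrite mulrC mulrCA [RHS]mulrC -mulrA; congr (_ * _).
  by rewrite sgr_odd// odd_q0 expr1.
rewrite lerD2l.
apply: (@le_trans _ _ (\sum_(i < M.+1 | i != Ordinal i0) e ^+ q0.+1 * `|p i|)); last first.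
  rewrite [leRHS](bigD1 (Ordinal i0))//= lerDr mulr_ge0// exprn_ge0//; exact: ltW.
apply: ler_sum => i ii0.
have [i00|] := posnP i.
  rewrite i00 expr0 mul1r (le_trans p0)// mulr_ge0// exprn_ge0//; exact: ltW.
move=> ipos; have [iq|iq|iq] := ltngtP i q0.
- by rewrite pz ?ipos// mulr0 normr0 mulr0.
- rewrite (le_trans (ler_norm _))// normrM normrX nu ler_wpM2r//.
  by rewrite ler_wiXn2l// ltW.
- by case/eqP : ii0; apply/val_inj.
Qed.

(** A nonzero polynomial cannot have [size p] distinct roots. The integers start at 2 so that
    [descent_at_flow_coef] applies to the value found. *)
Lemma poly_nonroot_nat (p : {poly R}) : p != 0 -> exists m : nat, p.[m.+2%:R] != 0.
Proof.
move=> p0; apply: contrapT => /forallNP H.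
pose s : seq R := [seq m.+2%:R | m <- iota 0 (size p)].
have /max_poly_roots -/(_ s) : p != 0 by [].
rewrite size_map size_iota ltnn => E; suff : false by [].
apply: E.
  apply/allP => x /mapP[m _ ->]; apply/eqP; apply/eqP/negPn/negP; exact: H.
rewrite map_inj_uniq ?iota_uniq// => a b /eqP.
by rewrite eqr_nat => /eqP[].
Qed.

Variables f g : vfield.
Hypotheses (sf : smooth_field f) (sg : smooth_field g).
Variable V : state -> R.
Hypothesis sV : smooth V.

(* Running [f + u g] for time [e], then [f + v g] for time [t e], makes [V]
   decrease at order [e ^ N.+1]. *)
Definition descent_at (C : R) x := exists (u v t : R) (N : nat),
  [/\ `|u| <= C, `|v| <= C, 0 < t,
      (forall k, (0 < k <= N)%N ->
         flow_coef (f + u *: g) (t *: (f + v *: g)) V k x = 0) &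
      flow_coef (f + u *: g) (t *: (f + v *: g)) V N.+1 x < 0].

Lemma descent_atS (C C' : R) x : C <= C' -> descent_at C x -> descent_at C' x.
Proof.
move=> CC' [u [v [t [N [uC vC t0 Q0 Q1]]]]]; exists u, v, t, N.
by split => //; [exact: le_trans CC'|exact: le_trans CC'].
Qed.

Let sZ (u : R) : smooth_field (f + u *: g).
Proof. by apply: smooth_fieldD => //; exact: smooth_fieldZ. Qed.

(** With the same control in two stages of equal length, the coefficient of order one is already
    [2 * lieD (f + u *: g) V x]. *)
Lemma descent_at_lt0 (u : R) x : lieD (f + u *: g) V x < 0 -> descent_at `|u| x.
Proof.
move=> ltx; exists u, u, 1, 0%N; split => //; first by case.
rewrite scale1r; set Z := f + u *: g.
have ZE : Z = 2 *: Z - Z by rewrite scaler_nat mulr2n addrK.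
have := flow_coef_rec 0 (sZ u) (sZ u) (sZ u) sV ZE; rewrite scale1r.
rewrite big_ord1 subnn flow_coef0 expr0 fact0 divr1 scale1r => ->.
by rewrite [ltLHS]/(2 * lieD Z V x) pmulr_rlt0.
Qed.

Let Qf (u s : R) k := flow_coef (f + u *: g) (s *: f - (f + u *: g)) V k.

(** Return from [u] and [s] to the controls: [t = s - 1] and [v = - (u / t)]. The bound [2 <= s]
    makes the second control no larger than the first. *)
Lemma descent_at_flow_coef (u s : R) N x : `|u| <= 1 -> 2 <= s ->
  (forall k, (0 < k <= N)%N -> Qf u s k x = 0) -> Qf u s N.+1 x < 0 ->
  descent_at 1 x.
Proof.
move=> u1 s2 Q0 Q1; have t1 : 1 <= s - 1 by lra.
have t0 : 0 < s - 1 by lra.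
exists u, (- (u / (s - 1))), (s - 1), N.
have -> : (s - 1) *: (f + - (u / (s - 1)) *: g) = s *: f - (f + u *: g).
  rewrite scalerDr scalerA mulrN mulrCA divff ?gt_eqF// mulr1.
  by rewrite scalerBl scale1r scaleNr opprD addrA.
split => //; rewrite normrN normrM normfV (gtr0_norm t0).
by rewrite ler_pdivrMr// mul1r (le_trans u1).
Qed.

(** Without control both stages follow [f], for a total time [s * e], which leaves a plain Taylor
    coefficient. *)
Lemma flow_coef_u0 (s : R) k :
  flow_coef f (s *: f - f) V k = (s ^+ k / k`!%:R) *: iter k (lieD f) V.
Proof.
have sY : smooth_field (s *: f - f).
  rewrite -scaleN1r; apply: smooth_fieldD; exact: smooth_fieldZ.
have it0 m : iter m.+1 (fun X' => bracket X' f) f = 0.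
  by elim: m => [|m IHm]; [exact: bracketXX|rewrite iterS IHm bracket0l].
elim: k => [|k IH]; first by rewrite flow_coef0 expr0 fact0 divr1 scale1r.
have k0 : (k.+1%:R : R) != 0 by rewrite pnatr_eq0.
apply: (scalerI k0); rewrite (flow_coef_rec _ sf sY sf sV (erefl _)).
rewrite big_ord_recl big1 => [|l _]; last first.
  have -> : iter (lift ord0 l) (fun X' => bracket X' f) f = 0 by exact: it0.
  by rewrite lieD0l scaler0.
rewrite addr0 expr0 fact0 divr1 scale1r subn0 IH /=.
rewrite lieDZr; last exact: smooth_iter_lieD.
rewrite !scalerA exprS factS natrM invfM; congr (_ *: _).
by field; rewrite nat1r k0 pnatr_eq0 -lt0n fact_gt0.
Qed.

Section AtPoint.
Variables (x : state) (N : nat).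
Let W : seq (R * seq (nat * nat)) := words N.+1 N.+1.
Let a (p : R * seq (nat * nat)) := p.1 * lie_word f g p.2 V x.

(** The coefficient of [u ^+ q] in the expansion of order [N.+1], as a polynomial in [s]. *)
Let P q : {poly R} := \sum_(p <- W | gord p.2 == q) a p *: 'X^(size p.2).

Let size_gt0 k M (p : R * seq (nat * nat)) : p \in words M k.+1 -> (0 < size p.2)%N.
Proof.
move=> /words_ford; case: p => c [|? ?] //=.
by rewrite /ford big_nil.
Qed.

Let QE (u s : R) : Qf u s N.+1 x = \sum_(q < N.+1) u ^+ q * (P q).[s].
Proof.
rewrite /Qf (flow_coef_words sf sg sV u s (leqnn N.+1)) fct_sumE.
transitivity (\sum_(p <- W) \sum_(q < N.+1 | gord p.2 == q) u ^+ q * (a p * s ^+ size p.2)).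
  rewrite big_seq_cond [RHS]big_seq_cond; apply: eq_bigr => p /andP[pW _].
  have gN : (gord p.2 < N.+1)%N.
    rewrite ltnS -ltnS (leq_trans _ (words_gord pW))// -addn1 leq_add2l.
    exact: size_gt0 pW.
  rewrite (big_pred1 (Ordinal gN)) => [|q]; last first.
    apply/idP/idP => [/eqP E|/eqP ->]; last exact: eqxx.
    by apply/eqP/val_inj; exact: esym E.
  have scaleE (c : R) (h : state -> R) : (c *: h) x = c * h x by [].
  rewrite scaleE /a /=; ring.
rewrite (exchange_big_dep xpredT)//=; apply: eq_bigr => q _.
rewrite /P horner_sum mulr_sumr; apply: eq_bigr => p _.
by rewrite hornerZ hornerXn.
Qed.

Let P0E (s : R) : (P 0).[s] = s ^+ N.+1 / N.+1`!%:R * iter N.+1 (lieD f) V x.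
Proof.
have := QE 0 s; rewrite /Qf scale0r addr0 flow_coef_u0 big_ord_recl expr0 mul1r.
rewrite big1 ?addr0 => [<-//|q _].
by rewrite expr0n mul0r.
Qed.

Let c1 : R := (-1) ^+ N / N`!%:R / N.+1%:R.

Let c1_neq0 : c1 != 0.
Proof.
by rewrite !mulf_neq0 ?signr_eq0// invr_eq0 pnatr_eq0// -lt0n fact_gt0.
Qed.

(** Terms linear in [s] come from one-letter words, and [(N, q)] is the only letter of order [N.+1]
    with [q] occurrences of [g]. Its multiplicity in the list is left as [m], since only positivity
    matters. *)
Let P_coef1 q : (q <= N)%N -> exists2 m : nat, (0 < m)%N &
  (P q)`_1 = m%:R * (c1 * lieD (lam f g N q) V x).
Proof.
move=> qN; pose B (p : R * seq (nat * nat)) := (gord p.2 == q) && (size p.2 == 1%N).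
exists (count B W).
  rewrite -has_count; apply/hasP; exists (c1, [:: (N, q)]); last first.
    by rewrite /B /gord big_seq1 /= eqxx.
  exact: mem_words1.
transitivity (\sum_(p <- W | B p) (c1 * lieD (lam f g N q) V x)); last first.
  by rewrite big_const_seq iter_addr_0 mulr_natl.
rewrite /P coef_sum.
have -> : \sum_(p <- W | gord p.2 == q) (a p *: 'X^(size p.2))`_1 = \sum_(p <- W | B p) a p.
  rewrite /B big_mkcondr; apply: eq_bigr => p _.
  by rewrite coefZ coefXn eq_sym; case: eqP; rewrite ?mulr1 ?mulr0.
rewrite big_seq_cond [RHS]big_seq_cond; apply: eq_bigr => p /andP[pW /andP[/eqP gq /eqP s1]].
have [E1 E2] := words_size1 pW s1.
by rewrite /a E1 E2 gq.
Qed.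

Let P_vanish q (C : nat -> nat -> Prop) :
  vanish_orders f g V x C -> C N.+1 q -> P q = 0.
Proof.
move=> vC CNq; rewrite /P big_seq_cond big1// => p /andP[pW /eqP gq].
rewrite /a (vanish_lie_word sf sg vC) ?mulr0 ?scale0r//.
  by have := size_gt0 pW; rewrite -size_eq0 lt0n.
by rewrite -/(ford _) -/(gord _) (words_ford pW) gq.
Qed.

Lemma condB_descent_aux :
  (forall k (u s : R), (0 < k <= N)%N -> Qf u s k x = 0) -> (0 < N)%N ->
  iter N.+1 (lieD f) V x < 0 \/
        (iter N.+1 (lieD f) V x <= 0 /\
         [\/ P2i f g V x N, P2ii f g V x N | P2iii f g V x N]) ->
  descent_at 1 x.
Proof.
move=> Q0 N0 H.
have fac0 : (0 : R) < (N.+1)`!%:R by rewrite ltr0n fact_gt0.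
have [ltf|[lef H2]] := H.
  (* P1: [u = 0] leaves only [P 0], which has the sign of the iterated derivative along [f]. *)
  apply: (@descent_at_flow_coef 0 2 N) => //; first by rewrite normr0.
    by move=> k kN; exact: Q0.
  rewrite QE big_ord_recl expr0 mul1r big1 ?addr0 => [|q _]; last first.
    by rewrite expr0n mul0r.
  by rewrite P0E pmulr_rlt0// divr_gt0// exprn_gt0.
(* [P j] is nonzero by its linear coefficient, so some [s] is not a root of it. The lowest positive
   power [q0] of [u] that survives at this [s] satisfies [q0 <= j], and it is odd because the even
   powers below [j] vanish identically; a small [u] of the right sign then gives a negative sum. *)
have caseP2i : P2i f g V x N -> descent_at 1 x.
  move=> [_ [j [oddj /andP[j0 jN] lj vj]]].
  rewrite lambdaE// in lj.
  have Pj0 : P j != 0.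
    have [m m0 E] := P_coef1 jN; apply/eqP => Pj.
    have : m%:R * (c1 * lieD (lam f g N j) V x) != 0.
      by apply: mulf_neq0; [rewrite pnatr_eq0 -lt0n|exact: mulf_neq0].
    by rewrite -E Pj coef0 eqxx.
  have Peven q : (0 < q < j)%N -> ~~ odd q -> P q = 0.
    move=> /andP[q0 qj] evq; have j2 : (2 < j)%N by move: q q0 qj evq; case=> [|[|q]]//; lia.
    apply: (P_vanish (vj j2 q _ evq)) => //; by rewrite q0.
  have [m rm] := poly_nonroot_nat Pj0.
  set s : R := m.+2%:R in rm.
  have s2 : 2 <= s by rewrite /s ler_nat.
  have ex_q : exists q, (0 < q)%N && ((P q).[s] != 0) by exists j; rewrite j0.
  pose q0 := ex_minn ex_q.
  have [q00 Pq0 minq] : [/\ (0 < q0)%N, (P q0).[s] != 0 &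
      forall q, (0 < q)%N && ((P q).[s] != 0) -> (q0 <= q)%N].
    by rewrite /q0; case: ex_minnP => q /andP[].
  have q0j : (q0 <= j)%N by apply: minq; rewrite j0.
  have oddq0 : odd q0.
    apply/negPn/negP => ev; have : q0 != j by apply: contraNneq ev => ->.
    move=> neq; have q0j' : (q0 < j)%N by rewrite ltn_neqAle neq.
    by move: Pq0; rewrite Peven ?q00// horner0 eqxx.
  have [|||u u1 Su] := @exists_neg_sum_powers N (fun q => (P q).[s]) q0 _ _ oddq0 Pq0.
  - by rewrite P0E mulr_ge0_le0// divr_ge0 ?exprn_ge0// ltW// (lt_le_trans _ s2).
  - by rewrite q00 (leq_trans q0j).
  - move=> q /andP[qpos qq0]; apply/eqP/negPn/negP => Pq.
    by have := minq q; rewrite qpos Pq leqNgt qq0 => /(_ isT).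
  apply: (@descent_at_flow_coef u s N) => //; first by move=> k; exact: Q0.
  by rewrite QE.
(* P2(ii) is P2(i) with [j = N]: the vanishing up to [N - 1] occurrences of [g] includes the even
   ones. *)
case: H2 => [//|[N2 oddN lN vN]|[evN lN vN]].
  apply: caseP2i; split => //; exists N; split => //.
    by rewrite N0 leqnn.
  move=> _ q /andP[q0 qN] _ k D o l k0 LD oD lD [ho hl].
  by apply: (vN k D o l) => //; split => //; rewrite hl; lia.
have Pq q : (q < N)%N -> P q = 0.
  move=> qN; apply: (P_vanish vN); split => //; lia.
(* P2(iii): only the power [u ^+ N] survives, with a coefficient linear in [s]. Since [N] is even,
   [c1] is positive and the sign is that of [lieD (lambda N.+1 N) V x]. *)
apply: (@descent_at_flow_coef 1 2 N) => //; first by rewrite normr1.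
  by move=> k; exact: Q0.
rewrite QE big_ord_recr big1 ?add0r => [|q _]; last first.
  by rewrite [P _](Pq q (ltn_ord q)) horner0 mulr0.
rewrite expr1n mul1r /=.
have -> : P N = (P N)`_1 *: 'X.
  rewrite {2}/P coef_sum scaler_suml /P big_seq_cond [RHS]big_seq_cond.
  apply: eq_bigr => p /andP[pW /eqP gN].
  suff -> : size p.2 = 1%N by rewrite coefZ coefX mulr1 expr1.
  have := words_gord pW; rewrite gN -addn1 leq_add2l => le1.
  by apply/eqP; rewrite eqn_leq le1; exact: size_gt0 pW.
have [m m0 ->] := P_coef1 (leqnn N).
rewrite add0r hornerZ hornerX pmulr_llt0// pmulr_rlt0 ?ltr0n//.
rewrite -lambdaE// pmulr_rlt0// /c1 -signr_odd (negbTE evN) expr0 !divr_gt0 ?ltr0n//.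
exact: fact_gt0.
Qed.

End AtPoint.

Lemma condB_descent x : condB f g V x -> descent_at 1 x.
Proof.
move=> [N [N1 vN H]]; apply: (condB_descent_aux (N := N)) => //.
move=> k u s /andP[k0 kN]; rewrite /Qf (flow_coef_words sf sg sV u s (leqnn k)) fct_sumE.
rewrite big_seq_cond big1// => p /andP[pW _].
have vN' : vanish_orders f g V x (fun o _ => (o <= N)%N).
  by move=> k' D o l k'0 LD oD lD; exact: vN.
rewrite [LHS]/(_ * _).
have -> : lie_word f g p.2 V x = 0; last exact: mulr0.
apply: (vanish_lie_word sf sg vN').
  apply/eqP => p0; have := words_ford pW; rewrite p0 /ford big_nil => k0'.
  by rewrite -k0' in k0.
by rewrite -/(ford _) (words_ford pW).
Qed.

End DescentDirection.

(** * Bounds and Lipschitz constants on balls *)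

Section Bounds.
Context {R : realType} {n : nat}.
Local Notation state := 'rV[R]_n.
Local Notation vfield := (state -> state).
Implicit Types (h : state -> R) (x y : state).

Lemma coord_le_norm x j : `|x 0 j| <= `|x|.
Proof.
by rewrite [leRHS]/Num.norm/= mx_normrE; exact: (le_bigmax _ _ (0, j)).
Qed.

Lemma norm_le_coord x (M : R) : 0 <= M -> (forall j, `|x 0 j| <= M) -> `|x| <= M.
Proof.
move=> M0 xM; rewrite [leLHS]/Num.norm/= mx_normrE; apply: bigmax_le => // -[i j] _ /=.
by rewrite ord1.
Qed.

Lemma compact_closed_ball (M : R) : compact [set x : state | `|x| <= M].
Proof.
apply: bounded_closed_compact.
  exists M; split; first exact: num_real.
  by move=> M' MM' x /= xM; rewrite (le_trans xM)// ltW.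
rewrite (_ : mkset _ = Num.norm @^-1` [set r : R | r <= M])//.
by apply: closed_comp; [move=> ? _; exact: norm_continuous|exact: closed_le].
Qed.

Lemma compact_continuous_bounded (A : set state) h : compact A -> continuous h ->
  exists2 B : R, 0 <= B & forall x, A x -> `|h x| <= B.
Proof.
move=> cA ch.
have /compact_bounded [B [_ HB]] := @continuous_compact _ _ h A
  (continuous_subspaceT ch) cA.
exists (`|B| + 1); first by rewrite addr_ge0.
move=> x Ax; apply: HB; last by exists x.
by rewrite (le_lt_trans (ler_norm _))// ltrDl.
Qed.

Lemma bounded_on_ball h (M : R) : continuous h ->
  exists2 B : R, 0 <= B & forall x, `|x| <= M -> `|h x| <= B.
Proof.
move=> ch; have [B B0 HB] := compact_continuous_bounded (@compact_closed_ball M) ch.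
by exists B.
Qed.

Lemma lipschitz_fun h (M : R) : smooth h ->
  exists2 L : R, 0 <= L &
    forall x y, `|x| <= M -> `|y| <= M -> `|h x - h y| <= L * `|x - y|.
Proof.
move=> sh.
have /(_ _)/cid2 B i := bounded_on_ball M (smooth_continuous (smooth_derive (delta_mx 0 i) sh)).
pose b i := sval (B i).
have b0 i : 0 <= b i by rewrite /b; case: (B i).
have bE i x : `|x| <= M -> `|'D_(delta_mx 0 i) h x| <= b i by rewrite /b; case: (B i) => /= c _; exact.
exists (\sum_(i < n) b i); first exact: sumr_ge0.
move=> x y xM yM; have [t] := directional_MVT y (x - y) ler01 sh.
rewrite scale1r mulr1 [y + (x - y)]addrC subrK in_itv/= => /andP[t0 t1] ->.
set z := y + t *: (x - y).
have zM : `|z| <= M.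
  (* The ball is convex, so the intermediate point of the mean value theorem stays in it. *)
  have -> : z = t *: x + (1 - t) *: y.
    by rewrite /z scalerBr scalerBl scale1r addrCA.
  rewrite (le_trans (ler_normD _ _))// !normrZ (ger0_norm t0) ger0_norm ?subr_ge0//.
  have -> : M = t * M + (1 - t) * M by ring.
  by rewrite lerD// ler_wpM2l// subr_ge0.
rewrite deriveE; last exact: smooth_differentiable.
have := lieD_coord (fun=> x - y) sh; move=> /(congr1 (@^~ z)).
rewrite /lieD => ->; rewrite fct_sumE mulr_suml (le_trans (ler_norm_sum _ _ _))//.
apply: ler_sum => i _; rewrite normrM mulrC ler_pM//; first exact: bE.
exact: (coord_le_norm (x - y)).
Qed.

Lemma lipschitz_field (X : vfield) (M : R) : smooth_field X ->
  exists2 L : R, 0 <= L &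
    forall x y, `|x| <= M -> `|y| <= M -> `|X x - X y| <= L * `|x - y|.
Proof.
move=> sX; have /(_ _)/cid2 B j := lipschitz_fun M (sX j).
pose b j := sval (B j).
have b0 j : 0 <= b j by rewrite /b; case: (B j).
have bE j x y : `|x| <= M -> `|y| <= M -> `|X x 0 j - X y 0 j| <= b j * `|x - y|.
  by rewrite /b; case: (B j) => /= c _; exact.
exists (\sum_(i < n) b i); first exact: sumr_ge0.
move=> x y xM yM; apply: norm_le_coord; first by rewrite mulr_ge0// sumr_ge0.
move=> j; rewrite !mxE (le_trans (bE j x y xM yM))// ler_wpM2r//.
by rewrite (bigD1 j)//= lerDl sumr_ge0.
Qed.

Lemma bounded_field (X : vfield) (M : R) : smooth_field X ->
  exists2 K : R, 0 <= K & forall x, `|x| <= M -> `|X x| <= K.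
Proof.
move=> sX; have /(_ _)/cid2 B j := bounded_on_ball M (smooth_continuous (sX j)).
pose b j := sval (B j).
have b0 j : 0 <= b j by rewrite /b; case: (B j).
have bE j x : `|x| <= M -> `|X x 0 j| <= b j by rewrite /b; case: (B j) => /= c _; exact.
exists (\sum_(i < n) b i); first exact: sumr_ge0.
move=> x xM; apply: norm_le_coord; first exact: sumr_ge0.
move=> j; rewrite (le_trans (bE j x xM))//.
by rewrite (bigD1 j)//= lerDl sumr_ge0.
Qed.

End Bounds.

(** * Functions given as integrals *)

Section Primitives.
Context {R : realType}.
Local Notation mu := (@lebesgue_measure R).
Implicit Types (h P : R -> R) (a b c s t : R).

Lemma integrable_setU_itv h a c t : a <= c -> c <= t ->
  mu.-integrable `[a, c] (EFin \o h) -> mu.-integrable `[c, t] (EFin \o h) ->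
  mu.-integrable `[a, t] (EFin \o h).
Proof.
move=> ac ct i1 i2.
have i3 : mu.-integrable `]c, t] (EFin \o h).
  by apply: integrableS i2 => //; exact: subset_itv_oc_cc.
have U : [set` `[a, t]] = `[a, c] `|` `]c, t].
  by rewrite -(@itv_bndbnd_setU _ _ (BLeft a) (BRight c) (BRight t)).
apply/integrableP; split.
  by rewrite U; apply/measurable_funU => //; split; [case/integrableP: i1|case/integrableP: i3].
rewrite U ge0_integral_setU//; first 1 last.
- apply: measurableT_comp => //; apply/measurable_funU => //.
  by split; [case/integrableP: i1|case/integrableP: i3].
- rewrite disj_set2E; apply/eqP; rewrite -subset0 => x /= [].
  by rewrite !in_itv/= => /andP[_ xc] /andP[cx _]; move: cx; rewrite ltNge xc.
by apply: lte_add_pinfty; [case/integrableP: i1|case/integrableP: i3].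
Qed.

Lemma Rintegral_split h a c t : a <= c -> c <= t ->
  mu.-integrable `[a, t] (EFin \o h) ->
  (\int[mu]_(s in `[a, t]) h s)%R =
  (\int[mu]_(s in `[a, c]) h s)%R + (\int[mu]_(s in `[c, t]) h s)%R.
Proof.
move=> ac ct it; apply/eqP; rewrite addrC -subr_eq; apply/eqP.
rewrite Rintegral_itvB// Rintegral_itv_obnd_cbnd//.
apply: integrableS it => //; apply: subset_itvr; by rewrite bnd_simp.
Qed.

Lemma Rintegral_le_cst h a t (M : R) : a <= t -> mu.-integrable `[a, t] (EFin \o h) ->
  (forall s, a <= s <= t -> `|h s| <= M) ->
  `|(\int[mu]_(s in `[a, t]) h s)%R| <= M * (t - a).
Proof.
move=> at_ ih hM; rewrite (le_trans (le_normr_Rintegral _ ih))//.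
have fin : (mu `[a, t] < +oo)%E by rewrite lebesgue_measure_itv/=; case: ifP => // _; rewrite -EFinB ltry.
have -> : M * (t - a) = (\int[mu]_(s in `[a, t]) (fun=> M) s)%R.
  rewrite Rintegral_cst//.
  have := lebesgue_measure_itv `[a, t]; rewrite /= lte_fin => ->.
  by case: ltgtP at_ => //= [->] _; rewrite subrr.
apply: le_Rintegral => //.
- exact: integrable_norm.
- apply: measurable_bounded_integrable => //.
  have M0 : 0 <= M by rewrite (le_trans (normr_ge0 (h a)))// hM// lexx at_.
  by exists M; split; [exact: num_real|move=> M' MM' ? _ /=; rewrite ger0_norm// ltW].
Qed.

(** The integral form used componentwise in [trajectory]. Integrability is included because
    otherwise the value of the integral would carry no information. *)
Definition primitive_on h P a b := forall t, a <= t <= b ->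
  mu.-integrable `[a, t] (EFin \o h) /\
  P t = P a + (\int[mu]_(s in `[a, t]) h s)%R.

Lemma primitive_on_tail h P a c b : a <= c ->
  primitive_on h P a b -> primitive_on h P c b.
Proof.
move=> ac pr t /andP[ct tb].
have [|it Pt] := pr t; first by rewrite (le_trans ac ct).
have [|ic Pc] := pr c; first by rewrite ac (le_trans ct).
split; first by apply: integrableS it => //; exact: subset_itvr.
by rewrite Pt Pc -addrA -Rintegral_split.
Qed.

Lemma primitive_on_head h P a c b : c <= b ->
  primitive_on h P a b -> primitive_on h P a c.
Proof. by move=> cb pr t /andP[at_ tc]; apply: pr; rewrite at_ (le_trans tc). Qed.

Lemma primitive_on_cat h P a c b : a <= c -> c <= b ->
  primitive_on h P a c -> primitive_on h P c b -> primitive_on h P a b.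
Proof.
move=> ac cb p1 p2 t /andP[at_ tb].
have [tc|/ltW ct] := leP t c; first by apply: p1; rewrite at_.
have [|i1 P1] := p1 c; first by rewrite ac lexx.
have [|i2 P2] := p2 t; first by rewrite ct tb.
have it := integrable_setU_itv ac ct i1 i2.
by split=> //; rewrite P2 P1 (Rintegral_split ac ct it) addrA.
Qed.

(** The integrands are compared on a half-open interval because at a sampling time the feedback
    already belongs to the next interval; the endpoint has measure zero. *)
Lemma primitive_on_eq h h' P P' a b :
  (forall s, a <= s < b -> h s = h' s) -> (forall t, a <= t <= b -> P t = P' t) ->
  primitive_on h P a b -> primitive_on h' P' a b.
Proof.
move=> hh PP pr t /andP[at_ tb]; have [|it Pt] := pr t; first by rewrite at_.
have i1 : mu.-integrable `[a, t[ (EFin \o h).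
  by apply: integrableS it => //; exact: subset_itv_co_cc.
have m1 : measurable_fun `[a, t[ h by case/integrableP: i1 => /measurable_EFinP.
have m2 : measurable_fun `[a, t[ h'.
  apply: eq_measurable_fun m1 => s /=; rewrite inE/= in_itv/= => /andP[as_ st].
  by rewrite hh// as_ (lt_le_trans st).
have i2 : mu.-integrable `[a, t[ (EFin \o h').
  apply: eq_integrable i1 => // s /=; rewrite inE/= in_itv/= => /andP[as_ st].
  by rewrite hh// as_ (lt_le_trans st).
have i3 : mu.-integrable `[a, t] (EFin \o h').
  apply/(@negligible_integrable _ _ _ mu _ [set t]) => //.
  - by apply/measurable_EFinP/measurable_fun_itv_bndo_bndcP.
  - exact: lebesgue_measure_set1.
  by rewrite setDitv1r.
split => //.
rewrite -!PP ?lexx ?(le_trans at_)// ?at_// Pt; congr (_ + _).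
rewrite -Rintegral_itv_bndo_bndc// -Rintegral_itv_bndo_bndc//.
apply: eq_Rintegral => s; rewrite inE/= in_itv/= => /andP[as_ st].
by rewrite hh// as_ (lt_le_trans st).
Qed.

Lemma primitive_on_lip h P a b (M : R) : primitive_on h P a b ->
  (forall s, a <= s <= b -> `|h s| <= M) ->
  forall s t, a <= s -> s <= t -> t <= b -> `|P t - P s| <= M * (t - s).
Proof.
move=> pr hM s t as_ st tb.
have [|it Pt] := primitive_on_tail as_ pr (t := t); first by rewrite st.
rewrite Pt addrAC subrr add0r; apply: Rintegral_le_cst => // r /andP[sr rt].
by apply: hM; rewrite (le_trans as_ sr) (le_trans rt).
Qed.

Lemma primitive_onB h h' P P' a b : primitive_on h P a b -> primitive_on h' P' a b ->
  primitive_on (fun s => h s - h' s) (fun t => P t - P' t) a b.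
Proof.
move=> p1 p2 t tab; have [i1 E1] := p1 t tab; have [i2 E2] := p2 t tab.
split.
  rewrite (_ : EFin \o _ = (EFin \o h) \- (EFin \o h'))%E; first exact: integrableB.
  by apply/funext => s /=; rewrite EFinB.
by rewrite RintegralB// E1 E2; ring.
Qed.

Lemma primitive_on_bounded h P a b : primitive_on h P a b ->
  exists B : R, forall t, a <= t <= b -> `|P t| <= B.
Proof.
move=> pr; have [ab|ba] := leP a b; last first.
  by exists 0 => t /andP[at_ tb]; have := le_trans at_ tb; rewrite leNgt ba.
have [|ib _] := pr b; first by rewrite ab lexx.
exists (`|P a| + (\int[mu]_(s in `[a, b]) `|h s|)%R) => t /andP[at_ tb].
have [|it ->] := pr t; first by rewrite at_.
rewrite (le_trans (ler_normD _ _))// lerD2l (le_trans (le_normr_Rintegral _ it))//.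
have inb := integrable_norm ib.
rewrite (Rintegral_split at_ tb)// lerDl; apply: Rintegral_ge0 => s _ //.
Qed.

Lemma continuous_primitive_on h P a b : {within `[a, b], continuous h} ->
  (forall t, a <= t <= b -> P t = P a + (\int[mu]_(s in `[a, t]) h s)%R) ->
  primitive_on h P a b.
Proof.
move=> ch E t /andP[at_ tb]; split; last by apply: E; rewrite at_.
apply: continuous_compact_integrable; first exact: segment_compact.
by apply: continuous_subspaceW ch; exact: subset_itvl.
Qed.

Lemma primitive_on_derive h P a b t : primitive_on h P a b -> a < t < b ->
  {for t, continuous h} -> is_derive t 1 P (h t).
Proof.
move=> pr /andP[at_ tb] ct.
have [|ib _] := pr b; first by rewrite lexx (ltW (lt_trans at_ tb)).
have [dF F'] := continuous_FTC1_closed tb ib at_ ct.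
have nearE : \forall y \near t, P a + (\int[mu]_(s in `[a, y]) h s)%R = P y.
  have : t \in `]a, b[ by rewrite in_itv/= at_ tb.
  move=> /near_in_itvoo; apply: filterS => y; rewrite in_itv/= => /andP[ay yb].
  by have [|_ ->] := pr y; rewrite ?(ltW ay) ?(ltW yb).
apply: (near_eq_is_derive (f := fun y => P a + (\int[mu]_(s in `[a, y]) h s)%R)) => //.
rewrite -[h t]add0r -F' derive1E.
by apply: is_deriveD => //; exact: derivableP.
Qed.

End Primitives.

(** * Solutions: concatenation, continuous dependence, uniqueness *)

Section Solutions.
Context {R : realType} {n : nat}.
Local Notation state := 'rV[R]_n.
Local Notation vfield := (state -> state).
Variables f g : vfield.
Hypotheses (sf : smooth_field f) (sg : smooth_field g).
Implicit Types (u v : R -> R) (p q : R -> state) (a b c s t : R).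

Definition dyn (x : state) (r : R) : state := f x + r *: g x.

Definition solves u p a b := forall j,
  primitive_on (fun s => dyn (p s) (u s) 0 j) (fun t => p t 0 j) a b.

Definition splice (T : Type) c (y z : R -> T) : R -> T := fun t => if t < c then y t else z t.

Lemma solves_tail u p a c b : a <= c -> solves u p a b -> solves u p c b.
Proof. by move=> ac sp j; exact: primitive_on_tail (sp j). Qed.

Lemma solves_head u p a c b : c <= b -> solves u p a b -> solves u p a c.
Proof. by move=> ac sp j; exact: primitive_on_head (sp j). Qed.

Lemma solves_eq u v p q a b : (forall s, a <= s < b -> u s = v s) ->
  (forall s, a <= s <= b -> p s = q s) -> solves u p a b -> solves v q a b.
Proof.
move=> uv pq sp j; apply: primitive_on_eq (sp j) => [s /andP[as_ sb]|s sab].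
  by rewrite uv ?as_// pq// as_ ltW.
by rewrite pq.
Qed.

Lemma solves_cat u v p q a c b : a <= c -> c <= b ->
  solves u p a c -> solves v q c b -> p c = q c ->
  solves (splice c u v) (splice c p q) a b.
Proof.
move=> ac cb sp sq pq j; apply: (primitive_on_cat ac cb).
  have := @solves_eq u (splice c u v) p (splice c p q) a c.
  apply=> // s /andP[_ sc]; rewrite /splice ?sc//.
  by case: ltgtP sc => // ->.
have := @solves_eq v (splice c u v) q (splice c p q) c b.
by apply=> // s /andP[cs _]; rewrite /splice ltNge cs.
Qed.

Lemma solves_bounded u p a b : solves u p a b ->
  exists2 B : R, 0 <= B & forall t, a <= t <= b -> `|p t| <= B.
Proof.
move=> sp; have /(_ _)/cid B j := primitive_on_bounded (sp j).
exists (\sum_j `|sval (B j)|); first exact: sumr_ge0.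
move=> t tab; apply: norm_le_coord; first exact: sumr_ge0.
move=> j; rewrite (bigD1 j)//= ler_wpDr ?sumr_ge0//.
by rewrite (le_trans _ (ler_norm _))//; case: (B j) => /= ? ->.
Qed.

Lemma dyn_lipschitz (M C : R) : exists2 L : R, 0 <= L & forall x y r,
  `|x| <= M -> `|y| <= M -> `|r| <= C -> `|dyn x r - dyn y r| <= L * `|x - y|.
Proof.
have [L1 L10 H1] := lipschitz_field M sf; have [L2 L20 H2] := lipschitz_field M sg.
exists (L1 + `|C| * L2); first by rewrite addr_ge0// mulr_ge0.
move=> x y r xM yM rC.
have -> : dyn x r - dyn y r = (f x - f y) + r *: (g x - g y).
  by rewrite /dyn scalerBr opprD addrACA.
rewrite (le_trans (ler_normD _ _))// mulrDl lerD//; first exact: H1.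
rewrite normrZ -mulrA ler_pM//; first by rewrite (le_trans rC)// ler_norm.
exact: H2.
Qed.

Lemma dyn_bounded (M C : R) : exists2 K : R, 0 <= K & forall x r,
  `|x| <= M -> `|r| <= C -> `|dyn x r| <= K.
Proof.
have [L1 L10 H1] := bounded_field M sf; have [L2 L20 H2] := bounded_field M sg.
exists (L1 + `|C| * L2); first by rewrite addr_ge0// mulr_ge0.
move=> x r xM rC; rewrite (le_trans (ler_normD _ _))// lerD//; first exact: H1.
rewrite normrZ ler_pM//; first by rewrite (le_trans rC)// ler_norm.
exact: H2.
Qed.

Lemma solves_lipschitz (M C K : R) u p a b : 0 <= K ->
  (forall x r, `|x| <= M -> `|r| <= C -> `|dyn x r| <= K) ->
  solves u p a b -> (forall s, `|u s| <= C) -> (forall t, a <= t <= b -> `|p t| <= M) ->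
  forall s t, a <= s -> s <= t -> t <= b -> `|p t - p s| <= K * (t - s).
Proof.
move=> K0 HK sp uC pM s t as_ st tb; apply: norm_le_coord.
  by rewrite mulr_ge0// subr_ge0.
move=> j; have := primitive_on_lip (sp j) (M := K).
rewrite !mxE; apply=> // r rab; rewrite (le_trans (coord_le_norm _ _))//.
by apply: HK; [exact: pM|exact: uC].
Qed.

(** A substitute for Gronwall's inequality: on so short an interval the supremum of the distance is
    at most the initial distance plus half of itself. *)
Lemma solves_dist (M C L : R) u p q a b : 0 <= L -> L * (b - a) <= 1 / 2 ->
  (forall x y r, `|x| <= M -> `|y| <= M -> `|r| <= C ->
    `|dyn x r - dyn y r| <= L * `|x - y|) ->
  solves u p a b -> solves u q a b -> (forall s, `|u s| <= C) ->
  (forall t, a <= t <= b -> `|p t| <= M) -> (forall t, a <= t <= b -> `|q t| <= M) ->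
  forall t, a <= t <= b -> `|p t - q t| <= 2 * `|p a - q a|.
Proof.
move=> L0 Lab HL sp sq uC pM qM t0 t0ab.
have ab : a <= b by case/andP: t0ab => a0 b0; exact: le_trans b0.
pose E := [set `|p t - q t| | t in [set t | a <= t <= b]].
have hE : has_sup E.
  split; first by exists `|p a - q a|, a; rewrite //= lexx.
  exists (M + M) => _ [t tab <-]; rewrite (le_trans (ler_normB _ _))// lerD//.
    exact: pM.
  exact: qM.
have supE t : a <= t <= b -> `|p t - q t| <= sup E.
  by move=> tab; apply: ub_le_sup; [case: hE|exists t].
have step t : a <= t <= b -> `|p t - q t| <= `|p a - q a| + sup E / 2.
  move=> tab; have /andP[at_ tb] := tab.
  have S0 : 0 <= sup E by rewrite (le_trans _ (supE _ tab)).
  apply: norm_le_coord; first by rewrite addr_ge0// divr_ge0.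
  move=> j; have pr := primitive_onB (sp j) (sq j).
  have dB s : a <= s <= b -> `|dyn (p s) (u s) 0 j - dyn (q s) (u s) 0 j| <= L * sup E.
    move=> sab; have := coord_le_norm (dyn (p s) (u s) - dyn (q s) (u s)) j.
    rewrite !mxE => /le_trans; apply.
    apply: (le_trans (HL _ _ _ (pM _ sab) (qM _ sab) (uC s))).
    by rewrite ler_wpM2l// supE.
  have := primitive_on_lip pr dB (lexx a) at_ tb => lipE.
  have le0 := coord_le_norm (p a - q a) j; rewrite !mxE in le0 *.
  have := ler_normD (p t 0 j - q t 0 j - (p a 0 j - q a 0 j)) (p a 0 j - q a 0 j).
  rewrite subrK => /le_trans; apply; rewrite addrC lerD//.
  apply: (le_trans lipE); rewrite mulrAC mulrC.
  rewrite ler_wpM2l// (le_trans _ (_ : L * (b - a) <= _))//.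
    by rewrite ler_wpM2l// lerB.
  by rewrite (le_trans Lab)// mul1r.
have : sup E <= `|p a - q a| + sup E / 2.
  by apply: ge_sup => [|_ [t tab <-]]; [case: hE|exact: step].
have := supE _ t0ab; lra.
Qed.

(** Both solutions are bounded, hence lie in one ball with a Lipschitz constant; [solves_dist] then
    propagates equality over successive intervals of length [e]. *)
Lemma solves_unique (C : R) u p q a b : solves u p a b -> solves u q a b ->
  (forall s, `|u s| <= C) -> p a = q a -> forall t, a <= t <= b -> p t = q t.
Proof.
move=> sp sq uC pq t tab.
have [B1 B10 HB1] := solves_bounded sp; have [B2 B20 HB2] := solves_bounded sq.
have [L L0 HL] := dyn_lipschitz (B1 + B2) C.
pose e : R := 1 / (2 * (L + 1)).
have L1 : 0 < L + 1 by rewrite ltr_wpDl.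
have e0 : 0 < e by rewrite divr_gt0// mulr_gt0.
have Le : L * e <= 1 / 2.
  have E : (L + 1) * e = 1 / 2 by rewrite /e; field; rewrite gt_eqF.
  by move: E; rewrite mulrDl mul1r; lra.
have steps (k : nat) s : a <= s <= b -> s <= a + k%:R * e -> p s = q s.
  elim: k s => [|k IH] s /andP[as_ sb].
    by rewrite mul0r addr0 => sa; have -> : s = a by apply/eqP; rewrite eq_le sa.
  move=> sk; have [sk'|ks] := leP s (a + k%:R * e); first by apply: IH; rewrite ?as_.
  set c := a + k%:R * e in ks *.
  have ac : a <= c by rewrite lerDl mulr_ge0// ltW.
  have pqc : p c = q c by apply: IH => //; rewrite ac (le_trans (ltW ks)).
  have sp' := solves_head sb (solves_tail ac sp).
  have sq' := solves_head sb (solves_tail ac sq).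
  have sc : s - c <= e by rewrite /c; move: sk; rewrite -natr1 mulrDl mul1r; lra.
  suff : `|p s - q s| <= 2 * `|p c - q c|.
    by rewrite pqc subrr normr0 mulr0 normr_le0 subr_eq0 => /eqP.
  apply: (@solves_dist (B1 + B2) C L u p q c s L0 _ HL sp' sq' uC).
  - by rewrite (le_trans _ Le)// ler_wpM2l.
  - by move=> r /andP[cr rs]; rewrite ler_wpDr// HB1// (le_trans ac) ?(le_trans rs).
  - by move=> r /andP[cr rs]; rewrite ler_wpDl// HB2// (le_trans ac) ?(le_trans rs).
  - by rewrite (ltW ks) lexx.
pose k := (Num.truncn ((t - a) / e)).+1.
apply: (steps k) => //; rewrite -lerBlDl -ler_pdivrMr// ltW//.
by have := truncnS_gt ((t - a) / e).
Qed.

End Solutions.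

(** * Clipping and geometric limits *)

Section Clip.
Context {R : realType}.

Definition clip1 (a b r : R) : R := Num.max a (Num.min b r).

Lemma clip1_itv (a b r : R) : a <= b -> a <= clip1 a b r <= b.
Proof. by move=> ab; rewrite /clip1 le_max lexx /= ge_max ab ge_min lexx. Qed.

Lemma clip1_id (a b r : R) : a <= r <= b -> clip1 a b r = r.
Proof. by move=> /andP[ar rb]; rewrite /clip1 (min_idPr rb) (max_idPr ar). Qed.

Lemma clip1_lip (a b r s : R) : `|clip1 a b r - clip1 a b s| <= `|r - s|.
Proof.
have mono r' s' : r' <= s' -> 0 <= clip1 a b s' - clip1 a b r' <= s' - r'.
  move=> rs; rewrite /clip1 !maxEle !minEle.
  by case: (leP b r') => ?; case: (leP b s') => ?; case: (leP a b) => ?;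
    case: (leP a r') => ?; case: (leP a s') => ?; apply/andP; split; lra.
have [/mono|/ltW/mono] := leP r s.
  by rewrite (distrC r) (distrC (clip1 a b r)) => /andP[h1 h2]; rewrite !ger0_norm// (le_trans h1).
by move=> /andP[h1 h2]; rewrite !ger0_norm// (le_trans h1).
Qed.

Lemma le_geometric (x y c : R) : (forall k : nat, x <= y + c / 2 ^+ k) -> x <= y.
Proof.
move=> H; apply/ler_addgt0Pr => e e0.
have [k ck] : exists k : nat, `|c| / 2 ^+ k <= e.
  exists (Num.truncn (`|c| / e)).+1.
  rewrite ler_pdivrMr ?exprn_gt0// mulrC -ler_pdivrMr//.
  have := ltW (truncnS_gt (`|c| / e)); move/le_trans; apply.
  rewrite -natrX ler_nat ltnW// ltn_expl//.
apply: (le_trans (H k)); rewrite lerD2l (le_trans _ ck)//.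
by rewrite ler_wpM2r ?ler_norm// invr_ge0 exprn_ge0.
Qed.

End Clip.

(** * Picard iteration and local existence *)

Section Picard.
Context {R : realType} {n : nat}.
Local Notation state := 'rV[R]_n.
Local Notation mu := (@lebesgue_measure R).
Variables (G : state -> state) (K L : R) (x : state) (a b : R).
Hypotheses (K0 : 0 <= K) (L0 : 0 <= L) (ab : a <= b) (Lab : L * (b - a) <= 1 / 2).
Hypotheses (GK : forall y, `|G y| <= K) (GL : forall y z, `|G y - G z| <= L * `|y - z|).

Let tc := clip1 a b.

(** Picard's integral operator. Clipping the time makes the iterates Lipschitz on the whole line, so
    continuity never has to refer to the interval. *)
Let step (q : R -> state) (t : R) : state :=
  \row_j (x 0 j + (\int[mu]_(s in `[a, tc t]) G (q s) 0 j)%R).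

Let lip (q : R -> state) := forall s t, `|q s - q t| <= K * `|s - t|.

Let cont_G q j : lip q -> continuous (fun s => G (q s) 0 j).
Proof.
move=> lq s; apply/cvgrPdist_le => /= e e0.
have c0 : 0 < L * K + 1 by rewrite ltr_wpDl// mulr_ge0.
near=> t.
have := coord_le_norm (G (q s) - G (q t)) j; rewrite !mxE => /le_trans; apply.
apply: (le_trans (GL _ _)); apply: (@le_trans _ _ ((L * K + 1) * `|s - t|)).
  by rewrite mulrDl mul1r -mulrA ler_wpDr// ler_wpM2l.
rewrite mulrC -ler_pdivlMr//; near: t.
apply/nbhs_ballP; exists (e / (L * K + 1)); first by rewrite /= divr_gt0.
by move=> t /ltW.
Unshelve. all: by end_near. Qed.

Let prim_step q j : lip q ->
  primitive_on (fun s => G (q s) 0 j) (fun t => step q t 0 j) a b.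
Proof.
move=> lq; apply: continuous_primitive_on.
  by apply: continuous_subspaceT; exact: cont_G.
move=> t tab; rewrite !mxE /tc !clip1_id ?lexx//.
by rewrite set_itv1 Rintegral_set1 addr0.
Qed.

Let step_tc q t : step q (tc t) = step q t.
Proof. by rewrite /step /tc (clip1_id (r := clip1 _ _ _))// clip1_itv. Qed.

Let lip_step q : lip q -> lip (step q).
Proof.
move=> lq s t; rewrite -(step_tc q s) -(step_tc q t).
have incr r r' : tc r <= tc r' ->
    `|step q (tc r') - step q (tc r)| <= K * (tc r' - tc r).
  move=> rr; have /andP[ar rb] : a <= tc r <= b by exact: clip1_itv.
  have /andP[ar' rb'] : a <= tc r' <= b by exact: clip1_itv.
  apply: norm_le_coord; first by rewrite mulr_ge0// subr_ge0.
  move=> j; have := primitive_on_lip (prim_step j lq) (M := K).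
  move=> /(_ _ _ _ ar rr rb'); rewrite !mxE; apply => s' _.
  by rewrite (le_trans (coord_le_norm _ _)).
apply: (@le_trans _ _ (K * `|tc s - tc t|)); last first.
  by rewrite ler_wpM2l// clip1_lip.
have [st|/ltW ts] := leP (tc s) (tc t).
  rewrite (distrC (step q (tc s)) (step q (tc t))) (distrC (tc s) (tc t)).
  by rewrite (ger0_norm (x := tc t - _)) ?subr_ge0//; exact: incr.
by rewrite (ger0_norm (x := tc s - _)) ?subr_ge0//; exact: incr.
Qed.

Let step_close q q' (d : R) : lip q -> lip q' -> (forall t, `|q t - q' t| <= d) ->
  forall t, `|step q t - step q' t| <= d / 2.
Proof.
move=> lq lq' qd t.
have d0 : 0 <= d by rewrite (le_trans _ (qd t)).
rewrite -(step_tc q t) -(step_tc q' t).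
have /andP[at_ tb] : a <= tc t <= b by exact: clip1_itv.
apply: norm_le_coord; first by rewrite divr_ge0.
move=> j; have pr := primitive_onB (prim_step j lq) (prim_step j lq').
have dB s : a <= s <= b -> `|G (q s) 0 j - G (q' s) 0 j| <= L * d.
  move=> _; have := coord_le_norm (G (q s) - G (q' s)) j; rewrite !mxE => /le_trans; apply.
  by rewrite (le_trans (GL _ _))// ler_wpM2l.
have := primitive_on_lip pr dB (lexx a) at_ tb.
have -> : step q a 0 j - step q' a 0 j = 0.
  by rewrite !mxE /tc clip1_id ?lexx// set_itv1 !Rintegral_set1 subrr.
rewrite subr0 !mxE => /le_trans; apply.
rewrite mulrAC mulrC ler_wpM2l// (le_trans _ (_ : L * (b - a) <= _))//.
  by rewrite ler_wpM2l// lerB.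
by rewrite (le_trans Lab)// mul1r.
Qed.

Let it k := iter k step (fun=> x).

Let lip_it k : lip (it k).
Proof.
elim: k => [|k IH] /=; last exact: lip_step.
by move=> s t; rewrite subrr normr0 mulr_ge0.
Qed.

Let D : R := K * (b - a).

Let it_succ k t : `|it k.+1 t - it k t| <= D / 2 ^+ k.
Proof.
elim: k t => [|k IH] t; last first.
  have -> : D / 2 ^+ k.+1 = D / 2 ^+ k / 2 by rewrite exprSr invfM mulrA.
  exact: (step_close (lip_it k.+1) (lip_it k) IH).
rewrite expr0 divr1; apply: norm_le_coord; first by rewrite mulr_ge0// subr_ge0.
move=> j; rewrite !mxE addrAC subrr add0r.
have /andP[at_ tb] : a <= tc t <= b by exact: clip1_itv.
apply: (@le_trans _ _ (K * (tc t - a))).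
  apply: Rintegral_le_cst => //.
    by have [|] := prim_step j (lip_it 0) (t := tc t); first by rewrite at_.
  by move=> s _; rewrite (le_trans (coord_le_norm _ _)).
by rewrite ler_wpM2l// lerB.
Qed.

Let it_dist k m t : (k <= m)%N -> `|it m t - it k t| <= 2 * D / 2 ^+ k.
Proof.
move=> /subnKC <-; set i := (m - k)%N.
suff : `|it (k + i) t - it k t| <= 2 * D / 2 ^+ k - 2 * D / 2 ^+ (k + i).
  have D0 : 0 <= 2 * D / 2 ^+ (k + i).
    by rewrite divr_ge0 ?exprn_ge0// mulr_ge0// mulr_ge0// subr_ge0.
  by move/le_trans; apply; rewrite lerBlDr lerDl.
elim: i => [|i IH]; first by rewrite addn0 !subrr normr0.
rewrite -[X in `|X|](subrKA (it (k + i) t)) (le_trans (ler_normD _ _))//.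
have := it_succ (k + i) t; rewrite addnS.
have -> : 2 * D / 2 ^+ (k + i).+1 = D / 2 ^+ (k + i).
  by rewrite exprS invfM mulrACA divff ?mul1r.
move: IH; have -> : 2 * D / 2 ^+ (k + i) = D / 2 ^+ (k + i) + D / 2 ^+ (k + i).
  by rewrite -mulrA mulr_natl mulr2n.
lra.
Qed.

Let it_cvg t : cvg (it k t @[k --> \oo]).
Proof.
apply: cauchy_cvg; apply: cauchy_exP => e e0.
have [k ke] : exists k, 2 * D / 2 ^+ k < e.
  apply: contrapT => /forallNP H; suff : e / 2 <= 0 by rewrite leNgt divr_gt0.
  apply: (@le_geometric _ _ _ (2 * D)) => k; rewrite add0r.
  have /negP := H k; rewrite -leNgt => h; lra.
exists (it k t); exists k => // m /= km.
by rewrite -ball_normE /= distrC (le_lt_trans (it_dist t km)).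
Qed.

Let p t := lim (it k t @[k --> \oo]).

Let p_dist k t : `|p t - it k t| <= 2 * D / 2 ^+ k.
Proof.
apply/ler_addgt0Pr => e e0.
have := @it_cvg t; move=> /cvgrPdist_le /(_ _ e0) [m _ Hm].
have := Hm (maxn m k); rewrite /= leq_maxl => /(_ isT) H1.
rewrite -[X in `|X|](subrKA (it (maxn m k) t)) (le_trans (ler_normD _ _))//.
by rewrite addrC lerD// it_dist// leq_maxr.
Qed.

Let lip_p : lip p.
Proof.
move=> s t; apply: (@le_geometric _ _ _ (2 * D + 2 * D)) => k.
have := p_dist k s; have := p_dist k t; have := lip_it k s t; rewrite mulrDl.
rewrite -[X in _ -> _ -> _ -> `|X| <= _](subrKA (it k s)).
rewrite -[X in _ -> _ -> _ -> `|_ + X| <= _](subrKA (it k t)).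
rewrite (distrC (p t)) => h1 h2 h3.
rewrite (le_trans (ler_normD _ _))//.
by have := ler_normD (it k s - it k t) (it k t - p t); lra.
Qed.

Let p_fix t : p t = step p t.
Proof.
apply/eqP; rewrite -subr_eq0 -normr_le0.
apply: (@le_geometric _ _ _ (2 * D + 2 * D)) => k.
have := p_dist k.+1 t.
have := step_close (lip_it k) lip_p (d := 2 * D / 2 ^+ k).
move=> /(_ _ t) h1 h2; rewrite -[X in `|X|](subrKA (it k.+1 t)).
rewrite (le_trans (ler_normD _ _))// add0r mulrDl.
have D0 : 0 <= 2 * D / 2 ^+ k.
  by rewrite divr_ge0 ?exprn_ge0// mulr_ge0// mulr_ge0// subr_ge0.
have h3 : `|it k.+1 t - step p t| <= 2 * D / 2 ^+ k / 2.
  by apply: h1 => s; rewrite distrC; exact: p_dist.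
move: h2; rewrite exprS invfM mulrCA [2^-1 * _]mulrC => h2; lra.
Qed.

(** By [Lab] the operator [step] halves distances, so its iterates converge geometrically, and their
    limit [p] is a fixed point. *)
Lemma picard_exists : exists2 p : R -> state, p a = x &
  forall j, primitive_on (fun s => G (p s) 0 j) (fun t => p t 0 j) a b.
Proof.
exists p => [|j].
  rewrite p_fix; apply/rowP => j.
  by rewrite !mxE /tc clip1_id ?lexx// set_itv1 Rintegral_set1 addr0.
rewrite (_ : (fun t => p t 0 j) = (fun t => step p t 0 j)).
  exact: prim_step lip_p.
by apply/funext => t; rewrite p_fix.
Qed.

End Picard.

Section LocalExistence.
Context {R : realType} {n : nat}.
Local Notation state := 'rV[R]_n.
Local Notation vfield := (state -> state).
Variables f g : vfield.
Hypotheses (sf : smooth_field f) (sg : smooth_field g).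

Definition clip (M : R) (x : state) : state := \row_j clip1 (- M) M (x 0 j).

Lemma clip_le (M : R) x : 0 <= M -> `|clip M x| <= M.
Proof.
move=> M0; apply: norm_le_coord => // j; rewrite mxE ler_norml.
by apply: clip1_itv; rewrite ge0_cp.
Qed.

Lemma clip_id (M : R) x : `|x| <= M -> clip M x = x.
Proof.
move=> xM; apply/rowP => j; rewrite mxE clip1_id// -ler_norml.
exact: le_trans (coord_le_norm _ _) xM.
Qed.

Lemma clip_lip (M : R) x y : `|clip M x - clip M y| <= `|x - y|.
Proof.
apply: norm_le_coord => // j; rewrite !mxE.
apply: le_trans (clip1_lip _ _ _ _) _.
by have := coord_le_norm (x - y) j; rewrite !mxE.
Qed.

(** Picard iteration for the field precomposed with [clip (M + 1)], which is globally bounded and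
    Lipschitz. A solution that starts in the ball of radius [M] moves by at most 1, hence stays
    where the clipping is the identity. *)
Lemma local_solution (M C : R) : 0 <= M ->
  exists2 tau : R, 0 < tau & forall (d r a : R) x, 0 <= d <= tau -> `|x| <= M -> `|r| <= C ->
    exists p, [/\ solves f g (fun=> r) p a (a + d), p a = x &
      forall t, a <= t <= a + d -> `|p t| <= M + 1].
Proof.
move=> M0; have M10 : 0 <= M + 1 by rewrite addr_ge0.
have [K K0 HK] := dyn_bounded sf sg (M + 1) C.
have [L L0 HL] := dyn_lipschitz sf sg (M + 1) C.
(* Small enough both for the contraction, [L * tau <= 1 / 2], and for the displacement,
   [K * tau <= 1]. *)
pose tau : R := 1 / (2 * (K + L + 1)).
have KL0 : 0 < K + L + 1 by rewrite ltr_wpDl// addr_ge0.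
have tau0 : 0 < tau by rewrite divr_gt0// mulr_gt0.
have E : (K + L + 1) * tau = 1 / 2 by rewrite /tau; field; rewrite gt_eqF.
have Lt : L * tau <= 1 / 2.
  by move: E; have := mulr_ge0 K0 (ltW tau0); rewrite !mulrDl mul1r; lra.
have Kt : K * tau <= 1.
  by move: E; have := mulr_ge0 L0 (ltW tau0); rewrite !mulrDl mul1r; lra.
exists tau => // d r a x /andP[d0 dtau] xM rC.
have [||||p pa pp] := @picard_exists R n (fun y => dyn f g (clip (M + 1) y) r) K L x a (a + d) K0 L0.
- by rewrite lerDl.
- by rewrite addrAC subrr add0r (le_trans _ Lt)// ler_wpM2l.
- by move=> y; apply: HK => //; exact: clip_le.
- move=> y z; apply: (le_trans (HL _ _ _ (clip_le _ M10) (clip_le _ M10) rC)).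
  by rewrite ler_wpM2l// clip_lip.
have pM t : a <= t <= a + d -> `|p t| <= M + 1.
  move=> /andP[at_ td]; rewrite -(subrK x (p t)) (le_trans (ler_normD _ _))//.
  rewrite addrC lerD//; apply: norm_le_coord => // j.
  have := primitive_on_lip (pp j) (M := K) _ (lexx a) at_ td.
  rewrite pa !mxE => h; apply: (le_trans (h _)).
    move=> s _; rewrite (le_trans (coord_le_norm _ _))// HK//; exact: clip_le.
  by rewrite (le_trans _ Kt)// ler_wpM2l// lerBlDl (le_trans td)// lerD2l.
exists p; split => // j; apply: primitive_on_eq (pp j) => // s /andP[as_ sd].
by rewrite clip_id// pM// as_ ltW.
Qed.

End LocalExistence.

(** * Taylor's formula along solutions *)

Section Taylor.
Context {R : realType} {n : nat}.
Local Notation state := 'rV[R]_n.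
Local Notation vfield := (state -> state).
Variables f g : vfield.
Hypotheses (sf : smooth_field f) (sg : smooth_field g).
Implicit Types (h : state -> R) (p : R -> state) (a b t : R).

Let sZ (r : R) : smooth_field (f + r *: g).
Proof. by apply: smooth_fieldD => //; exact: smooth_fieldZ. Qed.

(* Freezing a solution outside of its interval of definition makes it globally
   continuous. *)
Lemma solves_const_extend (r : R) p a b : a <= b -> solves f g (fun=> r) p a b ->
  exists q, [/\ solves f g (fun=> r) q a b, continuous q &
    forall t, a <= t <= b -> q t = p t].
Proof.
move=> ab sp; pose q t := p (clip1 a b t).
have qp t : a <= t <= b -> q t = p t by move=> tab; rewrite /q clip1_id.
exists q; split => //.
  by apply: solves_eq sp => // s sab; rewrite qp.
have [B B0 HB] := solves_bounded sp.
have [K K0 HK] := dyn_bounded sf sg B `|r|.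
have lp := solves_lipschitz K0 HK sp (fun=> lexx _) HB.
have lip s t : `|q s - q t| <= K * `|s - t|.
  apply: (@le_trans _ _ (K * `|clip1 a b s - clip1 a b t|)); last first.
    by rewrite ler_wpM2l// clip1_lip.
  have /andP[as_ sb] := clip1_itv s ab; have /andP[at_ tb] := clip1_itv t ab.
  rewrite /q; have [st|/ltW ts] := leP (clip1 a b s) (clip1 a b t).
    rewrite distrC (distrC (clip1 a b s)) (ger0_norm (x := clip1 a b t - _)) ?subr_ge0//.
    exact: lp.
  by rewrite (ger0_norm (x := clip1 a b s - _)) ?subr_ge0//; exact: lp.
move=> s; apply/cvgrPdist_le => /= e e0.
have K1 : 0 < K + 1 by rewrite ltr_wpDl.
near=> t; apply: (le_trans (lip s t)).
apply: (@le_trans _ _ ((K + 1) * `|s - t|)); first by rewrite mulrDl mul1r lerDl.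
rewrite mulrC -ler_pdivlMr//; near: t.
apply/nbhs_ballP; exists (e / (K + 1)); first by rewrite /= divr_gt0.
by move=> t /ltW.
Unshelve. all: by end_near. Qed.

Lemma is_derive_solves (r : R) p a b h t : continuous p -> solves f g (fun=> r) p a b ->
  smooth h -> a < t < b -> is_derive t 1 (h \o p) (lieD (f + r *: g) h (p t)).
Proof.
move=> cp sp sh tab.
have dj j : is_derive t 1 (fun s => p s 0 j) (dyn f g (p t) r 0 j).
  apply: (primitive_on_derive (sp j) tab).
  have cj : continuous (fun x => (f + r *: g) x 0 j) := smooth_continuous (sZ r j).
  exact: (continuous_comp (cp t) (cj (p t))).
have dp : derivable p t 1.
  by apply/derivable_mxP => i j; rewrite ord1; exact: (@ex_derive _ _ _ _ _ _ _ (dj j)).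
have Dp : 'D_1 p t = (f + r *: g) (p t).
  rewrite derive_mx//; apply/rowP => j; rewrite mxE.
  exact: (@derive_val _ _ _ _ _ _ _ (dj j)).
have dfp : differentiable p t by apply/derivable1_diffP.
have dh : differentiable h (p t) by exact: smooth_differentiable.
split; first by apply: diff_derivable; exact: differentiable_comp.
rewrite deriveE; last exact: differentiable_comp.
by rewrite diff_comp//= /lieD -Dp deriveE.
Qed.

(** The derivative of the remainder for [h] is the remainder, of one order less, for [lieD Z h]; the
    mean value theorem then contributes one factor [t - a]. The factorial of the usual remainder is
    given up. *)
Lemma taylor_solves (r : R) p a b (M B : R) N h : solves f g (fun=> r) p a b -> smooth h ->
  (forall t, a <= t <= b -> `|p t| <= M) ->
  (forall x, `|x| <= M -> `|iter N (lieD (f + r *: g)) h x| <= B) ->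
  forall t, a <= t <= b ->
  `|h (p t) - \sum_(k < N) (t - a) ^+ k * lie_exp (f + r *: g) k h (p a)| <= B * (t - a) ^+ N.
Proof.
move=> sp0 + pM0 + t0 /[dup] t0ab /andP[at0 t0b].
have [p' [sp cp p'p]] := solves_const_extend (le_trans at0 t0b) sp0.
have pM t : a <= t <= b -> `|p' t| <= M by move=> tab; rewrite p'p// pM0.
rewrite -!p'p ?lexx ?(le_trans at0)// {sp0 p'p pM0 p}.
set Z := f + r *: g.
elim: N h t0 t0ab at0 t0b => [|N IH] h t tab at_ tb sh HB.
  by rewrite big_ord0 subr0 expr0 mulr1; apply: HB; exact: pM.
have HB' : forall x, `|x| <= M -> `|iter N (lieD Z) (lieD Z h) x| <= B.
  by move=> x xM; rewrite -iterSr; exact: HB.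
have sZh : smooth (lieD Z h) by apply: smooth_lieD => //; exact: sZ.
pose c k := lie_exp Z k h (p' a).
pose phi t := h (p' t) - \sum_(k < N.+1) (t - a) ^+ k * c k.
pose dphi t := lieD Z h (p' t) - \sum_(k < N) (t - a) ^+ k * lie_exp Z k (lieD Z h) (p' a).
have dpow (s : R) k : is_derive s 1 (fun t : R => (t - a) ^+ k * c k) (k%:R * (s - a) ^+ k.-1 * c k).
  have -> : (fun t : R => (t - a) ^+ k * c k) = c k \*: ((id - cst a) ^+ k).
    by apply/funext => z; rewrite [RHS]/(_ *: _) /= exprfctE mulrC.
  apply: is_derive_eq.
  by rewrite subr0 [_ *: 1]mulr1 [LHS]mulrC mulr_natl.
have dsum (s : R) : is_derive s 1 (fun t : R => \sum_(k < N.+1) (t - a) ^+ k * c k)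
    (\sum_(k < N) (s - a) ^+ k * lie_exp Z k (lieD Z h) (p' a)).
  have -> : (fun t : R => \sum_(k < N.+1) (t - a) ^+ k * c k) =
      \sum_(k < N.+1) (fun t : R => (t - a) ^+ k * c k).
    by apply/funext => z; rewrite fct_sumE.
  have E : \sum_(k < N.+1) k%:R * (s - a) ^+ k.-1 * c k =
      \sum_(k < N) (s - a) ^+ k * lie_exp Z k (lieD Z h) (p' a).
    rewrite big_ord_recl mul0r mul0r add0r; apply: eq_bigr => k _.
    by rewrite lift0 /= /c -lie_expSr mulrAC mulrC mulrA.
  by rewrite -E; exact: (is_derive_sum (fun k : 'I_N.+1 => dpow s k)).
have dphiE s : a < s < t -> is_derive s 1 phi (dphi s).
  move=> /andP[as_ st]; apply: is_deriveB => //.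
  apply: (is_derive_solves cp sp) => //; by rewrite as_ (lt_le_trans st).
have cphi : continuous phi.
  have ch : continuous h := smooth_continuous sh.
  move=> s; apply: (@continuousB _ _ _ (h \o p') (fun t => \sum_(k < N.+1) (t - a) ^+ k * c k)).
    exact: (continuous_comp (cp s) (ch (p' s))).
  apply: differentiable_continuous; apply/derivable1_diffP.
  exact: (@ex_derive _ _ _ _ _ _ _ (dsum s)).
have dphi_itv s : s \in `]a, t[ -> is_derive s 1 phi (dphi s).
  by rewrite in_itv/=; exact: dphiE.
have [s sat] := @MVT_segment R phi dphi a t at_ dphi_itv (continuous_subspaceT cphi).
have -> : phi a = 0.
  rewrite /phi big_ord_recl big1 => [|k _]; last by rewrite subrr expr0n mul0r.
  by rewrite expr0 mul1r addr0 /c lie_exp0 subrr.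
rewrite subr0 => phit; rewrite -/(phi t) phit.
move: sat; rewrite in_itv/= => /andP[as_ st].
have sb := le_trans st tb.
have B0 : 0 <= B by rewrite (le_trans _ (HB _ (pM _ tab))).
rewrite normrM (ger0_norm (x := t - a)) ?subr_ge0// exprSr mulrA ler_wpM2r ?subr_ge0//.
apply: (le_trans (IH _ s _ as_ sb sZh HB')); first by rewrite as_.
by rewrite ler_wpM2l// lerXn2r ?nnegrE ?subr_ge0// lerB.
Qed.

End Taylor.

(** * Decrease of [V] along genuine two-stage trajectories *)

Section TwoStageDescent.
Context {R : realType} {n : nat}.
Local Notation state := 'rV[R]_n.
Local Notation vfield := (state -> state).
Variables f g : vfield.
Hypotheses (sf : smooth_field f) (sg : smooth_field g).
Variable V : state -> R.
Hypothesis sV : smooth V.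

Let sZ (r : R) : smooth_field (f + r *: g).
Proof. by apply: smooth_fieldD => //; exact: smooth_fieldZ. Qed.

Lemma lie_exp_scalel (c : R) (Z : vfield) j (h : state -> R) : smooth_field Z -> smooth h ->
  lie_exp (c *: Z) j h = c ^+ j *: lie_exp Z j h.
Proof.
move=> sZ' sh; rewrite /lie_exp scalerA mulrC -scalerA; congr (_ *: _).
elim: j => [|j IH]; first by rewrite expr0 scale1r.
rewrite !iterS IH lieDZl lieDZr; last exact: smooth_iter_lieD.
by rewrite scalerA -exprS.
Qed.

(** The second stage is expanded first, at the switching point; then each coefficient [h j] is
    expanded along the first stage up to order [N.+1 - j]. The triangular double sum regroups into
    [flow_coef]. *)
Lemma two_stage_expansion (r1 r2 th M : R) N : 0 < th ->
  exists2 B : R, 0 <= B & forall (e a : R) p1 p2, 0 < e ->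
    solves f g (fun=> r1) p1 a (a + e) -> solves f g (fun=> r2) p2 (a + e) (a + e + th * e) ->
    p2 (a + e) = p1 (a + e) ->
    (forall t, a <= t <= a + e -> `|p1 t| <= M) ->
    (forall t, a + e <= t <= a + e + th * e -> `|p2 t| <= M) ->
    `|V (p2 (a + e + th * e)) - \sum_(k < N.+1) e ^+ k *
        flow_coef (f + r1 *: g) (th *: (f + r2 *: g)) V k (p1 a)| <= B * e ^+ N.+1.
Proof.
move=> th0; set Z := f + r1 *: g; set W := f + r2 *: g; set Y := th *: W.
have sW : smooth_field W by exact: sZ.
have sY : smooth_field Y by exact: smooth_fieldZ.
pose h j := lie_exp Y j V.
have sh j : smooth (h j) by exact: smooth_lie_exp.
have [B0 B00 HB0] := bounded_on_ball M (smooth_continuous (smooth_iter_lieD N.+1 (sZ r2) sV)).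
have /(_ _)/cid2 B j := bounded_on_ball M
  (smooth_continuous (smooth_iter_lieD (N.+1 - j) (sZ r1) (sh j))).
pose b j := sval (B j).
have b0 j : 0 <= b j by rewrite /b; case: (B j).
have bE j x : `|x| <= M -> `|iter (N.+1 - j) (lieD Z) (h j) x| <= b j.
  by rewrite /b; case: (B j) => /= c _; exact.
exists (B0 * th ^+ N.+1 + \sum_(j < N.+1) b j).
  by rewrite addr_ge0 ?sumr_ge0// mulr_ge0// exprn_ge0// ltW.
move=> e a p1 p2 e0 s1 s2 p21 p1M p2M.
have ae : a <= a + e by rewrite lerDl ltW.
have aee : a + e <= a + e + th * e by rewrite lerDl mulr_ge0// ltW.
have := taylor_solves sf sg s2 sV p2M HB0 (t := a + e + th * e).
have tE : a + e + th * e - (a + e) = th * e by ring.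
rewrite aee lexx => /(_ isT); rewrite p21 tE.
set x1 := p1 (a + e).
have -> : \sum_(k < N.+1) (th * e) ^+ k * lie_exp W k V x1 = \sum_(k < N.+1) e ^+ k * h k x1.
  apply: eq_bigr => k _; rewrite /h /Y lie_exp_scalel//.
  by rewrite exprMn mulrAC -mulrA mulrCA [RHS]mulrCA mulrC -mulrA.
have E2 j : (j < N.+1)%N -> `|h j x1 - \sum_(i < N.+1 - j) e ^+ i * lie_exp Z i (h j) (p1 a)| <=
    b j * e ^+ (N.+1 - j).
  move=> jN; have := taylor_solves sf sg s1 (sh j) p1M (bE j) (t := a + e).
  by rewrite ae lexx => /(_ isT); rewrite addrAC subrr add0r.
have -> : \sum_(k < N.+1) e ^+ k * flow_coef Z Y V k (p1 a) =
    \sum_(j < N.+1) e ^+ j * \sum_(i < N.+1 - j) e ^+ i * lie_exp Z i (h j) (p1 a).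
  transitivity (\sum_(k < N.+1) \sum_(l < k.+1) e ^+ k * lie_exp Z (k - l) (h l) (p1 a)).
    apply: eq_bigr => k _; rewrite -mulr_sumr /flow_coef fct_sumE; congr (_ * _).
    rewrite (reindex_inj rev_ord_inj) /=; apply: eq_bigr => i _.
    by rewrite subSS subKn// -ltnS.
  rewrite (sum_triangle (fun k l => e ^+ k * lie_exp Z (k - l) (h l) (p1 a))).
  apply: eq_bigr => j _; rewrite mulr_sumr -subSn; last by rewrite -ltnS.
  by apply: eq_bigr => i _; rewrite addKn exprD mulrA.
move=> E1.
rewrite -(subrKA (\sum_(k < N.+1) e ^+ k * h k x1)) (le_trans (ler_normD _ _))//.
rewrite mulrDl lerD//; first by rewrite -mulrA -exprMn.
rewrite -sumrB (le_trans (ler_norm_sum _ _ _))// mulr_suml; apply: ler_sum => j _.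
rewrite -mulrBr normrM ger0_norm ?exprn_ge0 ?(ltW e0)//.
have -> : e ^+ N.+1 = e ^+ j * e ^+ (N.+1 - j) by rewrite -exprD subnKC// ltnW.
by rewrite [leRHS]mulrCA ler_wpM2l ?exprn_ge0 ?(ltW e0)// E2.
Qed.

Lemma two_stage_descent (C M : R) x0 : descent_at f g V C x0 ->
  exists r1 r2 th e0 : R, [/\ `|r1| <= C, `|r2| <= C, 0 < th, 0 < e0 &
    forall e, 0 < e <= e0 -> exists2 d : R, 0 < d & forall a p1 p2,
    solves f g (fun=> r1) p1 a (a + e) -> solves f g (fun=> r2) p2 (a + e) (a + e + th * e) ->
    p1 a = x0 -> p2 (a + e) = p1 (a + e) ->
    (forall t, a <= t <= a + e -> `|p1 t| <= M) ->
    (forall t, a + e <= t <= a + e + th * e -> `|p2 t| <= M) ->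
    V (p2 (a + e + th * e)) <= V x0 - d].
Proof.
move=> [r1 [r2 [th [N [r1C r2C th0 Q0]]]]].
set Z := f + r1 *: g in Q0 *; set Y := th *: (f + r2 *: g) in Q0 *.
set Q := flow_coef Z Y V N.+1 x0 => Qlt0.
have [B B0 HB] := two_stage_expansion r1 r2 M N.+1 th0.
have B1 : 0 < B + 1 by rewrite ltr_wpDl.
(* Below this length the remainder is at most half of the negative leading term. *)
exists r1, r2, th, (- Q / (2 * (B + 1))); split => //.
  by rewrite divr_gt0 ?mulr_gt0// oppr_gt0.
move=> e /andP[epos ee]; exists (- Q / 2 * e ^+ N.+1).
  by rewrite mulr_gt0 ?exprn_gt0// divr_gt0// oppr_gt0.
move=> a p1 p2 s1 s2 p1a p21 p1M p2M.
have := HB e a p1 p2 epos s1 s2 p21 p1M p2M; rewrite p1a big_ord_recr big_ord_recl /=.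
rewrite big1 => [|k _]; last by rewrite Q0 ?mulr0//= ltn_ord.
rewrite -/Z -/Y -/Q addr0 flow_coef0 expr0 mul1r ler_distl => /andP[_ /le_trans]; apply.
have Be : (B + 1) * e <= - Q / 2.
  move: ee; rewrite ler_pdivlMr ?mulr_gt0// => ee; rewrite ler_pdivlMr//.
  by move: ee; lra.
have : e ^+ N.+1 * (Q + B * e) <= e ^+ N.+1 * (Q / 2).
  by rewrite ler_wpM2l ?exprn_ge0 ?(ltW epos)//; move: Be; rewrite mulrDl mul1r; lra.
rewrite (exprS e N.+1); lra.
Qed.

End TwoStageDescent.

(** * Steps valid in a neighbourhood of a given state *)

Section LocalStep.
Context {R : realType} {n : nat}.
Local Notation state := 'rV[R]_n.
Local Notation vfield := (state -> state).

Lemma exists_lower_bound (s : seq R) : (forall r, r \in s -> 0 < r) ->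
  exists2 e : R, 0 < e & forall r, r \in s -> e <= r.
Proof.
elim: s => [|r s IH] H; first by exists 1.
have [q qs|e e0 He] := IH; first by apply: H; rewrite inE qs orbT.
exists (Num.min r e); first by rewrite lt_min e0 H// inE eqxx.
move=> q; rewrite inE => /predU1P[->|qs]; first by rewrite ge_min lexx.
by rewrite ge_min (He _ qs) orbT.
Qed.

Lemma measurable_splice (c : R) (u v : R -> R) :
  measurable_fun setT u -> measurable_fun setT v -> measurable_fun setT (splice c u v).
Proof.
move=> mu mv; apply: measurable_fun_ifT => //.
by apply: measurable_fun_ltr => //; exact: measurable_cst.
Qed.

Lemma splice_le (c C : R) (u v : R -> R) : (forall s, `|u s| <= C) -> (forall s, `|v s| <= C) ->
  forall s, `|splice c u v s| <= C.
Proof. by move=> uC vC s; rewrite /splice; case: ifP. Qed.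

Variables f g : vfield.
Hypotheses (sf : smooth_field f) (sg : smooth_field g).
Variable V : state -> R.
Hypothesis sV : smooth V.
Variable C : R.
Hypothesis C0 : 0 <= C.

Definition plan (a b : R) (x : state) (u : R -> R) (p : R -> state) :=
  [/\ measurable_fun setT u, (forall s, `|u s| <= C), solves f g u p a b & p a = x].

Lemma plan_const (a b r : R) x p : `|r| <= C -> solves f g (fun=> r) p a b -> p a = x ->
  plan a b x (fun=> r) p.
Proof. by move=> rC sp pa; split => //; exact: measurable_cst. Qed.

Lemma plan_cat (a c b : R) x u v p q : a <= c -> c <= b ->
  plan a c x u p -> plan c b (p c) v q -> plan a b x (splice c u v) (splice c p q).
Proof.
move=> ac cb [mu uC sp pa] [mv vC sq qc]; split.
- exact: measurable_splice.
- exact: splice_le.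
- exact: solves_cat.
- rewrite /splice; case: ltgtP ac => // E _.
  by rewrite E qc -E.
Qed.

(** The floor [lo] accounts for states near the origin, where no definite decrease is available;
    [eta] bounds the rise of [V] before the step ends. *)
Definition good_step (lo eta delta a sig : R) x := exists u p,
  [/\ plan a (a + sig) x u p,
      (forall t, a <= t <= a + sig -> V (p t) <= Num.max lo (V x) + eta) &
      V (p (a + sig)) <= Num.max lo (V x - delta)].

(** Near the origin it suffices to remain below [lo], and a short uncontrolled run does so by
    continuity of [V]. Hence any positive [delta] serves. *)
Lemma good_step_origin (lo eta D : R) : f 0 = 0 -> V 0 < lo -> 0 < eta -> 0 < D ->
  exists rho sig delta : R, [/\ 0 < rho, 0 < sig <= D, 0 < delta &
    forall a x, `|x| < rho -> good_step lo eta delta a sig x].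
Proof.
move=> f0 V0 eta0 D0.
have cV : continuous V := smooth_continuous sV.
have := cV 0; move=> /cvgrPdist_lt /(_ (lo - V 0)); rewrite subr_gt0 => /(_ V0).
move=> /nbhs_ballP[rho0 /= rho00 Hrho].
have Vlo y : `|y| < rho0 -> V y < lo.
  move=> yr; have : ball (0 : state) rho0 y by rewrite -ball_normE /= sub0r normrN.
  by move=> /Hrho /=; rewrite ltr_distlC => /andP[_]; rewrite subrKC.
have [tau tau0 Htau] := local_solution sf sg C ler01.
have [K K0 HK] := dyn_bounded sf sg (1 + 1) C.
have K1 : 0 < K + 1 by rewrite ltr_wpDl.
have rK0 : 0 < rho0 / 2 / (K + 1) by rewrite !divr_gt0.
have [r|sig sig0 Hsig] := @exists_lower_bound [:: D; tau; rho0 / 2 / (K + 1)].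
  by rewrite !inE => /or3P[/eqP->|/eqP->|/eqP->].
have [Hs1 Hs2 Hs3] : [/\ sig <= D, sig <= tau & sig <= rho0 / 2 / (K + 1)].
  by split; apply: Hsig; rewrite !inE eqxx ?orbT.
exists (Num.min 1 (rho0 / 2)), sig, 1; split => //.
- by rewrite lt_min ltr01 divr_gt0.
- by rewrite sig0.
move=> a x; rewrite lt_min => /andP[x1 xr].
have r0C : `|0 : R| <= C by rewrite normr0.
have [|p [sp pa pM]] := Htau sig 0 a x _ (ltW x1) r0C; first by rewrite ltW.
have pV t : a <= t <= a + sig -> V (p t) <= lo.
  move=> /andP[at_ ts]; apply/ltW/Vlo; rewrite -(subrK x (p t)).
  apply: (le_lt_trans (ler_normD _ _)); rewrite [ltRHS]splitr ler_ltD// .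
  have := solves_lipschitz K0 HK sp (fun=> r0C) pM (lexx a) at_ ts.
  rewrite pa => /le_trans; apply.
  move: Hs3; rewrite ler_pdivlMr// => /(le_trans _); apply.
  rewrite mulrC ler_pM// ?subr_ge0//; last by rewrite lerDl.
  by rewrite lerBlDl.
exists (fun=> 0), p; split.
- exact: plan_const.
- by move=> t /pV; rewrite /Num.max; case: ifP => h {Hsig Hs1 Hs2 Hs3 K0 K1 rK0}; lra.
- by rewrite le_max pV// lerDl (ltW sig0) lexx.
Qed.

(** The controls found at [x0] are used for all nearby starting points: each stage at most doubles
    the distance to the run from [x0], and [V] is Lipschitz, so half of the decrease [d]
    survives. *)
Lemma good_step_descent (lo eta D : R) x0 : descent_at f g V C x0 -> 0 < eta -> 0 < D ->
  exists rho sig delta : R, [/\ 0 < rho, 0 < sig <= D, 0 < delta &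
    forall a x, `|x - x0| < rho -> good_step lo eta delta a sig x].
Proof.
move=> dx0 eta0 D0.
pose M := `|x0| + 2; have M0 : 0 <= M by rewrite addr_ge0.
have ME : `|x0| + 1 + 1 = M by rewrite -addrA.
have M1 : M <= M + 1 by rewrite lerDl.
have x0M1 : `|x0| <= M + 1 by rewrite (le_trans _ M1)// lerDl.
have [tau tau0 Htau] := local_solution sf sg C M0.
have [K K0 HK] := dyn_bounded sf sg (M + 1) C.
have [L L0 HL] := dyn_lipschitz sf sg (M + 1) C.
have [LV LV0 HLV] := lipschitz_fun (M + 1) sV.
have [r1 [r2 [th [e0 [r1C r2C th0 e00 H2]]]]] := two_stage_descent sf sg sV (M + 1) dx0.
have K1 : 0 < K + 1 by rewrite ltr_wpDl.
have L1 : 0 < L + 1 by rewrite ltr_wpDl.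
have LVK0 : 0 <= LV * K by exact: mulr_ge0.
have LVK : 0 < LV * K + 1 by rewrite ltr_wpDl.
have th1 : 0 < 1 + th by rewrite ltr_wpDl.
(* In order: prescribed maximal length, existence of solutions, displacement at most 1, doubling of
   distances at most, overshoot at most [eta], range of [two_stage_descent]. *)
have [r|sig sig0 Hsig] := @exists_lower_bound
   [:: D; tau; (K + 1)^-1; (2 * (L + 1))^-1; eta / (LV * K + 1); e0].
  by rewrite !inE => /or3P[/eqP->|/eqP->|/or4P[/eqP->|/eqP->|/eqP->|/eqP->]] //;
    rewrite ?invr_gt0 ?divr_gt0 ?mulr_gt0.
have sD : sig <= D by apply: Hsig; rewrite !inE eqxx.
have stau : sig <= tau by apply: Hsig; rewrite !inE eqxx ?orbT.
have sK : (K + 1) * sig <= 1.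
  by rewrite -ler_pdivlMl// mulr1; apply: Hsig; rewrite !inE eqxx ?orbT.
have sL : 2 * (L + 1) * sig <= 1.
  by rewrite -ler_pdivlMl ?mulr_gt0// mulr1; apply: Hsig; rewrite !inE eqxx ?orbT.
have sE : (LV * K + 1) * sig <= eta.
  by rewrite -ler_pdivlMl// mulrC; apply: Hsig; rewrite !inE eqxx ?orbT.
have se0 : sig <= e0 by apply: Hsig; rewrite !inE eqxx ?orbT.
clear Hsig.
pose e := sig / (1 + th).
have epos : 0 < e by rewrite divr_gt0.
have sigE : e + th * e = sig by rewrite /e -{1}[_ / _]mul1r -mulrDl mulrC divfK// gt_eqF.
have the0 : 0 <= th * e by rewrite mulr_ge0// ltW.
have es : e <= sig by rewrite -sigE lerDl.
have thes : th * e <= sig by rewrite -sigE lerDr ltW.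
have [|d d0 Hd] := H2 e; first by rewrite epos (le_trans es).
clearbody e.
have Ks : K * sig <= 1 by move: sK; rewrite mulrDl mul1r; lra.
have Ls : L * sig <= 1 / 2 by move: sL; rewrite -mulrA mulrDl mul1r; lra.
have Es : LV * (K * sig) <= eta by move: sE; rewrite mulrDl mul1r -mulrA; lra.
have run a x : `|x| <= `|x0| + 1 -> exists p1 p2,
    [/\ solves f g (fun=> r1) p1 a (a + e), solves f g (fun=> r2) p2 (a + e) (a + e + th * e),
        p1 a = x /\ p2 (a + e) = p1 (a + e),
        (forall t, a <= t <= a + e -> `|p1 t| <= M + 1) &
        (forall t, a + e <= t <= a + e + th * e -> `|p2 t| <= M + 1)].
  move=> xM; have xM' : `|x| <= M by rewrite (le_trans xM)// -ME lerDl.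
  have [|p1 [s1 p1a p1M]] := Htau e r1 a x _ xM' r1C; first by rewrite ltW//= (le_trans es).
  have ae : a <= a + e by rewrite lerDl ltW.
  have x1M : `|p1 (a + e)| <= M.
    have := solves_lipschitz K0 HK s1 (fun=> r1C) p1M (lexx a) ae (lexx _).
    rewrite addrAC subrr add0r p1a => h.
    rewrite -(subrK x (p1 _)) (le_trans (ler_normD _ _))//.
    have Ke : K * e <= 1 by rewrite (le_trans _ Ks)// ler_wpM2l.
    by rewrite -ME [leRHS]addrC lerD// (le_trans h).
  have [|p2 [s2 p2a p2M]] := Htau (th * e) r2 (a + e) _ _ x1M r2C.
    by rewrite the0 (le_trans thes).
  by exists p1, p2; split.
(* The final values of [V] differ by at most [4 * LV] times the distance to [x0], the initial ones
   by [LV] times it; hence the 5. *)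
pose rho := Num.min 1 (d / 2 / (5 * LV + 1)).
have LV1 : 0 < 5 * LV + 1 by rewrite ltr_wpDl// mulr_ge0.
have rho0 : 0 < rho by rewrite lt_min ltr01 !divr_gt0.
exists rho, sig, (d / 2); split => //; [by rewrite sig0|by rewrite divr_gt0|].
move=> a x xr.
have x1 : `|x - x0| < 1 by rewrite (lt_le_trans xr)// ge_min lexx.
have xd : (5 * LV + 1) * `|x - x0| <= d / 2.
  by rewrite -ler_pdivlMl// mulrC (le_trans (ltW xr))// ge_min lexx orbT.
have xM : `|x| <= `|x0| + 1.
  by rewrite -(subrK x0 x) (le_trans (ler_normD _ _))// addrC lerD2l ltW.
have [p1 [p2 [s1 s2 [p1a p21] p1M p2M]]] := run a x xM.
have x0M : `|x0| <= `|x0| + 1 by rewrite lerDl.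
have [q1 [q2 [t1 t2 [q1a q21] q1M q2M]]] := run a x0 x0M.
have ae : a <= a + e by rewrite lerDl ltW.
have aee : a + e <= a + e + th * e by rewrite lerDl.
have asE : a + e + th * e = a + sig by rewrite -addrA sigE.
have Hend := Hd a q1 q2 t1 t2 q1a q21 q1M q2M.
have xM1 : `|x| <= M + 1 by rewrite (le_trans xM)// (le_trans _ M1)// -ME lerDl.
have near1 t : a <= t <= a + e -> `|p1 t - x| <= K * e.
  move=> /andP[at_ te]; rewrite -p1a.
  apply: (le_trans (solves_lipschitz K0 HK s1 (fun=> r1C) p1M (lexx a) at_ te)).
  by rewrite ler_wpM2l// lerBlDl.
have near2 t : a + e <= t <= a + e + th * e -> `|p2 t - x| <= K * sig.
  move=> /andP[at_ te]; rewrite -(subrKA (p2 (a + e))) (le_trans (ler_normD _ _))//.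
  have := solves_lipschitz K0 HK s2 (fun=> r2C) p2M (lexx _) at_ te.
  have := near1 (a + e); rewrite ae lexx p21 => /(_ isT) h1 h2.
  have Kt : K * (t - (a + e)) <= K * (th * e) by rewrite ler_wpM2l// lerBlDl.
  by rewrite -sigE mulrDr [leRHS]addrC lerD// (le_trans h2).
have Vnear y : `|y| <= M + 1 -> `|y - x| <= K * sig -> V y <= V x + eta.
  move=> yM yx; rewrite -lerBlDl (le_trans (ler_norm _))//.
  by rewrite (le_trans (HLV _ _ yM xM1))// (le_trans _ Es)// ler_wpM2l.
have c1 : `|p1 (a + e) - q1 (a + e)| <= 2 * `|x - x0|.
  rewrite -p1a -q1a; apply: (solves_dist L0 _ HL s1 t1 (fun=> r1C) p1M q1M).
    by rewrite addrAC subrr add0r (le_trans _ Ls)// ler_wpM2l.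
  by rewrite ae lexx.
have c2 : `|p2 (a + sig) - q2 (a + sig)| <= 2 * `|p1 (a + e) - q1 (a + e)|.
  rewrite -p21 -q21 -asE; apply: (solves_dist L0 _ HL s2 t2 (fun=> r2C) p2M q2M).
    by rewrite addrAC subrr add0r (le_trans _ Ls)// ler_wpM2l.
  by rewrite aee lexx.
exists (splice (a + e) (fun=> r1) (fun=> r2)), (splice (a + e) p1 p2); split.
- by rewrite -asE; apply: plan_cat; [|by []|exact: plan_const..].
- move=> t /andP[at_ ts]; apply: (@le_trans _ _ (V x + eta)); last first.
    by rewrite lerD2r le_max lexx orbT.
  rewrite /splice; case: ltP => te; apply: Vnear.
  + by apply: p1M; rewrite at_ ltW.
  + by apply: (le_trans (near1 t _)); [rewrite at_ ltW|rewrite ler_wpM2l].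
  + by apply: p2M; rewrite te asE.
  + by apply: near2; rewrite te asE.
- rewrite le_max; apply/orP; right.
  rewrite /splice -asE ltNge aee /= asE.
  rewrite asE in Hend.
  have b1 : `|p2 (a + sig)| <= M + 1 by apply: p2M; rewrite -asE aee lexx.
  have b2 : `|q2 (a + sig)| <= M + 1 by apply: q2M; rewrite -asE aee lexx.
  have h1 := HLV _ _ b1 b2.
  have h2 := HLV _ _ xM1 x0M1.
  have : LV * `|p2 (a + sig) - q2 (a + sig)| <= LV * (4 * `|x - x0|).
    by rewrite ler_wpM2l// (le_trans c2)// (natrM _ 2 2) -mulrA ler_wpM2l.
  have := ler_norm (V (p2 (a + sig)) - V (q2 (a + sig))).
  have : V x0 - V x <= `|V x - V x0| by rewrite distrC ler_norm.
  have := normr_ge0 (x - x0).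
  by move: xd Hend h1 h2; rewrite mulrDl mul1r; clear; lra.
Qed.

End LocalStep.

(** * Plans over long time intervals *)

Section WindowPlans.
Context {R : realType} {n : nat}.
Local Notation state := 'rV[R]_n.
Local Notation vfield := (state -> state).
Variables f g : vfield.
Hypotheses (sf : smooth_field f) (sg : smooth_field g) (f0 : f 0 = 0).
Variable V : state -> R.
Hypotheses (sV : smooth V) (V0 : V 0 = 0).
Variables C c : R.
Hypotheses (C0 : 0 <= C) (cV : compact [set x | V x <= c]).
Hypothesis descent : forall x, x != 0 -> V x <= c -> descent_at f g V C x.

Let good_step := good_step f g V C.
Let plan := plan f g C.

(** Compactness of the sublevel set, in covering form, turns the local durations and decreases into
    one lower bound [d] for both. *)
Lemma uniform_step (lo eta : R) : 0 < lo -> 0 < eta ->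
  exists2 d : R, 0 < d & forall x a, V x <= c ->
    exists2 sig : R, d <= sig <= 1 & good_step lo eta d a sig x.
Proof.
move=> lo0 eta0.
pose P (d : R) (x : state) := forall a, exists2 sig, d <= sig <= 1 & good_step lo eta d a sig x.
have /compact_near_coveringP/(_ R (0^'+)%R P _) H := cV.
have : \forall d \near 0^'+, [set x | V x <= c] `<=` P d.
  apply: H => x0 /= Vx0.
  have [rho [sig [delta [rho0 /andP[sig0 sig1] delta0 Hx]]]] :
      exists rho sig delta : R, [/\ 0 < rho, 0 < sig <= 1, 0 < delta &
        forall a (x : state), `|x - (x0 : state)| < rho -> good_step lo eta delta a sig x].
    have [->|x00] := eqVneq x0 0.
      have Vlo : V 0 < lo by rewrite V0.
      have [rho [sig [delta [h1 h2 h3 h4]]]] :=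
        good_step_origin sf sg sV C0 f0 Vlo eta0 ltr01.
      by exists rho, sig, delta; split => // a x; rewrite subr0; exact: h4.
    exact: (good_step_descent sf sg sV lo (descent x00 Vx0) eta0 ltr01).
  exists ([set x : state | `|x - (x0 : state)| < rho], [set d | d <= Num.min sig delta]) => /=.
    split.
      apply/nbhs_ballP; exists rho => // y; rewrite -ball_normE /= distrC.
      by [].
    apply: nbhs_right_le; by rewrite lt_min sig0.
  move=> [x d] /= [xr]; rewrite le_min => /andP[ds dd] a.
  exists sig; first by rewrite ds.
  have [u [p [pl Vp Vend]]] := Hx a x xr; exists u, p; split => //.
  by rewrite (le_trans Vend)// ge_max le_max lexx /= le_max lerD2l lerN2 dd orbT.
move=> /(filterI (nbhs_right_gt (0 : R))) /filter_ex [d [d0 Hd]].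
by exists d => // x a Vx; exact: Hd.
Qed.

(** Steps of length between [d] and 1 are chained, each gaining [d] until [lo] is reached. The
    horizon may cut the last step, of which only the overshoot bound remains: hence the final
    [+ eta] and the [- 1] in the duration. *)
Lemma iterated_plan (lo eta : R) : 0 < lo <= c -> 0 < eta -> exists2 d : R, 0 < d &
  forall x a b, V x <= c -> a <= b -> exists u p, [/\ plan a b x u p,
    (forall t, a <= t <= b -> V (p t) <= Num.max lo (V x) + eta) &
    V (p b) <= Num.max lo (V x - d * Num.max 0 (b - a - 1)) + eta].
Proof.
move=> /andP[lo0 loc] eta0; have [d d0 Hd] := uniform_step lo0 eta0.
exists d => // x a b Vx ab.
have [k bk] : exists k : nat, b - a <= k%:R * d.
  exists (Num.truncn ((b - a) / d)).+1; rewrite -ler_pdivrMr// ltW//.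
  exact: truncnS_gt.
elim: k x a Vx ab bk => [|k IH] x a Vx ab bk.
  have ba : b = a by apply/eqP; rewrite eq_le ab andbT -subr_le0; move: bk; rewrite mul0r.
  have [sig sg1 [u [p [[mu uC sp pa] Vp _]]]] := Hd x a Vx.
  have sig0 : 0 <= sig by case/andP: sg1 => h _; rewrite (le_trans _ h)// ltW.
  have sp' : solves f g u p a b.
    by apply: solves_head sp; rewrite ba lerDl.
  exists u, p; split => //.
    by move=> t /andP[at_ tb]; apply: Vp; rewrite at_ (le_trans tb)// ba lerDl.
  have -> : Num.max 0 (b - a - 1) = 0 by apply/max_idPl; rewrite ba; lra.
  rewrite mulr0 subr0 ba.
  by apply: Vp; rewrite lexx lerDl.
have [sig /andP[ds s1] [u [p [[mu uC sp pa] Vp Vend]]]] := Hd x a Vx.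
have sig0 : 0 < sig by exact: lt_le_trans ds.
have [bs|/ltW bs] := leP b (a + sig).
  exists u, p; split => //.
  - by split => //; exact: solves_head sp.
  - by move=> t /andP[at_ tb]; apply: Vp; rewrite at_ (le_trans tb).
  - have -> : Num.max 0 (b - a - 1) = 0 by apply/max_idPl; lra.
    by rewrite mulr0 subr0; apply: Vp; rewrite ab.
have Vx1 : V (p (a + sig)) <= c.
  by rewrite (le_trans Vend)// ge_max loc (le_trans _ Vx)// gerBl ltW.
have bk1 : b - (a + sig) <= k%:R * d.
  by move: bk; rewrite -natr1 mulrDl mul1r; lra.
have [v [q [[mv vC sq qa] Vq Vqend]]] := IH _ _ Vx1 bs bk1.
have asig : a <= a + sig by rewrite lerDl ltW.
have Vmax : Num.max lo (V (p (a + sig))) <= Num.max lo (V x).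
  rewrite ge_max le_max lexx /= (le_trans Vend)// ge_max !le_max lexx /=.
  by rewrite gerBl (ltW d0) orbT.
exists (splice (a + sig) u v), (splice (a + sig) p q); split.
- by apply: plan_cat => //; split.
- move=> t /andP[at_ tb]; rewrite /splice; case: ltP => ts.
    by apply: Vp; rewrite at_ ltW.
  by apply: (le_trans (Vq t _)); rewrite ?ts// lerD2r.
- rewrite /splice ltNge bs /= (le_trans Vqend)// lerD2r.
  set y := Num.max 0 (b - (a + sig) - 1); set z := Num.max 0 (b - a - 1).
  have y0 : 0 <= y by rewrite le_max lexx.
  have y1 : b - (a + sig) - 1 <= y by rewrite le_max lexx orbT.
  have yz : z <= 1 + y by rewrite ge_max; apply/andP; split; lra.
  have dz : d * z <= d + d * y by rewrite -{2}[d]mulr1 -mulrDr ler_wpM2l// ltW.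
  have dy : 0 <= d * y by rewrite mulr_ge0// ltW.
  move: Vend; rewrite !ge_max !le_max !lexx /= => /orP[h|h]; apply/orP; [left|right]; lra.
Qed.

(** One complete step is put before an iterated plan so that its gain pays for the final overshoot:
    above the floor, the plan then ends no higher than it started. The duration loses 2, one unit
    for this step and one for the truncated step. *)
Lemma window_plan (lo eta : R) : 0 < lo <= c -> 0 < eta -> exists2 d : R, 0 < d &
  forall x a b, V x <= c -> 1 <= b - a -> exists u p, [/\ plan a b x u p,
    (forall t, a <= t <= b -> V (p t) <= Num.max lo (V x) + eta),
    V (p b) <= Num.max (lo + eta) (V x) &
    V (p b) <= Num.max lo (V x - d * (b - a - 2)) + eta].
Proof.
move=> /andP[lo0 loc] eta0; have [d d0 Hd] := uniform_step lo0 eta0.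
have lo0c : 0 < lo <= c by rewrite lo0.
(* The overshoot of the iterated part is kept below the gain [d] of the first step. *)
pose eta' := Num.min eta d.
have eta'0 : 0 < eta' by rewrite lt_min eta0.
have eta'eta : eta' <= eta by rewrite ge_min lexx.
have eta'd : eta' <= d by rewrite ge_min lexx orbT.
have [d' d'0 Hd'] := iterated_plan lo0c eta'0.
exists d' => // x a b Vx ab.
have [sig /andP[ds s1] [u [p [[mu uC sp pa] Vp Vend]]]] := Hd x a Vx.
have sig0 : 0 < sig by exact: lt_le_trans ds.
have asig : a <= a + sig by rewrite lerDl ltW.
have bs : a + sig <= b by lra.
have Vx1 : V (p (a + sig)) <= c.
  by rewrite (le_trans Vend)// ge_max loc (le_trans _ Vx)// gerBl ltW.
have [v [q [[mv vC sq qa] Vq Vqend]]] := Hd' _ _ _ Vx1 bs.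
have Vmax : Num.max lo (V (p (a + sig))) <= Num.max lo (V x).
  rewrite ge_max le_max lexx /= (le_trans Vend)// ge_max !le_max lexx /=.
  by rewrite gerBl (ltW d0) orbT.
have pos : 0 <= d' * Num.max 0 (b - (a + sig) - 1).
  by rewrite mulr_ge0 ?(ltW d'0)// le_max lexx.
exists (splice (a + sig) u v), (splice (a + sig) p q); split.
- by apply: plan_cat => //; split.
- move=> t /andP[at_ tb]; rewrite /splice; case: ltP => ts.
    by apply: Vp; rewrite at_ ltW.
  by apply: (le_trans (Vq t _)); rewrite ?ts// lerD.
- rewrite /splice ltNge bs /= (le_trans Vqend)// -lerBrDr.
  rewrite ge_max; apply/andP; split.
    by rewrite lerBrDr le_max lerD2l eta'eta.
  rewrite lerBrDr le_max; move: Vend; rewrite !le_max => /orP[h|h]; apply/orP; [left|right]; lra.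
- rewrite /splice ltNge bs /= (le_trans Vqend)// lerD//.
  have h3 : d' * (b - a - 2) <= d' * Num.max 0 (b - (a + sig) - 1).
    by rewrite ler_wpM2l ?(ltW d'0)// le_max; apply/orP; right; lra.
  rewrite ge_max le_max lexx /= le_max.
  by move: Vend; rewrite !le_max => /orP[h|h]; apply/orP; [left|right]; lra.
Qed.

End WindowPlans.

(** * Sampling times and windows *)

Section SamplingTimes.
Context {R : realType}.
Variable T : nat -> R.
Hypotheses (T0 : T 0%N = 0) (T_lt : forall i, T i < T i.+1) (T_oo : T i @[i --> \oo] --> +oo).

Lemma time_le i j : (i <= j)%N -> T i <= T j.
Proof. by apply: (homo_leq (r := fun x y => x <= y)) => // [y x z|k]; [exact: le_trans|exact: ltW]. Qed.

Lemma time_unbounded (M : R) (i : nat) : exists2 k, (i < k)%N & M <= T k.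
Proof.
have [N _ HN] := (cvgryPge _).1 T_oo M.
by exists (maxn N i.+1); [rewrite leq_maxr|apply: HN; rewrite /= leq_maxl].
Qed.

Lemma window_times : exists w : nat -> nat,
  [/\ w 0%N = 0%N, (forall j, (w j < w j.+1)%N) &
      forall j, j.+1%:R <= T (w j.+1) - T (w j)].
Proof.
have /(_ _ _)/cid2 nx (j i : nat) := time_unbounded (T i + j.+1%:R) i.
pose w := fix w j := if j is j'.+1 then sval (nx (w j') j') else 0%N.
exists w; split => // j /=; case: (nx (w j) j) => //= k ik Tk.
by rewrite lerBrDl.
Qed.

Lemma sampling_index : exists idx : R -> nat, forall i t, T i <= t < T i.+1 -> idx t = i.
Proof.
pose P (t : R) (i : nat) := T i <= t < T i.+1.
exists (fun t => xget 0%N [set i | P t i]) => i t Pi.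
apply: xget_unique => // j /andP[Tj jT]; have /andP[Ti iT] := Pi.
apply/eqP; rewrite eqn_leq; apply/andP; split; rewrite leqNgt; apply/negP => /time_le h.
  by have := le_lt_trans Tj (lt_le_trans iT h); rewrite ltxx.
by have := le_lt_trans Ti (lt_le_trans jT h); rewrite ltxx.
Qed.

Lemma sampling_interval t : 0 <= t -> exists i, T i <= t < T i.+1.
Proof.
move=> t0; have ex : exists i, t < T i.
  have [k _ Tk] := time_unbounded (t + 1) 0.
  by exists k; rewrite (lt_le_trans _ Tk)// ltrDl.
case: (ex_minnP ex) => [[|i]] ti mini; first by move: ti; rewrite T0 ltNge t0.
exists i; rewrite ti andbT leNgt; apply/negP => /mini; by rewrite ltnn.
Qed.

End SamplingTimes.

Section WindowIndex.
Variable w : nat -> nat.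
Hypotheses (w0 : w 0%N = 0%N) (w_lt : forall j, (w j < w j.+1)%N).

Lemma window_le i j : (i <= j)%N -> (w i <= w j)%N.
Proof. by apply: (homo_leq (r := leq)) => // [? ? ?|k]; [exact: leq_trans|exact: ltnW]. Qed.

Lemma window_ge j : (j <= w j)%N.
Proof. by elim: j => // j IH; exact: leq_ltn_trans IH (w_lt j). Qed.

Lemma window_index : exists win : nat -> nat, forall i j,
  (w j <= i < w j.+1)%N <-> win i = j.
Proof.
have ex i : exists j, (i < w j.+1)%N by exists i; exact: window_ge.
exists (fun i => ex_minn (ex i)) => i j; case: ex_minnP => k ik mink; split => [/andP[ji ij]|<-].
  apply/eqP; rewrite eqn_leq mink//= leqNgt; apply/negP => kj.
  by have := window_le kj; rewrite leqNgt (leq_ltn_trans ji).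
rewrite ik andbT; case: k ik mink => [|k] ik mink; first by rewrite w0.
by rewrite leqNgt; apply/negP => /mink; rewrite ltnn.
Qed.

End WindowIndex.

(** * Levels between 0 and [c] *)

Section Levels.
Context {R : realType}.
Variable c : R.
Hypothesis c0 : 0 < c.

(** A decreasing two-sided sequence with limit 0 at $+\infty$ and [c] at $-\infty$. As [Negz k] is
    $-(k+1)$, the two halves meet at [level (-1) = 2c/3] and [level 0 = c/2]. *)
Definition level (m : int) : R :=
  match m with
  | Posz k => c / k.+2%:R
  | Negz k => c - c / k.+3%:R
  end.

Let div_lt k : c / k.+1%:R < c / k%:R \/ k = 0%N.
Proof.
case: k => [|k]; first by right.
by left; rewrite ltr_pM2l// ltf_pV2 ?posrE ?ltr0n// ltr_nat.
Qed.

Lemma level_lt m : level (m + 1) < level m.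
Proof.
case: m => [k|[|k]].
- have -> : Posz k + 1 = Posz k.+1 by lia.
  by have [] := div_lt k.+2.
- have -> : Negz 0 + 1 = Posz 0 by [].
  suff : c / 2 < c - c / 3 by [].
  rewrite -subr_gt0; have -> : c - c / 3 - c / 2 = c / 6 by field.
  exact: divr_gt0.
- have -> : Negz k.+1 + 1 = Negz k by lia.
  by rewrite /level ltrD2l ltrN2; have [] := div_lt k.+3.
Qed.

Lemma level_le (m m' : int) : m <= m' -> level m' <= level m.
Proof.
move=> mm; have -> : m' = m + Posz `|m' - m|%N by lia.
elim: `|_|%N => [|k IH]; first by rewrite addr0.
apply: le_trans IH; rewrite -addn1 PoszD addrA; exact/ltW/level_lt.
Qed.

Lemma level_gt0 m : 0 < level m.
Proof.
case: m => k /=; first by rewrite divr_gt0.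
by rewrite subr_gt0 ltr_pdivrMr// ltr_pMr// ltr1n.
Qed.

Lemma level_ltc m : level m < c.
Proof.
case: m => k /=; last by rewrite ltrBlDr ltrDl divr_gt0.
by rewrite ltr_pdivrMr// ltr_pMr// ltr1n.
Qed.

Let small (e : R) : 0 < e -> exists k : nat, c / k.+2%:R < e.
Proof.
move=> e0; exists (Num.truncn (c / e)); rewrite ltr_pdivrMr// mulrC -ltr_pdivrMr//.
by apply: (lt_trans (truncnS_gt _)); rewrite ltr_nat.
Qed.

Lemma exists_level_lt (e : R) : 0 < e -> exists m, level m < e.
Proof. by move=> /small[k ke]; exists (Posz k). Qed.

Lemma exists_level_ge (y : R) : y < c -> exists m, y <= level m.
Proof.
rewrite -subr_gt0 => /small[k kc]; exists (Negz k) => /=.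
have : c / k.+3%:R < c / k.+2%:R by have [] := div_lt k.+2.
by move: kc; set A := c / _; set B := c / _; lra.
Qed.

End Levels.

(** * The score-maximizing feedback *)

Section ScoreFeedback.
Context {R : realType} {n : nat}.
Local Notation state := 'rV[R]_n.
Local Notation vfield := (state -> state).
Variables f g : vfield.
Hypotheses (sf : smooth_field f) (sg : smooth_field g) (f0 : f 0 = 0).
Variable V : state -> R.
Hypotheses (sV : smooth V) (V0 : V 0 = 0) (Vpos : forall x, x != 0 -> 0 < V x).
Variables C c : R.
Hypotheses (C0 : 0 <= C) (c0 : 0 < c) (cV : compact [set x | V x <= c]).
Hypothesis descent : forall x, x != 0 -> V x <= c -> descent_at f g V C x.
Variable T : nat -> R.
Hypotheses (T0 : T 0%N = 0) (T_lt : forall i, T i < T i.+1) (T_oo : T i @[i --> \oo] --> +oo).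

Let A := level c.

(** [H m] is the index from which windows are long enough to gain a full level from level [m]; in
    shorter windows the level is merely recovered at the end. *)
Lemma window_levels : exists H : int -> nat, forall m j (x : state) a b,
  V x <= A m -> j.+1%:R <= b - a -> exists u p, [/\ plan f g C a b x u p,
    (forall t, a <= t <= b -> V (p t) <= A (m - 1)) &
    V (p b) <= A (m + (H m <= j)%N)].
Proof.
suff H1 m : exists h : nat, forall j (x : state) a b,
  V x <= A m -> j.+1%:R <= b - a -> exists u p, [/\ plan f g C a b x u p,
    (forall t, a <= t <= b -> V (p t) <= A (m - 1)) &
    V (p b) <= A (m + (h <= j)%N)].
  have /(_ _)/cid H2 m := H1 m.
  by exists (fun m => sval (H2 m)) => m; case: (H2 m).
(* Half of the target level is left for the overshoot, so [lo + eta <= A (m + 1)]; the other bound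
   on [eta] keeps the plan below level [m - 1]. *)
pose lo := A (m + 1) / 2; pose eta := Num.min lo (A (m - 1) - A m).
have lo0 : 0 < lo by rewrite divr_gt0// level_gt0.
have A1 : A m < A (m - 1) by rewrite -{1}(subrK 1 m); exact: level_lt.
have A2 : A (m + 1) < A m by exact: level_lt.
have eta0 : 0 < eta by rewrite lt_min lo0 subr_gt0.
have loc : 0 < lo <= c.
  rewrite lo0 /= /lo; have := level_ltc c0 (m + 1); rewrite -/A.
  have := level_gt0 c0 (m + 1); rewrite -/A; lra.
have loeta : lo + eta <= A (m + 1).
  have : eta <= lo by rewrite ge_min lexx.
  rewrite /lo; lra.
have [d d0 Hd] := window_plan sf sg f0 sV V0 C0 cV descent loc eta0.
(* From this index on, [d * (b - a - 2)] exceeds [A m], hence the whole initial value of [V]. *)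
exists (Num.truncn (A m / d)).+2 => j x a b Vx jab.
have ab : 1 <= b - a by rewrite (le_trans _ jab)// ler1n.
have Vxc : V x <= c by rewrite (le_trans Vx)// ltW// level_ltc.
have [u [p [pl Vp Vp1 Vp2]]] := Hd x a b Vxc ab.
exists u, p; split => //.
- move=> t tab; apply: (le_trans (Vp t tab)).
  have h1 : eta <= A (m - 1) - A m by rewrite ge_min lexx orbT.
  rewrite -lerBrDr ge_max; apply/andP; split; last by lra.
  by have := le_trans loeta (ltW A2); lra.
- case: leqP => hj /=.
    by rewrite addr0 (le_trans Vp1)// ge_max Vx andbT (le_trans loeta)//; exact: ltW.
  apply: (le_trans Vp2); apply: (le_trans _ loeta); rewrite lerD2r ge_max lexx /=.
  have : A m <= d * (b - a - 2).
    rewrite mulrC -ler_pdivrMr// ltW// (lt_le_trans (truncnS_gt _))// lerBrDr.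
    by rewrite (le_trans _ jab)// -natrD ler_nat addn2 ltnS.
  by move: Vx; lra.
Qed.

Variables (w win : nat -> nat) (idx : R -> nat) (H : int -> nat).
Hypotheses (w_lt : forall j, (w j < w j.+1)%N).
Hypothesis w0 : w 0%N = 0%N.
Hypothesis w_gap : forall j, j.+1%:R <= T (w j.+1) - T (w j).
Hypothesis winP : forall i j, (w j <= i < w j.+1)%N <-> win i = j.
Hypothesis idxP : forall i t, T i <= t < T i.+1 -> idx t = i.
Hypothesis HP : forall m j (x : state) a b,
  V x <= A m -> j.+1%:R <= b - a -> exists u p, [/\ plan f g C a b x u p,
    (forall t, a <= t <= b -> V (p t) <= A (m - 1)) &
    V (p b) <= A (m + (H m <= j)%N)].

Let wend i := w (win i).+1.

Let lt_wend i : (i < wend i)%N.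
Proof. by have /andP[] := (winP i (win i)).2 erefl. Qed.

(* The score [m] rates a plan for the rest of the window containing [i]. *)
Definition good_plan i x (m : int) u p := [/\ plan f g C (T i) (T (wend i)) x u p,
  (forall t, T i <= t <= T (wend i) -> V (p t) <= A (m - 1)) &
  V (p (T (wend i))) <= A (m + (H m <= win i)%N)].

Definition has_score i x m := exists u p, good_plan i x m u p.

Lemma score_start i j x m : w j = i -> V x <= A m -> has_score i x m.
Proof.
move=> wj Vx; have winj : win i = j by apply/winP; rewrite -wj leqnn w_lt.
have [u [p [pl Vp Vend]]] := HP Vx (w_gap j).
by exists u, p; rewrite /good_plan /wend winj -wj.
Qed.

(** Both requirements on a plan concern only the future and the end of the window, and the gain
    depends only on the index of the window. *)
Lemma score_tail i x m u p : good_plan i x m u p -> win i.+1 = win i ->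
  good_plan i.+1 (p (T i.+1)) m u p.
Proof.
move=> [[mu uC sp pa] Vp Vend] wi; rewrite /good_plan /wend wi -/(wend i).
split => //; first by split => //; apply: solves_tail sp; exact/ltW.
by move=> t /andP[it te]; apply: Vp; rewrite te (le_trans _ it)// ltW.
Qed.

Let A_le m m' : m <= m' -> A m' <= A m. Proof. exact: level_le. Qed.

(** For a strictly smaller [m'] one has [m' + 1 <= m], so even the stronger terminal requirement for
    [m'] follows from that for [m]. *)
Lemma good_planW i x (m m' : int) u p : m' <= m -> good_plan i x m u p -> good_plan i x m' u p.
Proof.
rewrite le_eqVlt => /predU1P[-> //|mm] [pl Vp Vend]; split => //.
  by move=> t tab; rewrite (le_trans (Vp t tab))// A_le// lerB// ltW.
rewrite (le_trans Vend)// A_le//; case: (H m <= _)%N; case: (H m' <= _)%N => /=; lia.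
Qed.

Lemma solves_zero a b : solves f g (fun=> 0) (fun=> 0) a b.
Proof.
move=> j t _; have -> : (fun s : R => dyn f g 0 0 0 j) = (fun=> 0).
  by apply/funext => s; rewrite /dyn f0 scale0r addr0 mxE.
rewrite Rintegral_cst// mul0r addr0; split => //.
by apply: integrable0.
Qed.

(** For [x != 0] the scores are bounded above, since [V x <= A (m - 1)] and the levels tend to 0. A
    plan of maximal score is good for all smaller scores by [good_planW]. *)
Lemma best_plan i x : exists up : (R -> R) * (R -> state),
  [/\ measurable_fun setT up.1, (forall s, `|up.1 s| <= C) &
      forall m, has_score i x m -> good_plan i x m up.1 up.2].
Proof.
(* At the origin the scores are unbounded, but the zero control is good for all of them at once. *)
have [->|x0] := eqVneq x 0.
  exists (fun=> 0, fun=> 0) => /=; split; [exact: measurable_cst|by rewrite normr0|].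
  move=> m _; split; last by rewrite V0 ltW// level_gt0.
    by split; [exact: measurable_cst|by rewrite normr0|exact: solves_zero|].
  by move=> t _; rewrite V0 ltW// level_gt0.
(* A state without score gets the zero control as a default, to keep the feedback measurable and
   bounded everywhere. *)
have [[m0 sm0]|no] := pselect (exists m, has_score i x m); last first.
  exists (fun=> 0, fun=> 0) => /=; split; [exact: measurable_cst|by rewrite normr0|].
  by move=> m sm; case: no; exists m.
have [M AM] := exists_level_lt c (Vpos x0).
have bounded m : has_score i x m -> m <= M.
  move=> [u [p [[_ _ _ pa] Vp _]]]; have := Vp (T i).
  rewrite lexx /= (time_le T_lt (ltnW (lt_wend i))) pa => /(_ isT) VA.
  rewrite leNgt; apply/negP => Mm.
  have h : M <= m - 1 by lia.
  by have := lt_le_trans AM (le_trans VA (A_le h)); rewrite ltxx.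
pose Q (k : nat) := `[< has_score i x (m0 + Posz k) >].
have exQ : exists k, Q k by exists 0%N; apply/asboolP; rewrite addr0.
have ubQ k : Q k -> (k <= `|M - m0|)%N by move=> /asboolP /bounded; lia.
case: (ex_maxnP exQ ubQ) => k /asboolP[u [p gp]] maxk.
exists (u, p) => /=; have [[mu uC _ _] _ _] := gp; split => // m sm.
apply: good_planW gp; have [m0m|mm0] := leP m0 m; last by lia.
have : Q `|m - m0|%N by apply/asboolP; have -> : m0 + Posz `|m - m0| = m by lia.
by move=> /maxk; lia.
Qed.

Let best i x := sval (cid (best_plan i x)).

Let bestP i x : [/\ measurable_fun setT (best i x).1, (forall s, `|(best i x).1 s| <= C) &
      forall m, has_score i x m -> good_plan i x m (best i x).1 (best i x).2].
Proof. exact: svalP (cid (best_plan i x)). Qed.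

Definition score_feedback (t : R) (x : state) : 'rV[R]_1 := const_mx ((best (idx t) x).1 t).

Let F (x : state) (u : 'rV[R]_1) : state := f x + u 0 0 *: g x.
Let Omega : set state := [set x | V x < c].
Let traj := trajectory F T Omega score_feedback.

Let idxT t : 0 <= t -> T (idx t) <= t < T (idx t).+1.
Proof. by move=> /(sampling_interval T0 T_oo)[i it]; rewrite (idxP it). Qed.

Lemma traj_solves pi i : traj pi ->
  solves f g (best i (pi (T i))).1 pi (T i) (T i.+1).
Proof.
move=> tr; have [_ Ht] := tr i.
pose u s := score_feedback s (pi (T i)) 0 0.
have : solves f g u pi (T i) (T i.+1).
  by move=> j t tab; have [h1 h2] := Ht t tab j.
apply: solves_eq => // s sT; rewrite /u /score_feedback mxE.
by rewrite (idxP sT).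
Qed.

Let next_score i m := if i.+1 == wend i then m + (H m <= win i)%N else m.

(** By uniqueness the trajectory follows the chosen plan up to the next sampling time. Inside a
    window the tail of this plan still witnesses the score [m]; at the end of the window the level
    reached starts a new one. *)
Lemma traj_step pi i m : traj pi -> has_score i (pi (T i)) m ->
  (forall t, T i <= t <= T i.+1 -> V (pi t) <= A (m - 1)) /\
  has_score i.+1 (pi (T i.+1)) (next_score i m).
Proof.
move=> tr sc; have sp := @traj_solves pi i tr.
have [mu uC /(_ m sc) gp] := bestP i (pi (T i)).
set u := (best i (pi (T i))).1 in sp mu uC gp; set p := (best i (pi (T i))).2 in gp.
have [[_ _ sq qa] Vp Vend] := gp.
have iend : T i.+1 <= T (wend i) by apply: time_le => //; exact: lt_wend.
have eqp t : T i <= t <= T i.+1 -> pi t = p t.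
  by apply: (solves_unique sf sg sp (solves_head iend sq) uC); rewrite qa.
split; first by move=> t tT; rewrite eqp// Vp//; case/andP: tT => -> h; exact: le_trans iend.
have eqe : pi (T i.+1) = p (T i.+1) by rewrite eqp// lexx ltW.
rewrite eqe /next_score; case: eqP => [ie|ine].
  by apply: (@score_start i.+1 (win i).+1) => //; rewrite ie.
exists u, p; apply: score_tail => //; apply/winP.
have /andP[h1 h2] := (winP i (win i)).2 erefl.
by rewrite (leq_trans h1)//= ltn_neqAle h2 andbT; apply/eqP.
Qed.

Lemma next_score_ge i m : m <= next_score i m.
Proof. by rewrite /next_score; case: ifP => // _; lia. Qed.

Lemma traj_score_mono pi m i0 : traj pi -> has_score i0 (pi (T i0)) m ->
  forall i, (i0 <= i)%N -> exists2 m', m <= m' & has_score i (pi (T i)) m'.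
Proof.
move=> tr sc i; elim: i => [|i IH] i0i.
  by exists m => //; move: i0i; rewrite leqn0 => /eqP <-.
move: i0i; rewrite leq_eqVlt => /predU1P[<-|]; first by exists m.
rewrite ltnS => /IH[m' mm' sc']; have [_ sc''] := traj_step tr sc'.
by exists (next_score i m') => //; rewrite (le_trans mm')// next_score_ge.
Qed.

Lemma traj_bound pi m i0 : traj pi -> has_score i0 (pi (T i0)) m ->
  forall t, T i0 <= t -> V (pi t) <= A (m - 1).
Proof.
move=> tr sc t it; have t0 : 0 <= t by rewrite (le_trans _ it)// -T0 time_le.
have /andP[h1 h2] := idxT t0.
have ii : (i0 <= idx t)%N.
  rewrite leqNgt; apply/negP => /(time_le T_lt) h.
  by have := lt_le_trans h2 (le_trans h it); rewrite ltxx.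
have [m' mm' sc'] := traj_score_mono tr sc ii.
have [Vt _] := traj_step tr sc'.
by apply: (le_trans (Vt t _)); [rewrite h1 ltW|apply: A_le; lia].
Qed.

(** [i] is the last sampling interval of a window [j >= H m]. Unless the score has grown before, it
    is still [m] there, and the end of this window brings the gain. *)
Lemma traj_score_grows pi m i0 : traj pi -> has_score i0 (pi (T i0)) m ->
  exists2 i, (i0 <= i)%N & exists2 m', m + 1 <= m' & has_score i (pi (T i)) m'.
Proof.
move=> tr sc; pose j := maxn i0 (H m); pose i := (w j.+1).-1.
have wj1 : (0 < w j.+1)%N by exact: leq_ltn_trans (w_lt j).
have iE : i.+1 = w j.+1 by rewrite prednK.
have wini : win i = j by apply/winP; rewrite iE leqnn andbT -ltnS iE w_lt.
have i0i : (i0 <= i)%N.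
  rewrite -ltnS iE (leq_trans _ (window_ge w_lt j.+1))// ltnS; exact: leq_maxl.
have [m' mm' sc'] := traj_score_mono tr sc i0i.
have [m1|m1] := leP (m + 1) m'; first by exists i => //; exists m'.
have mE : m' = m by lia.
have [_] := traj_step tr sc'; rewrite /next_score /wend wini iE eqxx mE leq_maxr /= => sc''.
exists i.+1; first exact: leqW.
by exists (m + 1) => //; rewrite iE.
Qed.

Lemma traj_score_unbounded pi m k : traj pi -> has_score 0 (pi (T 0%N)) m ->
  exists i, exists2 m', m + Posz k <= m' & has_score i (pi (T i)) m'.
Proof.
move=> tr sc; elim: k => [|k [i [m' mm' sc']]]; first by exists 0%N, m; rewrite ?addr0.
have [i' _ [m'' mm'' sc'']] := traj_score_grows tr sc'.
exists i', m'' => //; lia.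
Qed.

Lemma initial_score x : V x < c -> exists m, has_score 0 x m.
Proof.
move=> /(exists_level_ge c0)[m Vm]; exists m; exact: (score_start w0).
Qed.

Lemma score_lt i x m : has_score i x m -> V x < c.
Proof.
move=> [u [p [[_ _ _ pa] Vp _]]]; have := Vp (T i).
rewrite lexx /= (time_le T_lt (ltnW (lt_wend i))) pa => /(_ isT) /le_lt_trans; apply.
exact: level_ltc.
Qed.

(** Starting one level lower than required compensates for the level that a plan may lose on its
    way. *)
Lemma feedback_stable e : 0 < e -> exists2 d, 0 < d & forall pi, traj pi ->
  V (pi 0) <= d -> forall t, 0 <= t -> V (pi t) < e.
Proof.
move=> e0; have [m Ae] := exists_level_lt c e0.
exists (A (m + 1)); first exact: level_gt0.
move=> pi tr Vd t t0; have sc : has_score 0 (pi (T 0%N)) (m + 1).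
  by apply: (score_start w0); rewrite T0.
apply: le_lt_trans Ae; rewrite -T0 in t0.
by have := traj_bound tr sc t0; rewrite addrK.
Qed.

Lemma feedback_attractive pi e : traj pi -> 0 < e -> exists t0, forall t, t0 <= t -> V (pi t) < e.
Proof.
move=> tr e0; have [M Ae] := exists_level_lt c e0.
have [Om _] := tr 0%N.
have [m sc] := initial_score Om.
have [i [m' mm' sc']] := traj_score_unbounded (absz (M + 1 - m)%R) tr sc.
exists (T i) => t it; apply: le_lt_trans Ae.
by rewrite (le_trans (traj_bound tr sc' it))// A_le//; lia.
Qed.

(** The sampled states [xs] are built by recursion, each from the chosen plan at the previous one,
    and the pieces of these plans are glued. A score exists at every sample, so the choice is always
    a genuine plan. *)
Lemma feedback_exists x : V x < c -> exists pi, traj pi /\ pi 0 = x.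
Proof.
move=> /initial_score[m0 sc0].
pose xs := fix xs i := if i is i'.+1 then (best i' (xs i')).2 (T i'.+1) else x.
have sc i : exists m, has_score i (xs i) m.
  elim: i => [|i [m sc]]; first by exists m0.
  have [mu uC /(_ m sc) gp] := bestP i (xs i).
  set p := (best i (xs i)).2 in gp *.
  have xsE : xs i.+1 = p (T i.+1) by [].
  have [[_ _ sp pa] Vp Vend] := gp.
  have [ie|ine] := eqVneq i.+1 (wend i).
    by exists (m + (H m <= win i)%N); rewrite xsE; apply: (@score_start i.+1 (win i).+1) => //; rewrite ie.
  exists m, (best i (xs i)).1, p; rewrite xsE; apply: score_tail => //; apply/winP.
  have /andP[h1 h2] := (winP i (win i)).2 erefl.
  by rewrite (leq_trans h1)//= ltn_neqAle h2 andbT.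
pose pi t := (best (idx t) (xs (idx t))).2 t.
have idxTi i : idx (T i) = i by apply: idxP; rewrite lexx T_lt.
have bestTi i : (best i (xs i)).2 (T i) = xs i.
  have [m sci] := sc i; have [_ _ /(_ m sci) [[_ _ _ ->]]] := bestP i (xs i).
  by [].
have piT i : pi (T i) = xs i by rewrite /pi idxTi bestTi.
exists pi; split; last by rewrite -T0 piT.
move=> i; have [m sci] := sc i; split; first by rewrite piT; exact: score_lt sci.
have [_ _ /(_ m sci) [[_ _ sp _] _ _]] := bestP i (xs i).
have iend : T i.+1 <= T (wend i) by apply: time_le => //; exact: lt_wend.
have : solves f g (fun s => score_feedback s (pi (T i)) 0 0) pi (T i) (T i.+1).
  apply: solves_eq (solves_head iend sp) => [s sT|s /andP[si]].
    by rewrite /score_feedback mxE (idxP sT) piT.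
  rewrite le_eqVlt => /predU1P[->|sT]; first by rewrite piT.
  by rewrite /pi (idxP (i := i)) ?si.
by move=> sol t tab j; exact: (sol j t tab).
Qed.

Lemma measurable_feedback x j :
  measurable_fun (`[0, +oo[ : set R) (fun t : R => score_feedback t x 0 j : R).
Proof.
have -> : [set` `[0, +oo[] = \bigcup_i [set` `[T i, T i.+1[].
  apply/seteqP; split => t /=.
    rewrite in_itv/= andbT => /(sampling_interval T0 T_oo)[i it].
    by exists i => //=; rewrite in_itv.
  move=> [i _ /=]; rewrite !in_itv/= andbT => /andP[it _].
  by rewrite (le_trans _ it)// -T0 time_le.
apply/measurable_fun_bigcup => // i.
have [mu _ _] := bestP i x.
have mi : measurable_fun `[T i, T i.+1[ (best i x).1 by exact: measurable_funS mu.
apply: eq_measurable_fun mi => t; rewrite inE/= in_itv/= => it.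
by rewrite /score_feedback mxE (idxP it).
Qed.

Lemma feedback_le t x : enorm (score_feedback t x) <= C.
Proof.
rewrite /enorm big_ord1 sqrtr_sqr mxE.
by have [_ + _] := bestP (idx t) x; exact.
Qed.

End ScoreFeedback.

(** * Euclidean norm and sublevel sets of [V] *)

Section EuclideanNorm.
Context {R : realType} {n : nat}.
Local Notation state := 'rV[R]_n.
Implicit Type x : state.

Lemma norm_le_enorm x : `|x| <= enorm x.
Proof.
apply: norm_le_coord => [|j]; first exact: sqrtr_ge0.
rewrite -sqrtr_sqr ler_wsqrtr// (bigD1 j)//= lerDl.
by apply: sumr_ge0 => i _; exact: sqr_ge0.
Qed.

Lemma enorm_le_norm x : enorm x <= Num.sqrt n%:R * `|x|.
Proof.
rewrite -[X in _ * X]normr_id -sqrtr_sqr -sqrtrM// ler_wsqrtr//.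
apply: (@le_trans _ _ (\sum_(i < n) `|x| ^+ 2)); last by rewrite sumr_const card_ord mulr_natl.
apply: ler_sum => i _; rewrite -[leLHS]real_normK ?num_real//.
by rewrite lerXn2r ?nnegrE// coord_le_norm.
Qed.

Lemma compact_enorm_bounded (A : set state) : compact A ->
  exists2 M : R, 0 <= M & forall x, A x -> enorm x <= M.
Proof.
move=> /compact_bounded[M0 [_ HM]].
have M1 : M0 < `|M0| + 1 by rewrite ltr_pwDr// ler_norm.
exists (Num.sqrt n%:R * (`|M0| + 1)); first by rewrite mulr_ge0// sqrtr_ge0.
move=> x Ax; apply: (le_trans (enorm_le_norm x)).
by rewrite ler_wpM2l ?sqrtr_ge0//; exact: (HM _ M1 x Ax).
Qed.

Section Lyapunov.
Variable V : state -> R.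
Hypotheses (Vc : continuous V) (V0 : V 0 = 0) (Vpos : forall x, x != 0 -> 0 < V x).
Hypothesis V_proper : proper_fun V.

Lemma posdef_ge0 x : 0 <= V x.
Proof. by have [->|/Vpos/ltW//] := eqVneq x 0; rewrite V0. Qed.

Lemma sublevel_compact (c : R) : compact [set x | V x <= c].
Proof.
have -> : [set x | V x <= c] = V @^-1` `[0, c].
  by apply/seteqP; split => x /=; rewrite in_itv/= posdef_ge0.
by apply: V_proper; exact: segment_compact.
Qed.

Lemma nbhs_sublevel (c : R) : 0 < c -> nbhs (0 : state) [set x | V x < c].
Proof.
move=> c0; have := @Vc 0; rewrite /continuous_at V0 => /cvgr_lt; exact.
Qed.

(** [V] attains a positive minimum on the part of the compact set [V x <= 1] away from the origin,
    unless this part is empty. *)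
Lemma sublevel_small (e : R) : 0 < e -> exists2 d, 0 < d & forall x, V x < d -> enorm x <= e.
Proof.
move=> e0; pose K := [set x | V x <= 1] `&` [set x : state | e / (Num.sqrt n%:R + 1) <= `|x|].
have n0 : 0 < Num.sqrt n%:R + 1 :> R by rewrite ltr_wpDl// sqrtr_ge0.
have small x : `|x| < e / (Num.sqrt n%:R + 1) -> enorm x <= e.
  move=> xe; apply: (le_trans (enorm_le_norm x)).
  rewrite ltr_pdivlMr// in xe; apply: le_trans (ltW xe).
  by rewrite mulrC ler_wpM2l// lerDl.
have cK : compact K.
  apply: compact_closedI; first exact: sublevel_compact.
  rewrite (_ : [set x | _] = (fun x : state => `|x|) @^-1` [set y | e / (Num.sqrt n%:R + 1) <= y])//.
  apply: closed_comp; last exact: closed_ge.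
  by move=> y _; exact: norm_continuous.
have [[x0 Kx0]|no] := pselect (K !=set0); last first.
  exists 1 => // x Vx; apply: small; rewrite ltNge; apply/negP => h.
  by apply: no; exists x; split => //=; exact: ltW.
have [y /set_mem[_ /= ye] ymin] : exists2 y, y \in K & forall x, x \in K -> V y <= V x.
  apply: EVT_min_rV => //; first by exists x0.
  exact: continuous_subspaceT.
have Vy : 0 < V y.
  by apply: Vpos; rewrite -normr_gt0 (lt_le_trans _ ye)// divr_gt0.
exists (Num.min 1 (V y)); first by rewrite lt_min ltr01.
move=> x; rewrite lt_min => /andP[x1 xy]; apply: small; rewrite ltNge; apply/negP => h.
have : x \in K by apply/mem_set; split => //=; exact: ltW.
by move/ymin; rewrite leNgt xy.
Qed.

End Lyapunov.

End EuclideanNorm.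

(** * A common bound for the controls *)

Section DescentOnSublevels.
Context {R : realType} {n : nat}.
Local Notation state := 'rV[R]_n.
Variables (f g : state -> state) (V : state -> R).
Hypotheses (sf : smooth_field f) (sg : smooth_field g) (sV : smooth V).
Variables (theta : state -> R) (xi : R -> R).
Hypotheses (theta_ge0 : forall x, 0 <= theta x) (xi_ge0 : forall s, 0 <= s -> 0 <= xi s).
Hypothesis xi_cont : {within `[0, +oo[, continuous xi}.
Hypothesis cond1 : forall x, `|lieD f V x + theta x| <= xi (enorm x) * `|lieD g V x|.
Hypothesis cond2 : forall x, x != 0 -> lieD g V x != 0 \/
  (lieD g V x = 0 /\ (lieD f V x < 0 \/ condB f g V x)).

(** Condition (1) is what keeps the control bounded as [lieD g V x] tends to 0: the size needed is
    [xi (enorm x) + 1], bounded on compact sets, while (A) takes 0 and (B) at most 1. *)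
Lemma exists_descent_bound (A : set state) : compact A ->
  exists2 C : R, 0 < C & forall x, x != 0 -> A x -> descent_at f g V C x.
Proof.
move=> /compact_enorm_bounded[M M0 HM].
have [B HB] : exists B : R, forall s, 0 <= s <= M -> xi s <= B.
  have sub : [set` `[0, M]] `<=` [set` `[0, +oo[].
    by move=> s /=; rewrite !in_itv/= andbT => /andP[].
  have [s0 _ Hs] := EVT_max M0 (continuous_subspaceW sub xi_cont).
  by exists (xi s0) => s sM; apply: Hs; rewrite in_itv.
exists (`|B| + 1); first by rewrite ltr_wpDl.
move=> x x0 Ax; have [gV|[gV [fV|cB]]] := cond2 x0.
- have e0 : 0 <= enorm x by exact: sqrtr_ge0.
  have xiB : xi (enorm x) <= B by apply: HB; rewrite e0 HM.
  (* By condition (1) this control gives a derivative of [V] at most [- theta x] minus the absolute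
     value of [lieD g V x]. *)
  pose u := - (xi (enorm x) + 1) * Num.sg (lieD g V x).
  have uE : `|u| = xi (enorm x) + 1.
    by rewrite normrM normrN normr_sg gV mulr1 ger0_norm// addr_ge0// xi_ge0.
  apply: (@descent_atS _ _ f g V `|u|).
    by rewrite uE lerD2r (le_trans xiB)// ler_norm.
  apply: descent_at_lt0 => //.
  have -> : lieD (f + u *: g) V x = lieD f V x - (xi (enorm x) + 1) * `|lieD g V x|.
    rewrite lieDDl_at lieDZl_at -[u *: _]/(u * _) normrEsg mulrA; congr (_ + _).
    by rewrite /u !mulNr.
  have gV0 : 0 < `|lieD g V x| by rewrite normr_gt0.
  have h := le_trans (ler_norm _) (cond1 x).
  rewrite mulrDl mul1r opprD addrA; have := theta_ge0 x.
  by move: h gV0; set a := xi _ * _; lra.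
- apply: (@descent_atS _ _ f g V `|0|); first by rewrite normr0 addr_ge0.
  by apply: descent_at_lt0 => //; rewrite scale0r addr0.
- apply: (@descent_atS _ _ f g V 1); first by rewrite lerDr.
  exact: condB_descent.
Qed.

End DescentOnSublevels.

Theorem proposition3 (R : realType) (n : nat) (f g : 'rV[R]_n -> 'rV[R]_n)
    (f_smooth : smooth f) (g_smooth : smooth g) (f0 : f 0 = 0)
    (V : 'rV[R]_n -> R)
    (V_smooth : smooth V) (V_posdef : posdef V) (V_proper : proper_fun V)
    (cond1 : exists (theta : 'rV[R]_n -> R) (xi : R -> R),
       [/\ continuous theta, (forall w, 0 <= theta w),
           {within `[0, +oo[, continuous xi}, (forall s, 0 <= s -> 0 <= xi s)
         & forall w, `|lieD f V w + theta w| <= xi (enorm w) * `|lieD g V w| ])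
    (cond2 : forall x, x != 0 ->
       lieD g V x != 0 \/
       (lieD g V x = 0 /\ (lieD f V x < 0 \/ condB f g V x))) :
  BSDF_SGAS (fun (x : 'rV[R]_n) (u : 'rV[R]_1) => f x + u 0 0 *: g x).
Proof.
have sf := smooth_smooth_field f_smooth; have sg := smooth_smooth_field g_smooth.
have Vc := smooth_continuous V_smooth; have [V0 Vpos] := V_posdef.
have [theta [xi [_ th0 xic xi0 c1]]] := cond1.
move=> r T r0 [T0 T_lt T_oo _].
have [B B0 HB] := @bounded_on_ball _ _ V r Vc.
(* [B] bounds [V] on the ball of radius [r], so the open sublevel set of [c] is an admissible
   [Omega]. *)
pose c := B + 1; have c0 : 0 < c by rewrite ltr_wpDl.
have cV := @sublevel_compact _ _ V V0 Vpos V_proper c.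
have [C C0 descent] := exists_descent_bound sf sg V_smooth th0 xi0 xic c1 cond2 cV.
have C_ge0 := ltW C0.
have [H HP] := window_levels sf sg f0 V_smooth V0 C_ge0 c0 cV descent.
have [w [w0 w_lt w_gap]] := window_times T_oo.
have [win winP] := window_index w0 w_lt.
have [idx idxP] := sampling_index T_lt.
pose k := score_feedback g f0 V0 Vpos C_ge0 c0 T_lt idx H w0 winP.
have k_le t x : enorm (k t x) <= C by exact: feedback_le.
(* The bound [C] holds at all times, so [tau = 1] is an arbitrary choice. *)
exists [set x | V x < c], k; split; last by exists C; split => //; exists 1.
- exact: nbhs_sublevel.
- move=> x /= xr; have := HB x (le_trans (norm_le_enorm x) xr).
  by move=> /(le_trans (ler_norm _)) VB; rewrite (le_lt_trans VB)// ltrDl.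
split.
- move=> x _; split; first by move=> j; exact: measurable_feedback.
  by exists C; apply: aeW => t _.
- by move=> x; exact: feedback_exists HP _.
- move=> e e0; have [d d0 small] := sublevel_small Vc V0 Vpos V_proper e0.
  have [d' d'0 stab] :=
    feedback_stable sf sg f0 V0 Vpos C_ge0 c0 T0 T_lt T_oo w_lt w0 w_gap winP idxP HP d0.
  have [rho /= rho0 Hrho] := (nbhs_ballP _ _).1 (nbhs_sublevel Vc V0 d'0).
  exists (rho / 2); first exact: divr_gt0.
  move=> pi tr pi0 t t0; apply: small; apply: stab => //; apply/ltW/Hrho.
  rewrite -ball_normE /= sub0r normrN (le_lt_trans (norm_le_enorm _))//.
  by rewrite (le_lt_trans pi0)// ltr_pdivrMr// ltr_pMr// ltr1n.
- move=> pi tr; apply/cvgrPdist_le => e e0.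
  have [d d0 small] := sublevel_small Vc V0 Vpos V_proper e0.
  have [t0 Ht0] := feedback_attractive sf sg T0 T_oo w_lt w_gap idxP HP tr d0.
  exists t0; split; first exact: num_real.
  move=> t tt0 /=; rewrite sub0r normrN (le_trans (norm_le_enorm _))//.
  exact/small/Ht0/ltW.
Qed.
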